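(* Let $D:\mathcal E\to\mathcal E$, $Df=f'$, be the differentiation operator on the space $\mathcal E$ of entire functions on $\mathbb C$. **(i)** For any $c>0$ there is an entire $D$-frequently hypercyclic function $f$ such that $$M_f(r)\le c\,\frac{e^{r}}{r^{1/4}}\qquad\text{for all } r>0 .$$ This estimate is optimal: every entire $D$-frequently hypercyclic function $f$ satisfies $\limsup_{r\to\infty} r^{1/4}e^{-r}M_f(r)>0$. **(ii)** For $p\in(1,\infty]$ put $a(p)=1/4$ if $p\in[2,\infty]$ and $a(p)=1/(2p)$ if $p\in(1,2]$. Given $c>0$ and $p\in(1,\infty]$ there is an entire $D$-frequently hypercyclic function $f$ with $$M_{f,p}(r)\le c\,\frac{e^{r}}{r^{a(p)}}\qquad\text{for all } r>0 .$$ This estimate is optimal: for every $p\in(1,\infty]$, every entire $D$-frequently hypercyclic function $f$ satisfies $\limsup_{r\to\infty} r^{a(p)}e^{-r}M_{f,p}(r)>0$. **(iii)** Given any increasing function $\phi:(0,\infty)\to[1,\infty)$ with $\lim_{r\to\infty}\phi(r)=\infty$, there is an entire $D$-frequently hypercyclic function $f$ with $$M_{f,1}(r)\le \phi(r)\,\frac{e^{r}}{r^{1/2}}\qquad\text{for all } r>0 .$$ This estimate is optimal: every entire $D$-frequently hypercyclic function $f$ satisfies $\limsup_{r\to\infty} r^{1/2}e^{-r}M_{f,1}(r)=\infty$.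
   Context: $\mathcal E$ is the space of entire functions on $\mathbb C$ with the compact-open topology (uniform convergence on compact sets). An entire function $f$ is called $D$-frequently hypercyclic if for every non-empty open set $U\subset\mathcal E$ the set $A=\{n\ge 1: D^nf\in U\}$ (where $D^nf=f^{(n)}$ is the $n$-th derivative) has positive lower density, i.e. $$\liminf_{n\to\infty}\frac1n\,\#\big(A\cap\{1,\dots,n\}\big)>0 .$$ For an entire function $f$, $r>0$ and $p\in[1,\infty)$, $$M_{f,p}(r)=\Big(\frac1{2\pi}\int_0^{2\pi}|f(re^{i\theta})|^p\,d\theta\Big)^{1/p},\qquad M_{f,\infty}(r)=M_f(r)=\sup_{\theta}|f(re^{i\theta})| .$$ *)

(* Defs.v *)
From mathcomp Require Import all_boot all_order all_algebra.
From mathcomp Require Import all_classical all_reals all_analysis.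
From mathcomp Require Import complex.

Set Implicit Arguments.
Unset Strict Implicit.
Unset Printing Implicit Defensive.

Import Order.TTheory GRing.Theory Num.Theory.
Import numFieldNormedType.Exports.

Local Open Scope classical_set_scope.
Local Open Scope ring_scope.

(* [R[i]] seen as a numeric field: the topology and the derivatives are
   attached to this structure and not to the bare type [R[i]]. *)
Definition Cfield (R : realType) : numClosedFieldType := R[i].

Definition modulus (R : realType) (z : Cfield R) : R := ComplexField.Normc.normc z.

(* Differentiability is with respect to the field [Cfield R], i.e. it is
   complex differentiability. *)
Definition entire (R : realType) : set (Cfield R -> Cfield R) :=
  [set f : Cfield R -> Cfield R |
    forall z : Cfield R, derivable f z (1 : Cfield R)].

(* The open sets of the space of entire functions, which carries the subspace
   topology of the compact-open topology. *)
Definition open_entire (R : realType) (U : set (Cfield R -> Cfield R)) : Prop :=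
  exists2 O : set {compact-open, Cfield R -> Cfield R},
    open O & U = O `&` @entire R.

(* The term of index 0 is irrelevant for the lower limit. *)
Definition lower_density (R : realType) (A : set nat) : \bar R :=
  limn_einf (fun n : nat =>
    ((\sum_(1 <= k < n.+1) `[< A k >])%N%:R / n%:R)%:E).

Definition D_frequently_hypercyclic (R : realType)
    (f : Cfield R -> Cfield R) : Prop :=
  forall U : set (Cfield R -> Cfield R), open_entire U -> U !=set0 ->
    (0 < lower_density R [set n | (1 <= n)%N /\ U (derive1n n f)])%E.

(* The point r e^(it). *)
Definition circle_point (R : realType) (r t : R) : Cfield R :=
  Complex (r * cos t) (r * sin t).

Definition max_modulus (R : realType) (f : Cfield R -> Cfield R) (r : R) : R :=
  sup (range (fun t : R => modulus (f (circle_point r t)))).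

Definition integral_mean (R : realType) (p : R) (f : Cfield R -> Cfield R)
    (r : R) : R :=
  ((2 * pi)^-1 *
   \int[@lebesgue_measure R]_(t in `[0, 2 * pi])
     (modulus (f (circle_point r t)) `^ p)) `^ p^-1.

(* Meaningful for p in [1, +oo] and f continuous: then the range in
   [max_modulus] is bounded and the integral in [integral_mean] is finite. *)
Definition Lp_mean (R : realType) (p : \bar R) (f : Cfield R -> Cfield R)
    (r : R) : R :=
  match p with
  | q%:E => integral_mean q f r
  | +oo%E => max_modulus f r
  | -oo%E => 0
  end.

Definition growth_exponent (R : realType) (p : \bar R) : R :=
  if (2%:E <= p)%E then 1 / 4 else 1 / (2 * fine p).

Definition limsup_pinfty (R : realType) (g : R -> R) : \bar R :=
  limf_esup (fun r : R => (g r)%:E) (pinfty_nbhs R).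

(* Main.v *)
(** An entire function is an exponential generating series [\sum b_n z^n / n!]
    (Cauchy's formula, obtained from Goursat's bisection in logarithmic polar
    coordinates), and differentiation shifts [b].  The weights [r^n / n!] have
    size [e^r / sqrt r] on a window of length [sqrt r] around [n = r], and total
    variation at most [8 e^r / sqrt r].

    Optimality.  If [f] is frequently hypercyclic, [|b_n|] exceeds any given
    constant on a set of positive lower density.  Some window of [L ~ sqrt r]
    indices around [r ~ L^2] meets this set in at least [delta L] points; pairing
    [f] on the circle with the trigonometric polynomial carrying the signs of [b]
    there bounds [M_{f,p}] from below by Hoelder and Parseval.  For [p = 1] one
    large coefficient suffices, and it can be arbitrarily large.

    Existence.  Enumerate rational polynomials [P_l], each infinitely often.
    Layer [l] overwrites the coefficients near the multiples [q al_l] of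
    [al_l = 2^(m_l)] by [e0 (q) P_l], with signs [e0], and is multiplied by the
    ramp [1 - (1 - 1/N_l)^n] so that it is invisible until [n] is of order [N_l].
    As [al_l] grows fast, most [q al_k] with [e0 (q) = 1] are not overwritten by
    later layers, and there [D^n f] is close to [P_k].  A layer is a combination
    of few residue classes modulo [al_l] of ramped sign sequences, each of which
    must be small in mean compared with the target growth.  For [p >= 2] the
    signs are those of Rudin and Shapiro, stable under dyadic sampling: partial
    sums of square root size and Abel summation over windows of length [sqrt r]
    give [al^(-1/2) e^r r^(-1/4)].  For [p < 2] all signs are [1]: a class is an
    average of functions [e^(zeta z)], whose integral mean [O(e^r / sqrt r)] comes
    from [|e^z| = |e^(z/2)|^2] and Parseval, and it is interpolated with the
    uniform bound [25 e^r / al].  For [p = 1] the factor [phi] absorbs the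
    constant for large [r]; for small [r] the ramp makes every class small. *)

Require Import Defs.
From mathcomp Require Import all_boot all_order all_algebra.
From mathcomp Require Import all_classical all_reals all_analysis.
From mathcomp Require Import complex ring lra zify.

Set Implicit Arguments.
Unset Strict Implicit.
Unset Printing Implicit Defensive.

Import Order.TTheory GRing.Theory Num.Theory.
Import numFieldNormedType.Exports.

Local Open Scope classical_set_scope.
Local Open Scope ring_scope.

(** * Moduli and complex derivatives *)

(** For [p >= 2] a flat modulus on the circle is cheapest; for [p < 2] it is cheaper to concentrate
    it near [al] directions, hence constant signs. Interpolation then gains a factor
    [al^(-(1 - 1/p))], which degenerates at [p = 1]: there smallness can only come from [phi]. Two
    obstacles shape the construction. No choice of [al] makes a residue class small at bounded
    radii, where single terms are already too large. The ramp has the form [1 - q^n] because it then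
    replaces an exponential by the difference of two, so that the estimates of exponentials still
    apply. Moreover, polynomials added on top of earlier layers would leave errors of uncontrolled
    size. Each layer therefore also subtracts what stood there: once the ramps are close to 1, the
    layers telescope to the last stage. The price is that the subtracted part, read along a class
    modulo [al_l], carries a subsequence of [e0], so that all estimates must be uniform over a
    family of signs and every [al_l] is a power of two. *)

Section Modulus.
Variable R : realType.
Local Notation C := (Cfield R).
Local Notation ReC := (@complex.Re R).
Local Notation ImC := (@complex.Im R).
Implicit Types z w : C.

Lemma modulus_ge0 z : 0 <= modulus z.
Proof. by case: z => a b; rewrite /modulus /= sqrtr_ge0. Qed.

Lemma normC_modulus z : `|z| = real_complex R (modulus z).
Proof. by case: z. Qed.

Lemma modulusM z w : modulus (z * w) = modulus z * modulus w.
Proof. exact: ComplexField.Normc.normcM. Qed.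

Lemma modulusD z w : modulus (z + w) <= modulus z + modulus w.
Proof. exact: le_normcD. Qed.

Lemma modulusN z : modulus (- z) = modulus z.
Proof. exact: normcN. Qed.

Lemma modulusB z w : modulus (z - w) <= modulus z + modulus w.
Proof. by rewrite -(modulusN w) modulusD. Qed.

Lemma modulusBC z w : modulus (z - w) = modulus (w - z).
Proof. by rewrite -modulusN opprB. Qed.

Lemma modulus0 : modulus (0 : C) = 0.
Proof. exact: ComplexField.Normc.normc0. Qed.

Lemma modulus1 : modulus (1 : C) = 1.
Proof. exact: ComplexField.Normc.normc1. Qed.

Lemma modulus_eq0 z : (modulus z == 0) = (z == 0).
Proof.
apply/eqP/eqP => [|->]; [exact: ComplexField.Normc.eq0_normc | exact: modulus0].
Qed.

Lemma modulusV z : modulus z^-1 = (modulus z)^-1.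
Proof. exact: ComplexField.Normc.normcV. Qed.

Lemma modulusX z n : modulus (z ^+ n) = modulus z ^+ n.
Proof.
elim: n => [|n IH]; first by rewrite !expr0 modulus1.
by rewrite !exprS modulusM IH.
Qed.

Lemma modulus_triB z w : modulus z - modulus w <= modulus (z - w).
Proof. by rewrite lerBlDr -{1}(subrK w z) modulusD. Qed.

Lemma modulus_real (x : R) : modulus (x%:C%C : C) = `|x|.
Proof. by rewrite /modulus /= expr0n /= addr0 sqrtr_sqr. Qed.

Lemma modulus_nat n : modulus (n%:R : C) = n%:R.
Proof.
have -> : (n%:R : C) = (n%:R : R)%:C%C by rewrite -(rmorph_nat (real_complex R)).
by rewrite modulus_real ger0_norm.
Qed.

Lemma modulus_sum (I : Type) (s : seq I) (P : pred I) (F : I -> C) :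
  modulus (\sum_(i <- s | P i) F i) <= \sum_(i <- s | P i) modulus (F i).
Proof.
elim/big_ind2: _ => [|x a y b ? ?|//]; first by rewrite modulus0.
by apply: le_trans (modulusD _ _) _; apply: lerD.
Qed.

Lemma modulus_sqr z : modulus z ^+ 2 = ReC z ^+ 2 + ImC z ^+ 2.
Proof.
by case: z => a b; rewrite /modulus /= sqr_sqrtr // addr_ge0 // sqr_ge0.
Qed.

Lemma normr_Re_le z : `|ReC z| <= modulus z.
Proof.
rewrite -(@ler_pXn2r _ 2) ?nnegrE ?modulus_ge0 // modulus_sqr real_normK ?num_real //.
by rewrite lerDl sqr_ge0.
Qed.

Lemma normr_Im_le z : `|ImC z| <= modulus z.
Proof.
rewrite -(@ler_pXn2r _ 2) ?nnegrE ?modulus_ge0 // modulus_sqr real_normK ?num_real //.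
by rewrite lerDr sqr_ge0.
Qed.

Lemma modulus_le_ReIm z : modulus z <= `|ReC z| + `|ImC z|.
Proof.
rewrite -(@ler_pXn2r _ 2) ?nnegrE ?modulus_ge0 ?addr_ge0 // modulus_sqr.
rewrite sqrrD !real_normK ?num_real // -addrA lerD2l lerDr.
by rewrite mulrn_wge0 ?mulr_ge0.
Qed.

Lemma CReD z w : ReC (z + w) = ReC z + ReC w. Proof. by case: z; case: w. Qed.
Lemma CImD z w : ImC (z + w) = ImC z + ImC w. Proof. by case: z; case: w. Qed.
Lemma CReN z : ReC (- z) = - ReC z. Proof. by case: z. Qed.
Lemma CImN z : ImC (- z) = - ImC z. Proof. by case: z. Qed.
Lemma CReB z w : ReC (z - w) = ReC z - ReC w. Proof. by rewrite CReD CReN. Qed.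
Lemma CImB z w : ImC (z - w) = ImC z - ImC w. Proof. by rewrite CImD CImN. Qed.
Lemma CReM z w : ReC (z * w) = ReC z * ReC w - ImC z * ImC w.
Proof. by case: z; case: w. Qed.
Lemma CImM z w : ImC (z * w) = ReC z * ImC w + ImC z * ReC w.
Proof. by case: z => a b; case: w => c d. Qed.

Lemma CRe_sum (I : Type) (s : seq I) (P : pred I) (F : I -> C) :
  ReC (\sum_(i <- s | P i) F i) = \sum_(i <- s | P i) ReC (F i).
Proof. by elim/big_ind2: _ => [//|x a y b <- <-|//]; rewrite CReD. Qed.

Lemma CIm_sum (I : Type) (s : seq I) (P : pred I) (F : I -> C) :
  ImC (\sum_(i <- s | P i) F i) = \sum_(i <- s | P i) ImC (F i).
Proof. by elim/big_ind2: _ => [//|x a y b <- <-|//]; rewrite CImD. Qed.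

Lemma complex_ext z w : ReC z = ReC w -> ImC z = ImC w -> z = w.
Proof. by case: z => a b; case: w => c d /= -> ->. Qed.

Lemma eq_of_modulus_le z w : (forall e : R, 0 < e -> modulus (z - w) <= e) -> z = w.
Proof.
move=> H; apply/eqP; rewrite -subr_eq0 -modulus_eq0 eq_le modulus_ge0 andbT.
by apply/ler_addgt0Pr => e e0; rewrite add0r H.
Qed.

(** Balls of [C] have their radius in [C] itself; a positive radius has zero imaginary part, so real
    radii suffice. *)
Lemma nbhs_modulusP z (A : set C) :
  nbhs z A <-> exists2 e : R, 0 < e & forall w, modulus (w - z) < e -> A w.
Proof.
split.
- rewrite -nbhs_ballE => -[[a b]] /= ; rewrite ltcE /= => /andP[/eqP -> a0] H.
  exists a => // w wz; apply: H; rewrite /ball /= normC_modulus ltcR.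
  by rewrite modulusBC.
- move=> [e e0 H]; rewrite -nbhs_ballE; exists (e%:C%C) => /=; first by rewrite ltcR.
  move=> w; rewrite /ball /= normC_modulus ltcR => wz; apply: H.
  by rewrite modulusBC.
Qed.

End Modulus.

Arguments modulus : simpl never.

Section ComplexDerivative.
Variable R : realType.
Local Notation C := (Cfield R).
Implicit Types (f g : C -> C) (z d : C).

(** Quotient-free form of the complex derivative: it covers [h = 0] and can be used directly in
    estimates of series and of contour integrals. *)
Definition cderiv f z d := forall e : R, 0 < e -> exists2 del : R, 0 < del &
  forall h : C, modulus h < del ->
    modulus (f (z + h) - f z - d * h) <= e * modulus h.

Lemma cderiv_cvg f z d : cderiv f z d ->
  (fun h : C => h^-1 *: (f (h *: (1 : C) + z) - f z)) @ (0 : C)^' --> (d : C).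
Proof.
move=> H; apply/cvgrPdist_le => e; rewrite ltcE /= => /andP[/eqP Ie e0].
have [del d0 Hd] := H _ e0.
apply/nbhs_modulusP; exists del => // h; rewrite subr0 => hd h0.
rewrite normC_modulus lecE /= -Ie eqxx /=.
have h1 : 0 < modulus h by rewrite lt_neqAle eq_sym modulus_eq0 h0 modulus_ge0.
have := Hd _ hd; rewrite -ler_pdivrMr // -modulusV -modulusM.
have -> : (f (z + h) - f z - d * h) / h = h^-1 *: (f (h *: (1 : C) + z) - f z) - d.
  rewrite mulrBl mulfK // [_ *: 1]mulr1 [h + z]addrC; congr (_ - _).
  by rewrite mulrC.
by rewrite modulusBC.
Qed.

Lemma cderivP f z d : cderiv f z d -> derivable f z (1 : C) /\ derive1 f z = d.
Proof.
move=> /cderiv_cvg H; split; first by apply/cvg_ex; exists d.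
rewrite derive1E; exact: cvg_lim H.
Qed.

Lemma derivable_cderiv f z : derivable f z (1 : C) -> cderiv f z (derive1 f z).
Proof.
move=> /cvg_ex[l Hl]; have -> : derive1 f z = l.
  by rewrite derive1E; apply: cvg_lim Hl.
move=> e e0; move/cvgrPdist_le: Hl => /(_ e%:C%C).
rewrite ltcR => /(_ e0) /nbhs_modulusP[del d0 Hd].
exists del => // h hd; have [->|h0] := eqVneq h 0.
  by rewrite addr0 subrr mulr0 subr0 modulus0 mulr0.
have := Hd h; rewrite subr0 => /(_ hd h0); rewrite normC_modulus lecR => Hh.
have -> : f (z + h) - f z - l * h = - ((l - h^-1 *: (f (h *: (1 : C) + z) - f z)) * h).
  rewrite mulrBl [_ *: 1]mulr1 [h + z]addrC opprB; congr (_ - _).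
  by rewrite [_ *: _]mulrC mulfVK.
by rewrite modulusN modulusM ler_wpM2r // modulus_ge0.
Qed.

Lemma cderiv_continuous f z d : cderiv f z d ->
  forall e : R, 0 < e -> exists2 del : R, 0 < del &
    forall w, modulus (w - z) < del -> modulus (f w - f z) < e.
Proof.
move=> H e e0; have [del d0 Hd] := H 1 ltr01.
pose M := 2 + modulus d; have M0 : 0 < M by rewrite ltr_pwDl // modulus_ge0.
exists (Num.min del (e / M)); first by rewrite lt_min d0 divr_gt0.
move=> w; rewrite lt_min => /andP[w1 w2].
have := Hd _ w1; rewrite [z + _]addrC subrK mul1r => H1.
have -> : f w - f z = (f w - f z - d * (w - z)) + d * (w - z) by rewrite subrK.
apply: le_lt_trans (modulusD _ _) _; rewrite modulusM.
rewrite ltr_pdivlMr // in w2.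
have := modulus_ge0 (w - z); have := modulus_ge0 d; rewrite /M in w2.
rewrite mulrDr (mulrC _ (modulus d)) in w2.
by move=> d1 wz1; lra.
Qed.

Lemma cderivD f g z d1 d2 : cderiv f z d1 -> cderiv g z d2 ->
  cderiv (fun w => f w + g w) z (d1 + d2).
Proof.
move=> H1 H2 e e0; have e20 : 0 < e / 2 by rewrite divr_gt0.
have [a a0 Ha] := H1 _ e20; have [b b0 Hb] := H2 _ e20.
exists (Num.min a b); first by rewrite lt_min a0.
move=> h; rewrite lt_min => /andP[/Ha h1 /Hb h2].
have -> : f (z + h) + g (z + h) - (f z + g z) - (d1 + d2) * h =
  (f (z + h) - f z - d1 * h) + (g (z + h) - g z - d2 * h) by ring.
by apply: le_trans (modulusD _ _) _; lra.
Qed.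

End ComplexDerivative.

Ltac nonneg := first
  [ done | by apply: ltW | exact: modulus_ge0 | exact: expR_ge0 | exact: pi_ge0
  | lazymatch goal with
    | |- is_true (0 <= ?x) => lazymatch x with
      | _ * _ => apply: mulr_ge0; nonneg
      | _ + - _ => rewrite subr_ge0; nonneg
      | _ + _ => apply: addr_ge0; nonneg
      | _ ^+ _ => apply: exprn_ge0; nonneg
      | _^-1 => rewrite invr_ge0; nonneg
      end
    end ].

Section RealFacts.
Variable R : realType.

Lemma sum_half_le (n : nat) : \sum_(i < n) (1 / 2) ^+ i <= 2 :> R.
Proof.
have -> : \sum_(i < n) (1 / 2) ^+ i = 2 - 2 * (1 / 2) ^+ n :> R.
  elim: n => [|n IH]; first by rewrite big_ord0 expr0; lra.
  by rewrite big_ord_recr /= IH exprS; field.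
by rewrite lerBlDr lerDl mulr_ge0 // exprn_ge0.
Qed.

End RealFacts.

(** * Exponential generating series *)


Section ComplexSeries.
Variable R : realType.
Local Notation C := (Cfield R).
Local Notation ReC := (@complex.Re R).
Local Notation ImC := (@complex.Im R).
Implicit Types (u v : nat -> C).

(** [limn] is total, so every sequence has a sum; the value is meaningful under [abs_summable],
    where both real series converge absolutely. *)
Definition csum u : C :=
  Complex (limn (series (fun n => ReC (u n)))) (limn (series (fun n => ImC (u n)))).

Arguments csum : simpl never.

Definition abs_summable u (B : R) := forall n, \sum_(k < n) modulus (u k) <= B.

Lemma abs_bounded_series_cvg (v : nat -> R) (B : R) :
  (forall n, \sum_(k < n) `|v k| <= B) -> cvgn (series v).
Proof.
move=> vB; apply: normed_cvg.
have -> : [normed series v] = fun n => \sum_(k < n) `|v k|.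
  by apply/funext => n; exact: (big_mkord xpredT).
apply: nondecreasing_is_cvgn.
  by apply/nondecreasing_seqP => n; rewrite big_ord_recr /= lerDl normr_ge0.
by exists B => _ [n _ <-].
Qed.

Lemma csum_approx u B : abs_summable u B -> forall e : R, 0 < e ->
  exists n0, forall n, (n0 <= n)%N -> modulus (csum u - \sum_(k < n) u k) <= e.
Proof.
move=> uB e e0; have e20 : 0 < e / 2 by rewrite divr_gt0.
have cR : cvgn (series (fun n => ReC (u n))).
  apply: (@abs_bounded_series_cvg _ B) => n; apply: le_trans (uB n).
  by apply: ler_sum => k _; exact: normr_Re_le.
have cI : cvgn (series (fun n => ImC (u n))).
  apply: (@abs_bounded_series_cvg _ B) => n; apply: le_trans (uB n).
  by apply: ler_sum => k _; exact: normr_Im_le.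
move/cvgrPdist_le: cR => /(_ _ e20)[n1 _ H1].
move/cvgrPdist_le: cI => /(_ _ e20)[n2 _ H2].
exists (maxn n1 n2) => n; rewrite geq_max => /andP[/H1 h1 /H2 h2].
apply: le_trans (modulus_le_ReIm _) _; rewrite CReB CImB CRe_sum CIm_sum.
have E (v : nat -> R) : \sum_(k < n) v k = series v n by rewrite seriesEord.
by rewrite (E (fun k => ReC (u k))) (E (fun k => ImC (u k))); move: h1 h2 => /=; lra.
Qed.

Lemma csum_unique u B l : abs_summable u B ->
  (forall e : R, 0 < e -> exists n0, forall n, (n0 <= n)%N ->
     modulus (l - \sum_(k < n) u k) <= e) -> csum u = l.
Proof.
move=> uB Hl; apply: eq_of_modulus_le => e e0.
have e20 : 0 < e / 2 by rewrite divr_gt0.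
have [n1 H1] := csum_approx uB e20; have [n2 H2] := Hl _ e20.
have {}H1 := H1 _ (leq_maxl n1 n2); have {}H2 := H2 _ (leq_maxr n1 n2).
set s := \sum_(k < _) _ in H1 H2.
have -> : csum u - l = (csum u - s) - (l - s) by ring.
by apply: le_trans (modulusB _ _) _; lra.
Qed.

Lemma csum_le u B : abs_summable u B -> modulus (csum u) <= B.
Proof.
move=> uB; apply/ler_addgt0Pr => e e0; have [n /(_ _ (leqnn n)) H] := csum_approx uB e0.
rewrite -(subrK (\sum_(k < n) u k) (csum u)) addrC.
apply: le_trans (modulusD _ _) _; apply: lerD => //.
by apply: le_trans (modulus_sum _ _ _) _; exact: uB.
Qed.

Lemma abs_summableD u v A B : abs_summable u A -> abs_summable v B ->
  abs_summable (fun n => u n + v n) (A + B).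
Proof.
move=> uA vB n; apply: (@le_trans _ _ (\sum_(k < n) (modulus (u k) + modulus (v k)))).
  by apply: ler_sum => k _; exact: modulusD.
by rewrite big_split /=; apply: lerD; [exact: uA | exact: vB].
Qed.

Lemma abs_summableZ u A (a : C) : abs_summable u A ->
  abs_summable (fun n => a * u n) (modulus a * A).
Proof.
move=> uA n; under eq_bigr => k _ do rewrite modulusM.
by rewrite -mulr_sumr; apply: ler_wpM2l; [exact: modulus_ge0 | exact: uA].
Qed.

Lemma csumD u v A B : abs_summable u A -> abs_summable v B ->
  csum (fun n => u n + v n) = csum u + csum v.
Proof.
move=> uA vB; apply: csum_unique (abs_summableD uA vB) _ => e e0.
have e20 : 0 < e / 2 by rewrite divr_gt0.
have [n1 H1] := csum_approx uA e20; have [n2 H2] := csum_approx vB e20.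
exists (maxn n1 n2) => n; rewrite geq_max => /andP[/H1 h1 /H2 h2].
rewrite big_split /= [X in modulus X](_ : _ =
  (csum u - \sum_(k < n) u k) + (csum v - \sum_(k < n) v k)); last by ring.
by apply: le_trans (modulusD _ _) _; lra.
Qed.

Lemma csumZ u A (a : C) : abs_summable u A -> csum (fun n => a * u n) = a * csum u.
Proof.
move=> uA; apply: csum_unique (abs_summableZ a uA) _ => e e0.
have M0 : 0 < 1 + modulus a by rewrite ltr_pwDl // modulus_ge0.
have [n1 H1] := csum_approx uA (divr_gt0 e0 M0).
exists n1 => n /H1; rewrite -mulr_sumr -mulrBr modulusM => h.
apply: (@le_trans _ _ ((1 + modulus a) * (e / (1 + modulus a)))).
  by apply: ler_pM => //; rewrite ?modulus_ge0 // lerDr.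
by rewrite mulrC mulfVK // gt_eqF.
Qed.

Lemma abs_summableB u v A B : abs_summable u A -> abs_summable v B ->
  abs_summable (fun n => u n - v n) (A + B).
Proof.
move=> uA vB; have -> : A + B = A + modulus (-1 : C) * B.
  by rewrite modulusN modulus1 mul1r.
have := abs_summableD uA (abs_summableZ (-1) vB); congr abs_summable.
by apply/funext => n; rewrite mulN1r.
Qed.

Lemma csumB u v A B : abs_summable u A -> abs_summable v B ->
  csum (fun n => u n - v n) = csum u - csum v.
Proof.
move=> uA vB; have := csumD uA (abs_summableZ (-1) vB).
rewrite (csumZ _ vB) mulN1r => <-; congr csum; apply/funext => n.
by rewrite mulN1r.
Qed.

Lemma abs_summable_shift u A n : abs_summable u A -> abs_summable (fun k => u (n + k)%N) A.
Proof.
move=> uA m; apply: le_trans (uA (n + m)%N); rewrite big_split_ord /= lerDr.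
by apply: sumr_ge0 => k _; exact: modulus_ge0.
Qed.

Lemma csum_split u A n : abs_summable u A ->
  csum u = \sum_(k < n) u k + csum (fun k => u (n + k)%N).
Proof.
move=> uA; apply: (csum_unique uA) => e e0.
have [n1 H1] := csum_approx (abs_summable_shift n uA) e0.
exists (n + n1)%N => m nm; have -> : m = (n + (m - n))%N by lia.
rewrite big_split_ord /= opprD addrACA subrr add0r; apply: H1; lia.
Qed.

Lemma csum_tail u A n (e : R) : abs_summable u A ->
  abs_summable (fun k => u (n + k)%N) e -> modulus (csum u - \sum_(k < n) u k) <= e.
Proof. by move=> uA ue; rewrite (csum_split n uA) addrAC subrr add0r; exact: csum_le. Qed.

Lemma csum_fin u n : (forall k, (n <= k)%N -> u k = 0) -> csum u = \sum_(k < n) u k.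
Proof.
move=> u0; apply: (@csum_unique _ (\sum_(k < n) modulus (u k))) => [m|e e0].
  have [mn|/ltnW nm] := leqP m n.
    rewrite -(subnKC mn) [leRHS]big_split_ord /= lerDl.
    by apply: sumr_ge0 => k _; exact: modulus_ge0.
  rewrite -(subnKC nm) big_split_ord /= [X in _ + X]big1 ?addr0 // => i _.
  by rewrite u0 ?modulus0 // leq_addr.
exists n => m nm; rewrite -(subnKC nm) [X in _ - X]big_split_ord /=.
rewrite [X in _ - (_ + X)]big1 ?addr0 ?subrr ?modulus0 ?ltW // => i _.
by rewrite u0 // leq_addr.
Qed.

End ComplexSeries.

Arguments csum : simpl never.

(** * The weights [x^n / n!] *)

Section ExponentialWeights.

(** Stated over any numeric field, since the weights occur at complex points as well as at real
    radii; [modulus_ew] links the two. *)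
Definition ew (K : numFieldType) (x : K) (n : nat) : K := x ^+ n / n`!%:R.

Arguments ew : simpl never.

Lemma ew0 (K : numFieldType) (x : K) : ew x 0 = 1.
Proof. by rewrite /ew expr0 fact0 divr1. Qed.

Lemma ewS (K : numFieldType) (x : K) n : ew x n.+1 = x / n.+1%:R * ew x n.
Proof.
by rewrite /ew exprS factS natrM invfM mulrACA.
Qed.

Lemma ewS' (K : numFieldType) (x : K) n : n.+1%:R * ew x n.+1 = x * ew x n.
Proof. by rewrite ewS mulrA [_ * (x / _)]mulrC mulfVK ?pnatr_eq0. Qed.

Lemma ew0n (K : numFieldType) n : ew (0 : K) n.+1 = 0.
Proof. by rewrite ewS mul0r mul0r. Qed.

Lemma ewM (K : numFieldType) (a x : K) n : ew (a * x) n = a ^+ n * ew x n.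
Proof. by rewrite /ew exprMn mulrA. Qed.

Lemma ewD (K : numFieldType) (x y : K) n :
  ew (x + y) n = \sum_(i < n.+1) ew x (n - i) * ew y i.
Proof.
rewrite /ew exprDn mulr_suml; apply: eq_bigr => i _.
have ilen : (i <= n)%N by rewrite -ltnS.
rewrite -(bin_fact ilen) !natrM -mulr_natr; field.
by rewrite !pnatr_eq0 -!lt0n !fact_gt0 bin_gt0 ilen.
Qed.

Variable R : realType.
Local Notation C := (Cfield R).

Lemma modulus_ew (z : C) n : modulus (ew z n) = ew (modulus z) n.
Proof. by rewrite /ew modulusM modulusX modulusV modulus_nat. Qed.

Lemma ew_ge0 (x : R) n : 0 <= x -> 0 <= ew x n.
Proof. by move=> x0; rewrite /ew divr_ge0 ?exprn_ge0. Qed.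

Lemma ler_ew (x y : R) n : 0 <= x -> x <= y -> ew x n <= ew y n.
Proof. by move=> x0 xy; rewrite /ew ler_wpM2r ?invr_ge0 // lerXn2r // nnegrE (le_trans x0). Qed.

Lemma sum_ew_le (x : R) n : 0 <= x -> \sum_(k < n) ew x k <= expR x.
Proof.
move=> x0; have := @nondecreasing_cvgn_le R (series (exp_coeff x)).
rewrite /series /expR /= => /(_ _ _ n); rewrite big_mkord; apply.
  by apply/nondecreasing_seqP => m; rewrite big_nat_recr //= lerDl ew_ge0.
exact: is_cvg_series_exp_coeff.
Qed.

Lemma ew_le_expR (x : R) n : 0 <= x -> ew x n <= expR x.
Proof.
move=> x0; apply: le_trans (sum_ew_le n.+1 x0); rewrite big_ord_recr /= lerDr.
by apply: sumr_ge0 => k _; exact: ew_ge0.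
Qed.

(** In the binomial expansion of [ew (z + h) n.+2] the terms of degree 0 and 1 in [h] cancel. The
    others satisfy [ew |h| (i + 2) <= |h|^2 ew |h| i] and sum up again by the binomial formula. *)
Lemma ew_remainder (z h : C) n :
  modulus (ew (z + h) n.+2 - ew z n.+2 - h * ew z n.+1)
    <= modulus h ^+ 2 * ew (modulus z + modulus h) n.
Proof.
rewrite ewD 2!big_ord_recl /= (ew0 h) mulr1 subn0 /bump /= add1n subn1 /= (ewS h) (ew0 h) mulr1.
rewrite invr1 mulr1; set S := \sum_(i < _) _.
rewrite [X in modulus X](_ : _ = S); last by ring.
rewrite /S ewD mulr_sumr; apply: le_trans (modulus_sum _ _ _) _.
apply: ler_sum => i _; rewrite modulusM !modulus_ew /bump /= !add1n subSS subSS.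
rewrite [leRHS]mulrCA; apply: ler_wpM2l; first by rewrite ew_ge0 ?modulus_ge0.
rewrite /ew mulrA -exprD add2n ler_wpM2l ?exprn_ge0 ?modulus_ge0 //.
rewrite lef_pV2 ?posrE ?ltr0n ?fact_gt0 // ler_nat.
by rewrite !factS mulnA leq_pmull // muln_gt0.
Qed.

Lemma deriv_weight_le (x : R) n : 0 <= x -> n.+1%:R * x ^+ n <= (x + 1) ^+ n.+1.
Proof.
move=> x0; rewrite exprDn.
have lt1 : (1 < n.+2)%N by [].
rewrite (bigD1 (Ordinal lt1)) //= subn1 /= expr1n mulr1 bin1 mulr_natl lerDl.
by apply: sumr_ge0 => i _; rewrite mulrn_wge0 // expr1n mulr1 exprn_ge0.
Qed.

End ExponentialWeights.

Arguments ew : simpl never.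

(** * Entire functions given by their derivatives at 0 *)

Section EntirePowerSeries.
Variable R : realType.
Local Notation C := (Cfield R).
Implicit Types (c : nat -> C) (z : C).

Definition egf c z : C := csum (fun n => c n * ew z n).

Definition entire_coeffs c := forall rho : R, 0 <= rho ->
  exists K : R, forall n, \sum_(k < n) modulus (c k) * ew rho k <= K.

Lemma egf_summable c z K :
  (forall n, \sum_(k < n) modulus (c k) * ew (modulus z) k <= K) ->
  abs_summable (fun n => c n * ew z n) K.
Proof.
by move=> H n; under eq_bigr => k _ do rewrite modulusM modulus_ew; exact: H.
Qed.

Lemma entire_coeffs_summable c z : entire_coeffs c ->
  exists K : R, abs_summable (fun n => c n * ew z n) K.
Proof. by move=> /(_ _ (modulus_ge0 z))[K /egf_summable]; exists K. Qed.

(** The shift costs a factor [k.+1] in the weights, absorbed by enlarging the radius from [rho] to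
    [rho + 1]. *)
Lemma entire_coeffs_shift c : entire_coeffs c -> entire_coeffs (fun n => c n.+1).
Proof.
move=> cc rho rho0; have [K HK] := cc (rho + 1) (addr_ge0 rho0 ler01).
exists K => n; apply: le_trans (HK n.+1); rewrite big_ord_recl /=.
apply: ler_wpDl; first by rewrite mulr_ge0 ?modulus_ge0 ?ew_ge0 ?addr_ge0.
apply: ler_sum => k _; rewrite ler_wpM2l ?modulus_ge0 // /bump /= add1n.
rewrite /ew factS natrM invfM mulrA ler_wpM2r ?invr_ge0 //.
by rewrite ler_pdivlMr ?ltr0n // mulrC deriv_weight_le.
Qed.

Lemma egf_deriv c z : entire_coeffs c -> cderiv (egf c) z (egf (fun n => c n.+1) z).
Proof.
move=> cc; have cc1 := entire_coeffs_shift cc.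
have [K HK] := entire_coeffs_shift cc1 (addr_ge0 (modulus_ge0 z) ler01).
have K0 : 0 <= K by have := HK 0%N; rewrite big_ord0.
(* For [modulus h < 1] the second-order remainders are dominated by the twice shifted series at
   radius [modulus z + 1], whose sum is at most [K]. *)
move=> e e0; exists (Num.min 1 (e / (1 + K))).
  by rewrite lt_min ltr01 divr_gt0 // ltr_pwDl.
move=> h; rewrite lt_min => /andP[h1 h2].
have [A0 HA0] := entire_coeffs_summable (z + h) cc.
have [A1 HA1] := entire_coeffs_summable z cc.
have [A2 HA2] := entire_coeffs_summable z cc1.
rewrite /egf (csum_split 2 HA0) (csum_split 2 HA1) (csum_split 1 HA2).
rewrite !big_ord_recl !big_ord0 /= /bump /= !ew0 !ewS !ew0 !invr1 !mulr1 !addr0 mulrDr.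
have S0 := abs_summable_shift 2 HA0; have S1 := abs_summable_shift 2 HA1.
have S2 := abs_summable_shift 1 HA2.
set X0 := csum _; set X1 := csum (fun k => c (2 + k)%N * ew z _); set X2 := csum _.
rewrite [X in modulus X](_ : _ = X0 - X1 - h * X2); last by rewrite addn0; ring.
rewrite /X0 /X1 /X2 -(csumB S0 S1) -(csumZ h S2).
rewrite -(csumB (abs_summableB S0 S1) (abs_summableZ h S2)) /=.
set T := csum _; suff : modulus T <= modulus h * modulus h * K.
  move=> TK; apply: (le_trans TK); rewrite mulrC mulrA ler_wpM2r ?modulus_ge0 //.
  move: h2; rewrite ltr_pdivlMr ?ltr_pwDl // => h2.
  by have := modulus_ge0 h; nra.
apply: csum_le => n.
apply: (@le_trans _ _ (modulus h * modulus h *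
  \sum_(k < n) modulus (c k.+2) * ew (modulus z + 1) k)); last first.
  by apply: ler_wpM2l; rewrite ?mulr_ge0 ?modulus_ge0 ?HK.
rewrite mulr_sumr; apply: ler_sum => k _; rewrite !add2n !add1n.
rewrite -mulrBr mulrCA -mulrBr modulusM [leRHS]mulrCA ler_wpM2l ?modulus_ge0 //.
apply: le_trans (ew_remainder _ _ _) _.
rewrite -expr2 ler_wpM2l ?sqr_ge0 // ler_ew ?addr_ge0 ?modulus_ge0 //.
by rewrite lerD2l ltW.
Qed.

Lemma entire_egf c : entire_coeffs c -> entire (egf c).
Proof. by move=> cc z; have [] := cderivP (egf_deriv z cc). Qed.

Lemma derive1n_egf c n : entire_coeffs c ->
  derive1n n (egf c) = egf (fun k => c (n + k)%N).
Proof.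
elim: n c => [|n IH] c cc //.
rewrite derive1nS IH //.
have cn : entire_coeffs (fun k => c (n + k)%N).
  elim: n {IH} => [//|n IH]; have := entire_coeffs_shift IH.
  by congr entire_coeffs; apply/funext => k; rewrite addnS.
apply/funext => z; have [_ ->] := cderivP (egf_deriv z cn).
by congr egf; apply/funext => k; rewrite addnS.
Qed.

Lemma egf_at0 c : egf c 0 = c 0%N.
Proof.
rewrite /egf (@csum_fin _ _ 1) ?big_ord1 ?ew0 ?mulr1 // => -[//|k] _.
by rewrite ew0n mulr0.
Qed.

End EntirePowerSeries.

(** * Integrals of complex-valued functions *)

Section SegmentIntegral.
Variable R : realType.
Implicit Types (f g : R -> R) (a b c : R).

Definition rint a b f : R := \int[@lebesgue_measure R]_(x in `[a, b]) f x.

Lemma continuous_segment_integrable a b f : continuous f ->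
  (@lebesgue_measure R).-integrable `[a, b] (EFin \o f).
Proof.
move=> cf; apply: continuous_compact_integrable; first exact: segment_compact.
exact: continuous_subspaceT.
Qed.

Lemma rintD a b f g : continuous f -> continuous g ->
  rint a b (fun x => f x + g x) = rint a b f + rint a b g.
Proof. by move=> cf cg; apply: RintegralD => //; exact: continuous_segment_integrable. Qed.

Lemma rintB a b f g : continuous f -> continuous g ->
  rint a b (fun x => f x - g x) = rint a b f - rint a b g.
Proof. by move=> cf cg; apply: RintegralB => //; exact: continuous_segment_integrable. Qed.

Lemma rintZ a b f k : continuous f -> rint a b (fun x => k * f x) = k * rint a b f.
Proof. by move=> cf; apply: RintegralZl => //; exact: continuous_segment_integrable. Qed.

Lemma rint_cst a b k : a <= b -> rint a b (fun=> k) = k * (b - a).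
Proof.
move=> ab; rewrite /rint Rintegral_cst //; congr (_ * _).
have := lebesgue_measure_itv `[a, b]; rewrite /= lte_fin => ->.
by case: ltgtP ab => // -> _; rewrite subrr.
Qed.

Lemma ler_rint a b f g : continuous f -> continuous g ->
  (forall x, a <= x <= b -> f x <= g x) -> rint a b f <= rint a b g.
Proof.
move=> cf cg fg; apply: le_Rintegral => //; exact: continuous_segment_integrable.
Qed.

Lemma eq_rint a b f g : (forall x, a <= x <= b -> f x = g x) -> rint a b f = rint a b g.
Proof.
by move=> fg; apply: eq_Rintegral => x; rewrite inE /= in_itv /= => /fg.
Qed.

Lemma rint_ge0 a b f : (forall x, 0 <= f x) -> 0 <= rint a b f.
Proof. by move=> f0; apply: Rintegral_ge0. Qed.

Lemma rint_split a b c f : continuous f -> a <= c -> c <= b ->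
  rint a b f = rint a c f + rint c b f.
Proof.
move=> cf ac cb; apply/eqP; rewrite addrC -subr_eq; apply/eqP.
rewrite /rint Rintegral_itvB ?bnd_simp //; last exact: continuous_segment_integrable.
rewrite Rintegral_itv_obnd_cbnd //.
apply: integrableS (continuous_segment_integrable c b cf) => //.
by apply: subset_itvr; rewrite bnd_simp.
Qed.

Lemma rint_norm_le a b f : continuous f ->
  `|rint a b f| <= rint a b (fun x => `|f x|).
Proof. by move=> cf; apply: le_normr_Rintegral => //; exact: continuous_segment_integrable. Qed.

Lemma rint_FTC a b (F f : R -> R) : a <= b -> continuous f ->
  (forall x : R, is_derive x 1 F (f x)) -> rint a b f = F b - F a.
Proof.
rewrite le_eqVlt => /predU1P[->|ab] cf dF.
  by rewrite subrr /rint set_itv1 Rintegral_set1.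
have cF : continuous F.
  move=> x; apply/differentiable_continuous/derivable1_diffP.
  by have [] := dF x.
rewrite /rint /Rintegral (@continuous_FTC2 _ f F) //.
- exact: continuous_subspaceT.
- split; first by move=> x _; have [] := dF x.
  + by apply: cvg_at_right_filter; exact: cF.
  + by apply: cvg_at_left_filter; exact: cF.
- by move=> x _; rewrite derive1E; have [] := dF x.
Qed.

Lemma continuous_epsP f : continuous f <->
  forall x e, 0 < e -> exists2 d : R, 0 < d & forall y, `|y - x| < d -> `|f y - f x| < e.
Proof.
split=> [cf x e e0|H x].
- move/cvgrPdist_lt: (cf x) => /(_ _ e0) [d /= d0 Hd]; exists d => // y yx.
  by rewrite distrC; apply: Hd; rewrite /= distrC.
- apply/cvgrPdist_lt => e e0; have [d d0 Hd] := H x e e0.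
  by exists d => //= y; rewrite /= distrC => /Hd; rewrite distrC.
Qed.

End SegmentIntegral.

(** * Curves in the plane and their integrals *)

Section ComplexCurves.
Variable R : realType.
Local Notation C := (Cfield R).
Local Notation ReC := (@complex.Re R).
Local Notation ImC := (@complex.Im R).
Implicit Types (g k : R -> C) (a b c r s t : R).

Definition ccont g := forall x (e : R), 0 < e ->
  exists2 d : R, 0 < d & forall y, `|y - x| < d -> modulus (g y - g x) < e.

Lemma ccont_modulus g : ccont g -> continuous (fun x => modulus (g x)).
Proof.
move=> cg; apply/continuous_epsP => x e e0; have [d d0 Hd] := cg x e e0.
exists d => // y /Hd; apply: le_lt_trans; rewrite ler_norml modulus_triB andbT.
by rewrite lerNl opprB modulusBC modulus_triB.
Qed.

Lemma ccont_Re g : ccont g -> continuous (fun x => ReC (g x)).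
Proof.
move=> cg; apply/continuous_epsP => x e e0; have [d d0 Hd] := cg x e e0.
by exists d => // y /Hd; apply: le_lt_trans; rewrite -CReB normr_Re_le.
Qed.

Lemma ccont_Im g : ccont g -> continuous (fun x => ImC (g x)).
Proof.
move=> cg; apply/continuous_epsP => x e e0; have [d d0 Hd] := cg x e e0.
by exists d => // y /Hd; apply: le_lt_trans; rewrite -CImB normr_Im_le.
Qed.

Lemma ccont_ReIm g : continuous (fun x => ReC (g x)) -> continuous (fun x => ImC (g x)) ->
  ccont g.
Proof.
move=> /continuous_epsP cR /continuous_epsP cI x e e0.
have e20 : 0 < e / 2 by rewrite divr_gt0.
have [d1 d10 H1] := cR x _ e20; have [d2 d20 H2] := cI x _ e20.
exists (Num.min d1 d2); first by rewrite lt_min d10.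
move=> y; rewrite lt_min => /andP[/H1 h1 /H2 h2].
by apply: le_lt_trans (modulus_le_ReIm _) _; rewrite CReB CImB; lra.
Qed.

Lemma ccontD g k : ccont g -> ccont k -> ccont (fun x => g x + k x).
Proof.
move=> cg ck x e e0; have e20 : 0 < e / 2 by rewrite divr_gt0.
have [d1 d10 H1] := cg x _ e20; have [d2 d20 H2] := ck x _ e20.
exists (Num.min d1 d2); first by rewrite lt_min d10.
move=> y; rewrite lt_min => /andP[/H1 h1 /H2 h2].
rewrite opprD addrACA.
by apply: le_lt_trans (modulusD _ _) _; lra.
Qed.

Lemma ccontN g : ccont g -> ccont (fun x => - g x).
Proof.
move=> cg x e e0; have [d d0 H] := cg x _ e0; exists d => // y /H.
by rewrite -opprD modulusN.
Qed.

Lemma ccontB g k : ccont g -> ccont k -> ccont (fun x => g x - k x).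
Proof. by move=> cg ck; apply: ccontD => //; exact: ccontN. Qed.

Lemma ccont_cst (z : C) : ccont (fun=> z).
Proof. by move=> x e e0; exists 1 => // y _; rewrite subrr modulus0. Qed.

Lemma ccontM g k : ccont g -> ccont k -> ccont (fun x => g x * k x).
Proof.
move=> cg ck; apply: ccont_ReIm.
- rewrite (_ : (fun x => _) =
    (fun x => ReC (g x) * ReC (k x) - ImC (g x) * ImC (k x))); last first.
    by apply/funext => x; rewrite CReM.
  move=> x; apply: cvgB; apply: cvgM; first [exact: ccont_Re|exact: ccont_Im].
- rewrite (_ : (fun x => _) =
    (fun x => ReC (g x) * ImC (k x) + ImC (g x) * ReC (k x))); last first.
    by apply/funext => x; rewrite CImM.
  move=> x; apply: cvgD; apply: cvgM; first [exact: ccont_Re|exact: ccont_Im].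
Qed.

Lemma ccontX g n : ccont g -> ccont (fun x => g x ^+ n).
Proof.
move=> cg; elim: n => [|n IH].
  by have -> : (fun x => g x ^+ 0) = (fun=> 1) by []; exact: ccont_cst.
have -> : (fun x => g x ^+ n.+1) = (fun x => g x * g x ^+ n).
  by apply/funext => x; rewrite exprS.
exact: ccontM.
Qed.

Lemma ccont_sum (I : Type) (s : seq I) (P : pred I) (F : I -> R -> C) :
  (forall i, ccont (F i)) -> ccont (fun x => \sum_(i <- s | P i) F i x).
Proof.
move=> cF; elim: s => [|i s IH].
  by have -> : (fun x => \sum_(i <- [::] | P i) F i x) = (fun=> 0);
    [apply/funext => x; rewrite big_nil | exact: ccont_cst].
have -> : (fun x => \sum_(i <- i :: s | P i) F i x) =
   (fun x => (if P i then F i x else 0) + \sum_(i <- s | P i) F i x).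
  by apply/funext => x; rewrite big_cons; case: (P i); rewrite ?add0r.
by apply: ccontD => //; case: (P i) => //; exact: ccont_cst.
Qed.

Lemma ccontV g : ccont g -> (forall x, g x != 0) -> ccont (fun x => (g x)^-1).
Proof.
move=> cg g0 x e e0; pose m := modulus (g x).
have m0 : 0 < m by rewrite lt_neqAle eq_sym modulus_eq0 g0 modulus_ge0.
have d0 : 0 < Num.min (m / 2) (e * (m * m) / 2).
  by rewrite lt_min !divr_gt0 ?mulr_gt0.
have [d dd Hd] := cg x _ d0; exists d => // y /Hd; rewrite lt_min => /andP[h1 h2].
have -> : (g y)^-1 - (g x)^-1 = - ((g y - g x) * ((g y)^-1 * (g x)^-1)).
  by rewrite mulrBl mulrA mulfV ?g0 // mulrCA mulfV ?g0 // mul1r mulr1 opprB.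
rewrite modulusN !modulusM !modulusV -/m.
have my : m / 2 < modulus (g y).
  by have := modulus_triB (g x) (g y); rewrite modulusBC -/m; lra.
have m20 : 0 < m / 2 by rewrite divr_gt0.
have my0 : 0 < modulus (g y) by apply: lt_trans my.
rewrite -invfM ltr_pdivrMr ?mulr_gt0 //; apply: (lt_le_trans h2).
have -> : e * (m * m) / 2 = e * (m / 2 * m) by field.
by apply: ler_wpM2l; [exact: ltW | apply: ler_wpM2r; exact: ltW].
Qed.

Lemma ccont_real (h : R -> R) : continuous h -> ccont (fun x => (h x)%:C%C : C).
Proof. by move=> ch; apply: ccont_ReIm => //=; exact: cst_continuous. Qed.

Lemma entire_comp_ccont (f : C -> C) g : entire f -> ccont g -> ccont (fun x => f (g x)).
Proof.
move=> ef cg x e e0.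
have [d d0 Hd] := cderiv_continuous (derivable_cderiv (ef (g x))) e0.
by have [d' d'0 Hd'] := cg x d d0; exists d' => // y /Hd' /Hd.
Qed.

Definition cint a b g : C :=
  Complex (rint a b (fun x => ReC (g x))) (rint a b (fun x => ImC (g x))).

Arguments cint : simpl never.

Lemma Re_cint a b g : ReC (cint a b g) = rint a b (fun x => ReC (g x)).
Proof. by []. Qed.

Lemma Im_cint a b g : ImC (cint a b g) = rint a b (fun x => ImC (g x)).
Proof. by []. Qed.

Lemma eq_cint a b g k : (forall x, a <= x <= b -> g x = k x) -> cint a b g = cint a b k.
Proof. by move=> gk; apply: complex_ext; apply: eq_rint => x /gk ->. Qed.

Lemma cintD a b g k : ccont g -> ccont k ->
  cint a b (fun x => g x + k x) = cint a b g + cint a b k.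
Proof.
move=> cg ck; apply: complex_ext; rewrite ?CReD ?CImD ?Re_cint ?Im_cint -rintD;
  try (exact: ccont_Re || exact: ccont_Im); apply: eq_rint => x _.
- by rewrite CReD.
- by rewrite CImD.
Qed.

Lemma cintZ a b g (z : C) : ccont g -> cint a b (fun x => z * g x) = z * cint a b g.
Proof.
move=> cg; have [cR cI] := (ccont_Re cg, ccont_Im cg).
have cZ (h : R -> R) (y : R) : continuous h -> continuous (fun x : R => y * h x).
  by move=> ch x; apply: cvgM; [exact: cvg_cst | exact: ch].
apply: complex_ext; rewrite ?CReM ?CImM !Re_cint !Im_cint -!rintZ //.
- by rewrite -rintB //; try exact: cZ; apply: eq_rint => x _; rewrite CReM.
- by rewrite -rintD //; try exact: cZ; apply: eq_rint => x _; rewrite CImM.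
Qed.

Lemma cintB a b g k : ccont g -> ccont k ->
  cint a b (fun x => g x - k x) = cint a b g - cint a b k.
Proof.
move=> cg ck; rewrite -[- cint _ _ k]mulN1r -cintZ // -cintD //; last first.
  by apply: ccontM => //; exact: ccont_cst.
by apply: eq_cint => x _; rewrite mulN1r.
Qed.

Lemma cint_sum (I : Type) (s : seq I) (F : I -> R -> C) a b :
  (forall i, ccont (F i)) ->
  cint a b (fun x => \sum_(i <- s) F i x) = \sum_(i <- s) cint a b (F i).
Proof.
move=> cF; elim: s => [|i s IH].
  rewrite big_nil -[RHS](mul0r (cint a b (fun=> 0))) -cintZ; last exact: ccont_cst.
  by apply: eq_cint => x _; rewrite big_nil mul0r.
rewrite big_cons -IH -cintD //; last exact: ccont_sum.
by apply: eq_cint => x _; rewrite big_cons.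
Qed.

Lemma cint_split a b c g : ccont g -> a <= c -> c <= b ->
  cint a b g = cint a c g + cint c b g.
Proof.
move=> cg ac cb; apply: complex_ext; rewrite ?CReD ?CImD ?Re_cint ?Im_cint;
  apply: rint_split => //; by [exact: ccont_Re | exact: ccont_Im].
Qed.

(* The factor 2 comes from bounding real and imaginary parts separately. *)
Lemma modulus_cint a b g : ccont g ->
  modulus (cint a b g) <= 2 * rint a b (fun x => modulus (g x)).
Proof.
move=> cg; apply: le_trans (modulus_le_ReIm _) _; rewrite Re_cint Im_cint.
have cm := ccont_modulus cg.
have := rint_norm_le a b (ccont_Re cg); have := rint_norm_le a b (ccont_Im cg).
have cn (h : R -> R) : continuous h -> continuous (fun x : R => `|h x|).
  by move=> ch x; apply: cvg_norm; exact: ch.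
have := @ler_rint R a b (fun x => `|ReC (g x)|) _ (cn _ (ccont_Re cg)) cm.
have := @ler_rint R a b (fun x => `|ImC (g x)|) _ (cn _ (ccont_Im cg)) cm.
move=> /(_ (fun x _ => normr_Im_le _)) h1 /(_ (fun x _ => normr_Re_le _)) h2 h3 h4.
lra.
Qed.

Lemma modulus_cint_le a b g M : a <= b -> ccont g ->
  (forall x, a <= x <= b -> modulus (g x) <= M) ->
  modulus (cint a b g) <= 2 * (M * (b - a)).
Proof.
move=> ab cg gM; apply: le_trans (modulus_cint _ _ cg) _; rewrite ler_pM2l //.
rewrite -rint_cst //; apply: ler_rint => //; first exact: ccont_modulus.
exact: cst_continuous.
Qed.

Lemma cint_FTC a b (G g : R -> C) : a <= b -> ccont g ->
  (forall x : R, is_derive x 1 (fun x => ReC (G x)) (ReC (g x))) ->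
  (forall x : R, is_derive x 1 (fun x => ImC (G x)) (ImC (g x))) ->
  cint a b g = G b - G a.
Proof.
move=> ab cg dR dI; apply: complex_ext; rewrite ?CReB ?CImB ?Re_cint ?Im_cint.
- by apply: rint_FTC (dR) => //; exact: ccont_Re.
- by apply: rint_FTC (dI) => //; exact: ccont_Im.
Qed.

Definition cis (t : R) : C := Complex (cos t) (sin t).

Lemma circle_pointE r t : circle_point r t = (r%:C%C : C) * cis t.
Proof. by rewrite /circle_point /cis; apply: complex_ext; rewrite ?CReM ?CImM /=; ring. Qed.

Lemma modulus_cis t : modulus (cis t) = 1.
Proof.
apply/eqP; rewrite -(@eqrXn2 _ 2) ?modulus_ge0 // expr1n (modulus_sqr (cis t)) /=.
by rewrite cos2Dsin2.
Qed.

Lemma cisD s t : cis (s + t) = cis s * cis t.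
Proof. by apply: complex_ext; rewrite ?CReM ?CImM /= ?cosD ?sinD //; ring. Qed.

Lemma cis0 : cis 0 = 1.
Proof. by apply: complex_ext => /=; rewrite ?cos0 ?sin0. Qed.

Lemma cisX t n : cis t ^+ n = cis (n%:R * t).
Proof.
elim: n => [|n IH]; first by rewrite mul0r cis0.
by rewrite exprS IH -cisD -natr1 mulrDl mul1r addrC.
Qed.

Lemma cis_neq0 t : cis t != 0.
Proof. by rewrite -modulus_eq0 modulus_cis oner_eq0. Qed.

Lemma cisN t : cis (- t) = (cis t)^-1.
Proof.
apply: (mulfI (cis_neq0 t)); rewrite -cisD subrr cis0 mulfV //; exact: cis_neq0.
Qed.

Lemma ccont_cis : ccont cis.
Proof. by apply: ccont_ReIm; [exact: continuous_cos | exact: continuous_sin]. Qed.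

Lemma cis_2pi : cis (2 * pi) = 1.
Proof. by rewrite mulr_natl; apply: complex_ext => /=; rewrite ?cos2pi ?sin2pi. Qed.

Lemma modulus_circle_point r t : 0 <= r -> modulus (circle_point r t) = r.
Proof.
by move=> r0; rewrite circle_pointE modulusM modulus_cis mulr1 modulus_real ger0_norm.
Qed.

Lemma ccont_circle_point r : ccont (circle_point r).
Proof.
rewrite (_ : circle_point r = fun t => (r%:C%C : C) * cis t); last first.
  by apply/funext => t; exact: circle_pointE.
by apply: ccontM; [exact: ccont_cst | exact: ccont_cis].
Qed.

Lemma cint_cis a b : a <= b -> 'i%C * cint a b cis = cis b - cis a.
Proof.
move=> ab; rewrite -cintZ; last exact: ccont_cis.
apply: cint_FTC => //.
- by apply: ccontM; [exact: ccont_cst | exact: ccont_cis].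
- by move=> x; rewrite CReM /= mul0r mul1r add0r; exact: is_derive_cos.
- by move=> x; rewrite CImM /= mul0r mul1r add0r; exact: is_derive_sin.
Qed.

Lemma modulus_cisB s t : modulus (cis s - cis t) <= 2 * `|s - t|.
Proof.
wlog ts : s t / t <= s.
  move=> H; have [ts|/ltW st] := leP t s; first exact: H.
  by rewrite modulusBC distrC; exact: H.
rewrite -(cint_cis ts) modulusM.
have -> : modulus ('i%C : C) = 1.
  by rewrite /modulus /= expr0n expr1n /= add0r sqrtr1.
rewrite mul1r ger0_norm ?subr_ge0 // -[s - t]mul1r.
apply: modulus_cint_le => //; first exact: ccont_cis.
by move=> x _; rewrite modulus_cis.
Qed.

Lemma is_derive_scale (h h' : R -> R) (k x : R) :
  is_derive (k * x) 1 h (h' (k * x)) ->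
  is_derive x 1 (fun y => h (k * y)) (k * h' (k * x)).
Proof.
move=> dh.
have dk : is_derive x 1 (fun y : R => k * y) k.
  have := @is_deriveZ R R R id k x 1 1 (is_derive_id _ _).
  by rewrite /GRing.scale /= mulr1.
have := @is_derive1_comp R h (fun y => k * y) x _ _ dh dk.
by rewrite mulrC.
Qed.

Lemma cint_cis_nat n : (0 < n)%N -> cint 0 (2 * pi) (fun t => cis (n%:R * t)) = 0.
Proof.
move=> n0; have nn0 : n%:R != 0 :> R by rewrite pnatr_eq0 -lt0n.
have cc : ccont (fun t => cis (n%:R * t)).
  rewrite (_ : (fun t => _) = fun t => cis t ^+ n); first exact/ccontX/ccont_cis.
  by apply/funext => t; rewrite cisX.
have E : (n%:R%:C * 'i)%C * cint 0 (2 * pi) (fun t => cis (n%:R * t)) =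
   cis (n%:R * (2 * pi)) - cis (n%:R * 0).
  rewrite -cintZ //; apply: (cint_FTC (G := fun t => cis (n%:R * t))).
  - by rewrite mulr_ge0 // pi_ge0.
  - by apply: ccontM => //; exact: ccont_cst.
  - move=> x; have := @is_derive_scale cos (fun y => - sin y) n%:R x (is_derive_cos _).
    by congr is_derive; rewrite CReM /=; ring.
  - move=> x; have := @is_derive_scale sin cos n%:R x (is_derive_sin _).
    by congr is_derive; rewrite CImM /=; ring.
move: E; rewrite mulr0 cis0 -cisX cis_2pi expr1n subrr => /eqP.
rewrite mulf_eq0 => /orP[|/eqP //].
by rewrite -modulus_eq0 /modulus /= !mul0r mulr0 !mulr1 subr0 addr0 expr0n add0r
   sqrtr_sqr normr_eq0 (negbTE nn0).
Qed.

Lemma cint_cis_natN n : (0 < n)%N -> cint 0 (2 * pi) (fun t => (cis (n%:R * t))^-1) = 0.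
Proof.
move=> n0; have := cint_cis_nat n0; set I := cint _ _ _; set K := cint _ _ _.
have cc : ccont (fun t => cis (n%:R * t)).
  rewrite (_ : (fun t => _) = fun t => cis t ^+ n); first exact/ccontX/ccont_cis.
  by apply/funext => t; rewrite cisX.
move=> I0; apply: complex_ext.
- transitivity (ReC I); last by rewrite I0.
  by rewrite !Re_cint; apply: eq_rint => x _; rewrite -cisN /= cosN.
- transitivity (- ImC I); last by rewrite I0 /= oppr0.
  rewrite !Im_cint -mulN1r -rintZ; last exact: ccont_Im.
  by apply: eq_rint => x _; rewrite -cisN /= sinN mulN1r.
Qed.

Lemma cint_one : cint 0 (2 * pi) (fun=> 1) = ((2 * pi)%:C%C : C).
Proof.
have p0 : 0 <= 2 * pi :> R by rewrite mulr_ge0 // pi_ge0.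
by apply: complex_ext => /=; rewrite ?Re_cint ?Im_cint /= rint_cst // subr0 ?mul1r ?mul0r.
Qed.

End ComplexCurves.

Arguments cint : simpl never.

(** * Cauchy's formula and Taylor series *)

Section Goursat.
Variable R : realType.
Local Notation C := (Cfield R).
Variables (z : C) (rho : R).
Hypothesis zrho : modulus z < rho.

Let zeta (t : R) : C := circle_point rho t.

Let rho0 : 0 < rho. Proof. exact: le_lt_trans (modulus_ge0 z) zrho. Qed.

Let modulus_zeta t : modulus (zeta t) = rho.
Proof. by rewrite modulus_circle_point // ltW. Qed.

Let zeta_ge t : rho - modulus z <= modulus (zeta t - z).
Proof. by have := modulus_triB (zeta t) z; rewrite modulus_zeta. Qed.

Let zeta_neq t : zeta t - z != 0.
Proof.
rewrite -modulus_eq0 gt_eqF //; apply: lt_le_trans (zeta_ge t).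
by rewrite subr_gt0.
Qed.

Let zeta_le t : modulus (zeta t - z) <= 2 * rho.
Proof. by apply: le_trans (modulusB _ _) _; rewrite modulus_zeta; move: zrho; lra. Qed.

(** The derivative of [zeta] is ['i%C * zeta t], so this is the logarithmic derivative of
    [zeta t - z]. *)
Definition cauchy_kernel (t : R) : C := 'i%C * zeta t / (zeta t - z).

Let ell := cauchy_kernel.

Lemma ccont_cauchy_kernel : ccont ell.
Proof.
apply: ccontM; first by apply: ccontM; [exact: ccont_cst | exact: ccont_circle_point].
apply: ccontV => //; apply: ccontB; [exact: ccont_circle_point | exact: ccont_cst].
Qed.

Let M : R := rho / (rho - modulus z).

Lemma modulus_cauchy_kernel t : modulus (ell t) <= M.
Proof.
rewrite /ell /cauchy_kernel !modulusM modulusV modulus_zeta.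
have -> : modulus ('i%C : C) = 1.
  by rewrite /modulus /= expr0n expr1n /= add0r sqrtr1.
rewrite mul1r ler_pM2l // lef_pV2 ?posrE ?subr_gt0 //.
by apply: lt_le_trans (zeta_ge t); rewrite subr_gt0.
Qed.

Let M0 : 0 <= M.
Proof. exact: le_trans (modulus_ge0 _) (modulus_cauchy_kernel 0). Qed.

(** Logarithmic polar coordinates about [z]. In them [dw / (w - z)] becomes [ds + ell dt], which has
    no singularity, so Cauchy's formula reduces to rectangles in [s] and [t]. *)
Definition dilated (s t : R) : C := z + (expR s)%:C%C * (zeta t - z).

(* Integral of the closed form F (ds + ell dt) along the boundary of a rectangle. *)
Definition rect_form (F : R -> R -> C) (s1 s2 t1 t2 : R) : C :=
  cint t1 t2 (fun t => (F s2 t - F s1 t) * ell t)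
    - cint s1 s2 (fun s => F s t2 - F s t1).

Definition sep_cont (F : R -> R -> C) :=
  (forall s, ccont (F s)) /\ (forall t, ccont (fun s => F s t)).

Let cont1 F s1 s2 : sep_cont F -> ccont (fun t => (F s2 t - F s1 t) * ell t).
Proof.
by move=> [F1 F2]; apply: ccontM; [exact: ccontB | exact: ccont_cauchy_kernel].
Qed.

Let cont2 F t1 t2 : sep_cont F -> ccont (fun s => F s t2 - F s t1).
Proof. by move=> [F1 F2]; apply: ccontB. Qed.

Lemma rect_form_split_s F s1 m s2 t1 t2 : sep_cont F -> s1 <= m -> m <= s2 ->
  rect_form F s1 s2 t1 t2 = rect_form F s1 m t1 t2 + rect_form F m s2 t1 t2.
Proof.
move=> cF s1m ms2; rewrite /rect_form (cint_split (cont2 t1 t2 cF) s1m ms2).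
rewrite addrACA -opprD -cintD; try exact: cont1.
by congr (_ - _); apply: eq_cint => t _; ring.
Qed.

Lemma rect_form_split_t F s1 s2 t1 m t2 : sep_cont F -> t1 <= m -> m <= t2 ->
  rect_form F s1 s2 t1 t2 = rect_form F s1 s2 t1 m + rect_form F s1 s2 m t2.
Proof.
move=> cF t1m mt2; rewrite /rect_form (cint_split (cont1 s1 s2 cF) t1m mt2).
rewrite addrACA -opprD -cintD; try exact: cont2.
by congr (_ - _); apply: eq_cint => t _; ring.
Qed.

Lemma sep_cont_affine (A B : C) : sep_cont (fun s t => A + B * (dilated s t - z)).
Proof.
split=> [s|t]; apply: ccontD; try exact: ccont_cst; apply: ccontM; try exact: ccont_cst;
  apply: ccontB; try exact: ccont_cst; apply: ccontD; try exact: ccont_cst;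
  apply: ccontM; try exact: ccont_cst.
- by apply: ccontB; [exact: ccont_circle_point | exact: ccont_cst].
- by apply: ccont_real; exact: continuous_expR.
Qed.

Lemma cint_expR a b : a <= b ->
  cint a b (fun s => (expR s)%:C%C : C) = (expR b)%:C%C - (expR a)%:C%C.
Proof.
move=> ab; apply: (cint_FTC (G := fun s => (expR s)%:C%C)) => //.
- by apply: ccont_real; exact: continuous_expR.
- by move=> x /=; exact: is_derive_cst.
Qed.

(** The constant [A] cancels in the differences, and both integrals equal
    [B (e^s2 - e^s1) rho (cis t2 - cis t1)]. *)
Lemma rect_form_affine A B s1 s2 t1 t2 : s1 <= s2 -> t1 <= t2 ->
  rect_form (fun s t => A + B * (dilated s t - z)) s1 s2 t1 t2 = 0.
Proof.
move=> s12 t12; rewrite /rect_form.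
have e1 : cint t1 t2 (fun t => (A + B * (dilated s2 t - z) -
    (A + B * (dilated s1 t - z))) * ell t) =
  (B * ((expR s2)%:C%C - (expR s1)%:C%C)) * (rho%:C%C * ('i%C * cint t1 t2 (@cis R))).
  rewrite !mulrA -cintZ; last exact: ccont_cis.
  apply: eq_cint => t _; rewrite /dilated /ell /cauchy_kernel /zeta circle_pointE.
  field; rewrite -circle_pointE; exact: zeta_neq.
have e2 : cint s1 s2 (fun s => A + B * (dilated s t2 - z) -
    (A + B * (dilated s t1 - z))) =
  (B * (rho%:C%C * (cis t2 - cis t1))) * cint s1 s2 (fun s => (expR s)%:C%C).
  rewrite -cintZ; last by apply: ccont_real; exact: continuous_expR.
  apply: eq_cint => s _; rewrite /dilated /zeta !circle_pointE; ring.
by rewrite e1 e2 cint_cis // cint_expR //; ring.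
Qed.

Lemma rect_form_bound F s1 s2 t1 t2 eta : sep_cont F -> s1 <= s2 -> t1 <= t2 -> 0 <= eta ->
  (forall s t, s1 <= s <= s2 -> t1 <= t <= t2 -> modulus (F s t) <= eta) ->
  modulus (rect_form F s1 s2 t1 t2) <= 4 * eta * (1 + M) * ((s2 - s1) + (t2 - t1)).
Proof.
move=> cF s12 t12 eta0 HF.
have h1 : modulus (cint t1 t2 (fun t => (F s2 t - F s1 t) * ell t)) <=
    2 * (2 * eta * M * (t2 - t1)).
  apply: modulus_cint_le => //; first exact: cont1.
  move=> t tt; rewrite modulusM; apply: ler_pM; rewrite ?modulus_ge0 //.
    apply: le_trans (modulusB _ _) _.
    by have := HF s2 t; have := HF s1 t; rewrite !lexx s12 tt => /(_ isT isT) ? /(_ isT isT) ?; lra.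
  exact: modulus_cauchy_kernel.
have h2 : modulus (cint s1 s2 (fun s => F s t2 - F s t1)) <= 2 * (2 * eta * (s2 - s1)).
  apply: modulus_cint_le => //; first exact: cont2.
  move=> s ss; apply: le_trans (modulusB _ _) _.
  by have := HF s t2; have := HF s t1; rewrite !lexx t12 ss => /(_ isT isT) ? /(_ isT isT) ?; lra.
apply: le_trans (modulusB _ _) _.
apply: (le_trans (lerD h1 h2)).
have p1 : 0 <= eta * M * (s2 - s1) by rewrite mulr_ge0 ?subr_ge0 // (mulr_ge0 eta0 M0).
have p2 : 0 <= eta * (t2 - t1) by rewrite mulr_ge0 // subr_ge0.
nra.
Qed.

Lemma expRB_le (s t m : R) : s <= m -> t <= m -> `|expR s - expR t| <= expR m * `|s - t|.
Proof.
wlog ts : s t / t <= s.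
  move=> H sm tm; have [ts|/ltW st] := leP t s; first exact: H.
  by rewrite distrC [X in _ * X]distrC; exact: H.
move=> sm tm; rewrite !ger0_norm ?subr_ge0 ?ler_expR //.
apply: (@le_trans _ _ (expR s * (s - t))); last first.
  by rewrite ler_wpM2r ?subr_ge0 // ler_expR.
have := expR_ge1Dx (t - s); have -> : expR t = expR s * expR (t - s).
  by rewrite -expRD addrC subrK.
have := expR_gt0 s; nra.
Qed.

Lemma dilated_lipschitz s s' t t' m : s <= m -> s' <= m ->
  modulus (dilated s t - dilated s' t') <= 2 * rho * expR m * (`|s - s'| + `|t - t'|).
Proof.
move=> sm s'm.
have -> : dilated s t - dilated s' t' =
   (expR s - expR s')%:C%C * (zeta t - z) +
   (expR s')%:C%C * rho%:C%C * (cis t - cis t').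
  by rewrite /dilated /zeta !circle_pointE rmorphB /=; ring.
apply: le_trans (modulusD _ _) _; rewrite !modulusM !modulus_real.
rewrite (gtr0_norm (expR_gt0 _)) (gtr0_norm rho0).
have h1 := expRB_le sm s'm; have h2 := modulus_cisB t t'; have h3 := zeta_le t.
have h4 : expR s' <= expR m by rewrite ler_expR.
have e0 := expR_gt0 s'.
rewrite mulrDr; apply: lerD.
- rewrite [leRHS](_ : _ = (expR m * `|s - s'|) * (2 * rho)); last by ring.
  by apply: ler_pM; rewrite ?modulus_ge0.
- rewrite [leRHS](_ : _ = (expR m * rho) * (2 * `|t - t'|)); last by ring.
  by apply: ler_pM; rewrite ?modulus_ge0 ?(mulr_ge0 (ltW e0) (ltW rho0)) // ler_pM2r.
Qed.

Variable f : C -> C.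
Hypothesis ef : entire f.

Let F (s t : R) := f (dilated s t).

Let cont_dilated : (forall s, ccont (dilated s)) /\ (forall t, ccont (fun s => dilated s t)).
Proof.
have [H1 H2] := sep_cont_affine z 1.
by split=> [s|t]; [have := H1 s | have := H2 t]; congr ccont; apply/funext => x;
  rewrite mul1r addrC subrK.
Qed.

Lemma sep_cont_dilated : sep_cont F.
Proof. by have [H1 H2] := cont_dilated; split=> x; exact: entire_comp_ccont. Qed.

Lemma nested_intervals (x : nat -> R) (w : R) :
  (forall n, x n <= x n.+1) -> (forall n, x n.+1 + w / 2 ^+ n.+1 <= x n + w / 2 ^+ n) ->
  0 <= w -> exists y, forall n, x n <= y <= x n + w / 2 ^+ n.
Proof.
move=> xi xd w0.
have mon : {homo x : m n / (m <= n)%N >-> m <= n}.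
  by apply: homo_leq => //; exact: le_trans.
have dec n k : x (n + k)%N + w / 2 ^+ (n + k) <= x n + w / 2 ^+ n.
  elim: k => [|k IH]; first by rewrite addn0.
  by rewrite addnS; apply: le_trans (xd _) IH.
have wn n : 0 <= w / 2 ^+ n by rewrite divr_ge0 // exprn_ge0.
have ub n : ubound (range x) (x n + w / 2 ^+ n).
  move=> _ [k _ <-]; have [nk|/ltnW kn] := leqP n k.
    by rewrite -(subnKC nk); apply: le_trans (dec n (k - n)%N); rewrite lerDl.
  by apply: le_trans (mon _ _ kn) _; rewrite lerDl.
exists (sup (range x)) => n; apply/andP; split.
  by apply: ub_le_sup; [exists (x 0%N + w / 2 ^+ 0); exact: ub | exists n].
by apply: ge_sup; [exists (x 0%N); exists 0%N | exact: ub].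
Qed.

Lemma rect_bisection (G : R -> R -> C) (s t w h : R) : sep_cont G -> 0 <= w -> 0 <= h ->
  exists p : R * R, [/\ p.1 = s \/ p.1 = s + w / 2, p.2 = t \/ p.2 = t + h / 2 &
    modulus (rect_form G s (s + w) t (t + h)) <=
      4 * modulus (rect_form G p.1 (p.1 + w / 2) p.2 (p.2 + h / 2))].
Proof.
move=> cG w0 h0.
have E : rect_form G s (s + w) t (t + h) =
  (rect_form G s (s + w / 2) t (t + h / 2) +
   rect_form G s (s + w / 2) (t + h / 2) (t + h / 2 + h / 2)) +
  (rect_form G (s + w / 2) (s + w / 2 + w / 2) t (t + h / 2) +
   rect_form G (s + w / 2) (s + w / 2 + w / 2) (t + h / 2) (t + h / 2 + h / 2)).
  have a1 : s <= s + w / 2 by lra.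
  have a2 : s + w / 2 <= s + w / 2 + w / 2 by lra.
  have b1 : t <= t + h / 2 by lra.
  have b2 : t + h / 2 <= t + h / 2 + h / 2 by lra.
  rewrite -(rect_form_split_t _ _ cG b1 b2) -(rect_form_split_t _ _ cG b1 b2).
  rewrite -(rect_form_split_s _ _ cG a1 a2) -!addrA.
  have E (x : R) : x / 2 + x / 2 = x by field.
  by rewrite !E.
apply: contrapT => H.
have H' s' t' : s' = s \/ s' = s + w / 2 -> t' = t \/ t' = t + h / 2 ->
   4 * modulus (rect_form G s' (s' + w / 2) t' (t' + h / 2)) <
    modulus (rect_form G s (s + w) t (t + h)).
  move=> hs ht; rewrite ltNge; apply/negP => hh; apply: H.
  by exists (s', t').
have h1 := H' s t (or_introl erefl) (or_introl erefl).
have h2 := H' s _ (or_introl erefl) (or_intror erefl).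
have h3 := H' _ t (or_intror erefl) (or_introl erefl).
have h4 := H' _ _ (or_intror erefl) (or_intror erefl).
have := modulusD (rect_form G s (s + w / 2) t (t + h / 2) +
   rect_form G s (s + w / 2) (t + h / 2) (t + h / 2 + h / 2))
  (rect_form G (s + w / 2) (s + w / 2 + w / 2) t (t + h / 2) +
   rect_form G (s + w / 2) (s + w / 2 + w / 2) (t + h / 2) (t + h / 2 + h / 2)).
rewrite -E.
have := modulusD (rect_form G s (s + w / 2) t (t + h / 2))
   (rect_form G s (s + w / 2) (t + h / 2) (t + h / 2 + h / 2)).
have := modulusD (rect_form G (s + w / 2) (s + w / 2 + w / 2) t (t + h / 2))
   (rect_form G (s + w / 2) (s + w / 2 + w / 2) (t + h / 2) (t + h / 2 + h / 2)).
lra.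
Qed.

(** The affine part of [f] at the point integrates to 0. What remains is at most [e] times the
    distance, itself of order [w' + h'], and is integrated over sides of total length of that order:
    hence the square. *)
Lemma rect_local_bound (s0 t0 w h m e : R) : 0 <= w -> 0 <= h -> 0 < e ->
  exists2 d, 0 < d & forall s t w' h', s <= s0 <= s + w' -> t <= t0 <= t + h' ->
    s + w' <= m -> 0 <= w' -> 0 <= h' -> w' + h' < d ->
    modulus (rect_form F s (s + w') t (t + h')) <=
      e * (8 * rho * expR m * (1 + M)) * (w' + h') ^+ 2.
Proof.
move=> w0 h0 e0; have := @derivable_cderiv R f (dilated s0 t0) (@ef _).
set D := derive1 f _ => /(_ _ e0) [d d0 Hd].
pose L := 2 * rho * expR m.
have L0 : 0 < L by rewrite !mulr_gt0 ?expR_gt0.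
exists (d / L); first by rewrite divr_gt0.
move=> s t w' h' ss tt sm w'0 h'0; rewrite ltr_pdivlMr // => wh.
have wh' : L * (w' + h') < d by rewrite mulrC.
have near u v : s <= u <= s + w' -> t <= v <= t + h' ->
    modulus (dilated u v - dilated s0 t0) <= L * (w' + h').
  move=> uu vv; apply: (@le_trans _ _ (L * (`|u - s0| + `|v - t0|))).
    by apply: dilated_lipschitz; lra.
  rewrite ler_wpM2l ?(ltW L0) //; apply: lerD; rewrite ler_norml; lra.
pose A := f (dilated s0 t0) - D * (dilated s0 t0 - z).
pose G u v := A + D * (dilated u v - z).
pose E u v := F u v - G u v.
have cG : sep_cont G by exact: sep_cont_affine.
have cF := sep_cont_dilated.
have cE : sep_cont E.
  by split=> x; apply: ccontB; [exact: cF.1 | exact: cG.1 | exact: cF.2 | exact: cG.2].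
have -> : rect_form F s (s + w') t (t + h') = rect_form E s (s + w') t (t + h').
  have G0 : rect_form G s (s + w') t (t + h') = 0 by apply: rect_form_affine; lra.
  transitivity (rect_form E s (s + w') t (t + h') + rect_form G s (s + w') t (t + h'));
    last by rewrite G0 addr0.
  rewrite /rect_form addrACA -opprD.
  rewrite -!cintD; try exact: cont1; try exact: cont2.
  by congr (_ - _); apply: eq_cint => x _; rewrite /E; ring.
have whL : 0 <= e * (L * (w' + h')) 
  by apply: mulr_ge0; [exact: ltW | apply: mulr_ge0; [exact: ltW | exact: addr_ge0]].
apply: (@le_trans _ _ (4 * (e * (L * (w' + h'))) * (1 + M) * ((s + w' - s) + (t + h' - t)))).
  apply: rect_form_bound => //; try lra.
  move=> u v uu vv; have nuv := near u v uu vv.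
  have := Hd (dilated u v - dilated s0 t0); rewrite [dilated s0 t0 + _]addrC subrK.
  move=> /(_ (le_lt_trans nuv wh')) H.
  rewrite [X in modulus X](_ : _ = f (dilated u v) - f (dilated s0 t0) -
     D * (dilated u v - dilated s0 t0)); last by rewrite /E /F /G /A; ring.
  by apply: (le_trans H); apply: ler_wpM2l => //; exact: ltW.
by rewrite le_eqVlt; apply/orP; left; apply/eqP; rewrite /L; ring.
Qed.

Lemma goursat s1 s2 t1 t2 : s1 <= s2 -> t1 <= t2 -> rect_form F s1 s2 t1 t2 = 0.
Proof.
move=> s12 t12; pose w := s2 - s1; pose h := t2 - t1.
have w0 : 0 <= w by rewrite subr_ge0.
have h0 : 0 <= h by rewrite subr_ge0.
have cF := sep_cont_dilated.
have wn n : 0 <= w / 2 ^+ n by rewrite divr_ge0 // exprn_ge0.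
have hn n : 0 <= h / 2 ^+ n by rewrite divr_ge0 // exprn_ge0.
have half (x : R) n : x / 2 ^+ n / 2 = x / 2 ^+ n.+1.
  by rewrite exprSr invfM mulrA.
(* The bisection is selected for all levels and corners at once, so that the nested rectangles are
   given by plain recursion. *)
have := choice (fun q : nat * (R * R) => rect_bisection q.2.1 q.2.2 cF (wn q.1) (hn q.1)).
move=> [g Hg].
pose p := fix p n := if n is m.+1 then g (m, p m) else (s1, t1).
have Hp n : [/\ (p n.+1).1 = (p n).1 \/ (p n.+1).1 = (p n).1 + w / 2 ^+ n.+1,
   (p n.+1).2 = (p n).2 \/ (p n.+1).2 = (p n).2 + h / 2 ^+ n.+1 &
    modulus (rect_form F (p n).1 ((p n).1 + w / 2 ^+ n) (p n).2 ((p n).2 + h / 2 ^+ n)) <=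
     4 * modulus (rect_form F (p n.+1).1 ((p n.+1).1 + w / 2 ^+ n.+1)
       (p n.+1).2 ((p n.+1).2 + h / 2 ^+ n.+1))].
  by have [] := Hg (n, p n) => /=; rewrite !half; split.
have dbl (x : R) n : x / 2 ^+ n = x / 2 ^+ n.+1 + x / 2 ^+ n.+1.
  by rewrite exprS; field; rewrite expf_neq0.
have [s0 Hs0] : exists y, forall n, (p n).1 <= y <= (p n).1 + w / 2 ^+ n.
  apply: nested_intervals => // n; have [[] -> _ _] := Hp n; rewrite ?(dbl w n);
    have := wn n.+1; lra.
have [t0 Ht0] : exists y, forall n, (p n).2 <= y <= (p n).2 + h / 2 ^+ n.
  apply: nested_intervals => // n; have [_ [] -> _] := Hp n; rewrite ?(dbl h n);
    have := hn n.+1; lra.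
have top n : (p n).1 + w / 2 ^+ n <= s2.
  elim: n => [|n IH]; first by rewrite expr0 divr1 /= /w; lra.
  by apply: le_trans IH; have [[] -> _ _] := Hp n; rewrite (dbl w n); have := wn n.+1; lra.
have desc n : modulus (rect_form F s1 s2 t1 t2) <= 4 ^+ n *
    modulus (rect_form F (p n).1 ((p n).1 + w / 2 ^+ n) (p n).2 ((p n).2 + h / 2 ^+ n)).
  elim: n => [|n IH].
    by rewrite !expr0 !divr1 mul1r /= /w /h addrC subrK [t1 + _]addrC subrK.
  apply: (le_trans IH); rewrite exprSr -mulrA ler_wpM2l ?exprn_ge0 //.
  by have [_ _] := Hp n.
apply: eq_of_modulus_le => e e0; rewrite subr0.
pose K := 8 * rho * expR s2 * (1 + M) * (w + h) ^+ 2 + 1.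
have K0 : 0 < K.
  have M1 : 0 <= 1 + M by exact: addr_ge0.
  apply: ltr_wpDl => //; apply: mulr_ge0; last exact: sqr_ge0.
  by rewrite mulr_ge0 // mulr_ge0 ?expR_ge0 // mulr_ge0 // ltW.
have [d d0 Hd] := @rect_local_bound s0 t0 w h s2 (e / K) w0 h0 (divr_gt0 e0 K0).
have [n Hn] : exists n, (w + h) / 2 ^+ n < d.
  have [n Hn] : exists n : nat, (w + h) / d < n%:R.
    by exists (Num.truncn ((w + h) / d)).+1; rewrite truncnS_gt.
  exists n; rewrite ltr_pdivrMr ?exprn_gt0 //.
  move: Hn; rewrite ltr_pdivrMr // => /lt_le_trans; apply.
  rewrite mulrC ler_pM2l // -natrX ler_nat; exact/ltnW/ltn_expl.
(* The factor [4 ^+ n] lost in the bisections is recovered by the square of the side lengths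
   [(w + h) / 2 ^+ n]. *)
apply: (le_trans (desc n)).
have := Hd (p n).1 (p n).2 (w / 2 ^+ n) (h / 2 ^+ n) (Hs0 n) (Ht0 n) (top n) (wn n) (hn n).
rewrite -mulrDl => /(_ Hn); rewrite expr_div_n -exprM mulnC exprM => H.
have -> : e = 4 ^+ n * (e / K * K / 4 ^+ n).
  by rewrite mulfVK ?gt_eqF // mulrC mulfVK // expf_neq0.
rewrite ler_wpM2l ?exprn_ge0 //; apply: (le_trans H).
have -> : 2 ^+ 2 = 4 :> R by rewrite expr2; lra.
rewrite [leLHS](_ : _ = e / K * (8 * rho * expR s2 * (1 + M) * (w + h) ^+ 2) / 4 ^+ n);
  last by rewrite !mulrA.
rewrite ler_wpM2r ?invr_ge0 ?exprn_ge0 // ler_wpM2l ?divr_ge0 ?(ltW e0) ?(ltW K0) //.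
by rewrite /K lerDl.
Qed.

(** By [goursat] on [[s, 0]] times [[0, 2 pi]] the circle can be replaced by its contraction by
    [expR s] towards [z]; as [s] decreases, [f] becomes the constant [f z] by continuity. *)
Lemma cauchy_kernel_mean :
  cint 0 (2 * pi) (fun t => f (zeta t) * ell t) = f z * cint 0 (2 * pi) ell.
Proof.
have p0 : 0 <= 2 * pi :> R by rewrite mulr_ge0 // pi_ge0.
have [cF1 cF2] := sep_cont_dilated.
have shrink s : s <= 0 -> cint 0 (2 * pi) (fun t => f (zeta t) * ell t) =
    cint 0 (2 * pi) (fun t => F s t * ell t).
  move=> s0; have := goursat s0 p0; rewrite /rect_form.
  (* The sides [t = 0] and [t = 2 pi] describe the same segment, so their contributions cancel. *)
  rewrite [X in _ - X](_ : _ = 0); last first.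
    transitivity (cint s 0 (fun=> 0 * (0 : C))); last first.
      by rewrite (cintZ s 0 0 (ccont_cst _)) mul0r.
    apply: eq_cint => u _; rewrite mul0r /F /dilated /zeta !circle_pointE.
    by rewrite cis_2pi cis0 subrr.
  rewrite subr0 => /eqP H; apply/eqP; rewrite -subr_eq0 -cintB.
  - rewrite -[X in X == _](_ : cint 0 (2 * pi) (fun t => (F 0 t - F s t) * ell t) = _) //.
    apply: eq_cint => t _; rewrite mulrBl; congr (_ * _ - _).
    by rewrite /F /dilated expR0 mul1r addrC subrK.
  - apply: ccontM; last exact: ccont_cauchy_kernel.
    exact/entire_comp_ccont/ccont_circle_point.
  - by apply: ccontM; [exact: cF1 | exact: ccont_cauchy_kernel].
apply: eq_of_modulus_le => e e0.
pose K := 2 * (M * (2 * pi)) + 1.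
have K0 : 0 < K by rewrite ltr_wpDl // (mulr_ge0 _ (mulr_ge0 M0 p0)).
have [d d0 Hd] := cderiv_continuous (@derivable_cderiv R f z (@ef z)) (divr_gt0 e0 K0).
(* The contracted circle stays within [expR s * (2 * rho)], at most [d / 2], of [z]; the minimum
   with 1 ensures [s <= 0]. *)
pose s := ln (Num.min 1 (d / (4 * rho))).
have r40 : 0 < 4 * rho by rewrite mulr_gt0.
have m0 : 0 < Num.min 1 (d / (4 * rho)) by rewrite lt_min ltr01 divr_gt0.
have s0 : s <= 0 by rewrite /s ln_le0 // ge_min lexx.
rewrite (shrink s s0) -cintZ ?ccont_cauchy_kernel //; last exact: ccont_cauchy_kernel.
rewrite -cintB; last 2 first.
- by apply: ccontM; [exact: cF1 | exact: ccont_cauchy_kernel].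
- by apply: ccontM; [exact: ccont_cst | exact: ccont_cauchy_kernel].
apply: (@le_trans _ _ (2 * (e / K * M * (2 * pi - 0)))).
  apply: modulus_cint_le => //.
    apply: ccontB; apply: ccontM; try exact: ccont_cauchy_kernel; [exact: cF1 | exact: ccont_cst].
  move=> t _; rewrite -mulrBl modulusM.
  apply: ler_pM; rewrite ?modulus_ge0 //; last exact: modulus_cauchy_kernel.
  apply/ltW/Hd; rewrite /dilated addrC addKr modulusM modulus_real /s lnK ?posrE //.
  rewrite gtr0_norm //; apply: (@le_lt_trans _ _ (d / (4 * rho) * (2 * rho))).
    by apply: ler_pM; rewrite ?modulus_ge0 ?(ltW m0) // ge_min lexx orbT.
  rewrite [ltLHS](_ : _ = d / 2); last by field; rewrite gt_eqF.
  by rewrite ltr_pdivrMr //; lra.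
rewrite subr0 [leLHS](_ : _ = e / K * (2 * (M * (2 * pi)))); last by ring.
rewrite -[leRHS](mulfVK (lt0r_neq0 K0)) ler_wpM2l ?divr_ge0 ?ltW //.
by rewrite /K ltrDl.
Qed.

End Goursat.

(** * Taylor expansion of entire functions *)

Section Taylor.
Variable R : realType.
Local Notation C := (Cfield R).

Definition fourier_coef (u : R -> C) (rho : R) (k : nat) : C :=
  ((2 * pi)^-1)%:C%C * cint 0 (2 * pi) (fun t => u t * (circle_point rho t)^-1 ^+ k).

Lemma pi2_gt0 : 0 < 2 * pi :> R. Proof. by rewrite mulr_gt0 // pi_gt0. Qed.

Lemma circle_point_neq0 (rho t : R) : 0 < rho -> circle_point rho t != 0 :> C.
Proof. by move=> r0; rewrite -modulus_eq0 modulus_circle_point ?gt_eqF // ltW. Qed.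

Lemma ccont_fourier (u : R -> C) rho k : 0 < rho -> ccont u ->
  ccont (fun t => u t * (circle_point rho t)^-1 ^+ k).
Proof.
move=> r0 cu; apply: ccontM => //; apply: ccontX; apply: ccontV.
  exact: ccont_circle_point.
by move=> t; exact: circle_point_neq0.
Qed.

Lemma fourier_coef_le (u : R -> C) rho k B : 0 < rho -> ccont u ->
  (forall t, modulus (u t) <= B) -> modulus (fourier_coef u rho k) <= 2 * B / rho ^+ k.
Proof.
move=> r0 cu uB; have p0 := pi2_gt0.
rewrite /fourier_coef modulusM modulus_real gtr0_norm ?invr_gt0 //.
rewrite mulrC ler_pdivrMr //.
rewrite [leRHS](_ : _ = 2 * (B / rho ^+ k * (2 * pi - 0))); last by rewrite subr0; ring.
apply: modulus_cint_le; [exact: ltW | exact: ccont_fourier|].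
move=> t _; rewrite modulusM modulusX modulusV modulus_circle_point ?(ltW r0) //.
by rewrite exprVn ler_wpM2r // invr_ge0 exprn_ge0 // ltW.
Qed.

(** Geometric series in [z / zeta], whose remainder is the integrand times [(z / zeta) ^+ n]. Any
    bounded continuous [u] is allowed: [f] on the circle gives the Taylor series, and [u = 1]
    evaluates the integral of the kernel itself. *)
Lemma cauchy_kernel_expansion (u : R -> C) (z : C) rho B : modulus z < rho -> ccont u ->
  (forall t, modulus (u t) <= B) -> forall e : R, 0 < e ->
  exists n0, forall n, (n0 <= n)%N ->
    modulus (cint 0 (2 * pi) (fun t => u t * cauchy_kernel z rho t) -
      'i%C * (2 * pi)%:C%C * \sum_(k < n) fourier_coef u rho k * z ^+ k) <= e.
Proof.
move=> zr cu uB e e0; have p0 := pi2_gt0.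
have r0 : 0 < rho by apply: le_lt_trans zr; exact: modulus_ge0.
have B0 : 0 <= B by apply: le_trans (uB 0); exact: modulus_ge0.
pose q := modulus z / rho.
have q0 : 0 <= q by rewrite divr_ge0 ?modulus_ge0 ?ltW.
have q1 : q < 1 by rewrite ltr_pdivrMr // mul1r.
pose M := rho / (rho - modulus z).
have M0 : 0 < M by rewrite divr_gt0 // subr_gt0.
pose K := 2 * (B * M * (2 * pi)) + 1.
have K0 : 0 < K by apply: ltr_wpDl => //; nonneg.
have := @cvg_expr R q; rewrite ger0_norm // => /(_ q1) /cvgrPdist_lt /(_ (e / K)).
rewrite divr_gt0 // => /(_ isT)[n0 _ Hn0]; exists n0 => n /Hn0 /=.
rewrite sub0r normrN ger0_norm ?exprn_ge0 // => Hq.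
have cK := ccont_cauchy_kernel zr.
pose T k t := u t * (circle_point rho t)^-1 ^+ k.
have cT k : ccont (T k) by exact: ccont_fourier.
have -> : 'i%C * (2 * pi)%:C%C * \sum_(k < n) fourier_coef u rho k * z ^+ k =
   cint 0 (2 * pi) (fun t => \sum_(k < n) ('i%C * z ^+ k) * T k t).
  rewrite (cint_sum _ (F := fun (k : 'I_n) t => ('i%C * z ^+ k) * T k t)); last first.
    by move=> k; apply: ccontM => //; exact: ccont_cst.
  rewrite mulr_sumr; apply: eq_bigr => k _; rewrite cintZ // /fourier_coef -/(T k).
  have E : (2 * pi)%:C%C * (2 * pi)^-1%:C%C = 1 :> C.
    by rewrite -rmorphM mulfV // gt_eqF.
  rewrite [LHS](_ : _ = 'i%C * z ^+ k * cint 0 (2 * pi) (T k) *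
     ((2 * pi)%:C%C * (2 * pi)^-1%:C%C)); last by ring.
  by rewrite E mulr1.
rewrite -cintB; last 2 first.
- exact: ccontM.
- by apply: ccont_sum => k; apply: ccontM => //; exact: ccont_cst.
apply: (@le_trans _ _ (2 * (B * M * q ^+ n * (2 * pi - 0)))); last first.
  rewrite subr0 [leLHS](_ : _ = 2 * (B * M * (2 * pi)) * q ^+ n); last by ring.
  apply: (@le_trans _ _ (K * (e / K))); last by rewrite mulrC mulfVK // gt_eqF.
  apply: ler_pM => //; last exact: ltW.
  - nonneg.
  - nonneg.
  - by rewrite /K lerDl.
apply: modulus_cint_le; first exact: ltW.
  apply: ccontB; first exact: ccontM.
  by apply: ccont_sum => k; apply: ccontM => //; exact: ccont_cst.
move=> t _; set zt := circle_point rho t.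
have zt0 : zt != 0 by exact: circle_point_neq0.
have ztz : zt - z != 0.
  rewrite -modulus_eq0 gt_eqF //; have := modulus_triB zt z.
  by rewrite modulus_circle_point ?(ltW r0) //; apply: lt_le_trans; rewrite subr_gt0.
have geo m : \sum_(k < m) (z / zt) ^+ k * (1 - z / zt) = 1 - (z / zt) ^+ m.
  elim: m => [|m IH]; first by rewrite big_ord0 expr0 subrr.
  by rewrite big_ord_recr /= IH exprS; ring.
have -> : u t * cauchy_kernel z rho t - \sum_(k < n) 'i%C * z ^+ k * T k t =
   u t * cauchy_kernel z rho t * (z / zt) ^+ n.
  have -> : \sum_(k < n) 'i%C * z ^+ k * T k t =
     u t * cauchy_kernel z rho t * \sum_(k < n) (z / zt) ^+ k * (1 - z / zt).
    rewrite mulr_sumr; apply: eq_bigr => k _; rewrite /T /cauchy_kernel -/zt exprMn.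
    have -> : 1 - z / zt = (zt - z) / zt by rewrite mulrBl mulfV.
    by rewrite exprVn; field; rewrite zt0 ztz expf_neq0.
  by rewrite geo mulrBr mulr1 opprB addrC subrK.
rewrite modulusM modulusX [modulus (z / zt)]modulusM modulusV.
rewrite modulus_circle_point ?(ltW r0) // -/q.
rewrite ler_wpM2r ?exprn_ge0 // modulusM; apply: ler_pM; rewrite ?modulus_ge0 //.
exact: modulus_cauchy_kernel.
Qed.

Lemma fourier_coef_one rho k : 0 < rho ->
  fourier_coef (fun=> 1) rho k = (k == 0)%:R.
Proof.
move=> r0; have p0 := pi2_gt0; rewrite /fourier_coef; case: k => [|k].
  have -> : cint 0 (2 * pi) (fun t => 1 * (circle_point rho t)^-1 ^+ 0) =
      cint 0 (2 * pi) (fun=> 1 : C).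
    by apply: eq_cint => t _; rewrite mul1r expr0.
  by rewrite cint_one -rmorphM mulVf ?rmorph1 // gt_eqF.
have cc : ccont (fun t => (cis (k.+1%:R * t))^-1 : C).
  apply: ccontV; last by move=> t /=; exact: cis_neq0.
  rewrite (_ : (fun t => _) = fun t => cis t ^+ k.+1); first exact/ccontX/ccont_cis.
  by apply/funext => t; rewrite cisX.
have -> : cint 0 (2 * pi) (fun t => 1 * (circle_point rho t)^-1 ^+ k.+1) =
   (rho^-1 ^+ k.+1)%:C%C * cint 0 (2 * pi) (fun t => (cis (k.+1%:R * t))^-1).
  rewrite -cintZ //; apply: eq_cint => t _.
  by rewrite mul1r circle_pointE invfM exprMn rmorphXn /= fmorphV !exprVn cisX.
by rewrite cint_cis_natN // mulr0 mulr0.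
Qed.

Lemma cint_cauchy_kernel (z : C) rho : modulus z < rho ->
  cint 0 (2 * pi) (cauchy_kernel z rho) = 'i%C * (2 * pi)%:C%C.
Proof.
move=> zr; have r0 : 0 < rho by apply: le_lt_trans zr; exact: modulus_ge0.
apply: eq_of_modulus_le => e e0.
have := @cauchy_kernel_expansion (fun=> 1) z rho 1 zr (ccont_cst _) _ e e0.
case=> [t|n0 /(_ n0.+1 (leqnSn _))]; first by rewrite modulus1.
rewrite big_ord_recl big1 => [|i _]; last by rewrite fourier_coef_one // mul0r.
rewrite fourier_coef_one // addr0 expr0 !mulr1; congr (modulus (_ - _) <= _).
by apply: eq_cint => t _; rewrite mul1r.
Qed.

Lemma entire_bounded_circle (f : C -> C) rho : entire f ->
  exists B : R, forall t, modulus (f (circle_point rho t)) <= B.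
Proof.
move=> ef; have p0 := pi2_gt0; pose u t := f (circle_point rho t).
have cu : ccont u by exact/entire_comp_ccont/ccont_circle_point.
have cm := ccont_modulus cu.
have [c _ Hc] : exists2 c, c \in `[0, 2 * pi]%R &
    forall t, t \in `[0, 2 * pi]%R -> modulus (u t) <= modulus (u c).
  apply: (@EVT_max _ (fun t => modulus (u t))); first exact: ltW.
  exact: continuous_subspaceT.
exists (modulus (u c)) => t; rewrite -/(u t).
pose k := Num.floor (t / (2 * pi)).
have -> : u t = u (t - k%:~R * (2 * pi)).
  rewrite /u !circle_pointE; congr (f (_ * _)).
  have per m : cis (m%:R * (2 * pi)) = 1 :> C by rewrite -cisX cis_2pi expr1n.
  case: k => m.
    by rewrite cisD cisN per invr1 mulr1.
  by rewrite NegzE mulrNz mulNr opprK cisD per mulr1.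
apply: Hc; rewrite in_itv /= subr_ge0 -ler_pdivlMr // floor_le /=.
rewrite lerBlDr -{1}[2 * pi]mul1r -mulrDl addrC -ler_pdivrMr //.
by apply/ltW; have := floorD1_gt (t / (2 * pi)); rewrite intrD.
Qed.

Lemma taylor_local (f : C -> C) rho : entire f -> 0 < rho ->
  exists c : nat -> C, (exists B : R, forall k, modulus (c k) * rho ^+ k <= B) /\
    forall z, modulus z < rho -> forall e : R, 0 < e -> exists n0, forall n, (n0 <= n)%N ->
      modulus (f z - \sum_(k < n) c k * z ^+ k) <= e.
Proof.
move=> ef r0; have p0 := pi2_gt0.
pose u t := f (circle_point rho t).
have cu : ccont u by exact/entire_comp_ccont/ccont_circle_point.
have [B uB] := entire_bounded_circle rho ef.
exists (fourier_coef u rho); split.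
  exists (2 * B) => k; rewrite -ler_pdivlMr ?exprn_gt0 //.
  exact: fourier_coef_le.
move=> z zr e e0; pose a : C := 'i%C * (2 * pi)%:C%C.
have ma : modulus a = 2 * pi.
  rewrite /a modulusM modulus_real gtr0_norm //.
  by rewrite {1}/modulus /= expr0n expr1n /= add0r sqrtr1 mul1r.
have [n0 Hn0] := cauchy_kernel_expansion zr cu uB (mulr_gt0 e0 p0).
exists n0 => n /Hn0; rewrite /u (cauchy_kernel_mean zr ef) cint_cauchy_kernel // -/a.
by rewrite mulrC -mulrBr modulusM ma mulrC ler_pM2r.
Qed.

(** Strong induction: if the earlier coefficients vanish, division by [x ^+ k] at a small real [x]
    leaves [modulus (d k) <= 2 * B * x], the tail being dominated by a geometric series of ratio
    1/2. *)
Lemma power_series_unique (d : nat -> C) (B : R) :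
  (forall k, modulus (d k) <= B) ->
  (forall z, modulus z < 1 -> forall e : R, 0 < e -> exists n0, forall n, (n0 <= n)%N ->
      modulus (\sum_(k < n) d k * z ^+ k) <= e) -> forall k, d k = 0.
Proof.
move=> dB Hd k; have [m] := ubnP k; elim: m k => // m IH k; rewrite ltnS => km.
have d0 i : (i < k)%N -> d i = 0 by move=> ik; apply: IH; exact: leq_trans km.
have B0 : 0 <= B by apply: (le_trans _ (dB 0%N)); exact: modulus_ge0.
have small (x : R) : 0 < x -> x < 1 / 2 -> modulus (d k) <= 2 * B * x.
  move=> x0 x1; have xk0 : 0 < x ^+ k by rewrite exprn_gt0.
  rewrite -(@ler_pM2r _ (x ^+ k)) //; apply/ler_addgt0Pr => e e0.
  have mx : modulus (x%:C%C : C) = x by rewrite modulus_real gtr0_norm.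
  have [|n0 /(_ (k.+1 + n0)%N (leq_addl _ _))] := Hd x%:C%C _ e e0.
    by rewrite mx; lra.
  rewrite big_split_ord big_ord_recr /= [X in X + _ + _]big1 => [|i _]; last by rewrite d0 ?mul0r.
  rewrite add0r; set S := \sum_(i < n0) _ => H.
  have HS : modulus S <= 2 * B * x * x ^+ k.
    apply: le_trans (modulus_sum _ _ _) _.
    apply: (@le_trans _ _ (\sum_(i < n0) (B * x ^+ k.+1) * (1 / 2) ^+ i)).
      apply: ler_sum => i _; rewrite modulusM modulusX mx exprD mulrA.
      apply: ler_pM; try nonneg.
        by apply: ler_pM; try nonneg; exact: dB.
      by apply: lerXn2r; rewrite ?nnegrE; try nonneg; apply: ltW.
    rewrite -mulr_sumr exprS; have := sum_half_le R n0 => hs.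
    rewrite [leRHS](_ : _ = B * (x * x ^+ k) * 2); last by ring.
    by apply: ler_wpM2l => //; nonneg.
  have -> : modulus (d k) * x ^+ k = modulus (d k * x%:C%C ^+ k + S - S).
    by rewrite addrK modulusM modulusX mx.
  by apply: le_trans (modulusB _ _) _; lra.
apply/eqP; rewrite -modulus_eq0 eq_le modulus_ge0 andbT; apply/ler_addgt0Pr => e e0.
rewrite add0r; pose x := Num.min (1 / 4) (e / (2 * B + 1)).
have B1 : 0 < 2 * B + 1 by apply: ltr_wpDl => //; nonneg.
have x0 : 0 < x by rewrite lt_min !divr_gt0.
have x1 : x < 1 / 2 by rewrite gt_min; apply/orP; left; lra.
apply: (le_trans (small _ x0 x1)).
apply: (@le_trans _ _ ((2 * B + 1) * (e / (2 * B + 1)))).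
  apply: ler_pM; try nonneg; first by rewrite lerDl.
  by rewrite ge_min lexx orbT.
by rewrite mulrC mulfVK // gt_eqF.
Qed.

Lemma entire_egfP (f : C -> C) : entire f ->
  exists2 b : nat -> C, entire_coeffs b & f = egf b.
Proof.
move=> ef; have [c [[B0 cB] Hc]] := taylor_local ef ltr01.
have B0p k : modulus (c k) <= B0 by have := cB k; rewrite expr1n mulr1.
(* Each radius yields its own coefficients; by uniqueness on the unit disc they all equal [c], so
   Cauchy's bound holds for [c] at every radius. *)
have cE rho : 1 <= rho -> exists B : R, (forall k, modulus (c k) * rho ^+ k <= B) /\
    forall z, modulus z < rho -> forall e : R, 0 < e -> exists n0, forall n, (n0 <= n)%N ->
      modulus (f z - \sum_(k < n) c k * z ^+ k) <= e.
  move=> r1; have r0 : 0 < rho by apply: lt_le_trans r1.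
  have [c' [[B c'B] Hc']] := taylor_local ef r0.
  suff E : c' = c by exists B; rewrite -{1}E; split => // z zr; rewrite -E; exact: Hc'.
  apply/funext => k; apply/eqP; rewrite -subr_eq0; apply/eqP.
  apply: (@power_series_unique (fun k => c' k - c k) (B + B0)) k => [k|z z1 e e0].
    apply: le_trans (modulusB _ _) _; apply: lerD => //; apply: le_trans (c'B k).
    by apply: ler_peMr; [nonneg | exact: exprn_ege1].
  have e20 : 0 < e / 2 by rewrite divr_gt0.
  have [n1 H1] := Hc z z1 _ e20; have [n2 H2] := Hc' z (lt_le_trans z1 r1) _ e20.
  exists (maxn n1 n2) => n; rewrite geq_max => /andP[/H1 h1 /H2 h2].
  rewrite [X in modulus X](_ : _ = (f z - \sum_(k < n) c k * z ^+ k) -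
     (f z - \sum_(k < n) c' k * z ^+ k)).
    by apply: le_trans (modulusB _ _) _; lra.
  rewrite opprB addrC addrA subrK -sumrB; apply: eq_bigr => k _.
  by rewrite mulrBl.
pose b k := c k * k`!%:R.
have bE z k : b k * ew z k = c k * z ^+ k.
  by rewrite /b /ew; field; rewrite pnatr_eq0 -lt0n fact_gt0.
have cb : entire_coeffs b.
  (* Cauchy's bound beyond radius [2 * rho] makes the terms at radius [rho] decay like [2^-k]; the
     [+ 1] meets the condition of [cE]. *)
  move=> rho rho0; have r1 : 1 <= 2 * rho + 1 by rewrite lerDr mulr_ge0.
  have [B [HB _]] := cE _ r1; exists (B * 2) => n.
  have B1 : 0 <= B by have := HB 0%N; rewrite expr0 mulr1; apply: le_trans; nonneg.
  apply: (@le_trans _ _ (\sum_(k < n) B * (1 / 2) ^+ k)); last first.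
    by rewrite -mulr_sumr ler_wpM2l // sum_half_le.
  apply: ler_sum => k _; rewrite /b modulusM modulus_nat.
  have -> : modulus (c k) * k`!%:R * ew rho k = modulus (c k) * (2 * rho) ^+ k * (1 / 2) ^+ k.
    rewrite -mulrA -[in RHS]mulrA -exprMn [2 * rho * _](_ : _ = rho); last by field.
    by rewrite /ew; field; rewrite pnatr_eq0 -lt0n fact_gt0.
  apply: ler_wpM2r; first by rewrite exprn_ge0.
  apply: le_trans (HB k); apply: ler_wpM2l; first nonneg.
  by apply: lerXn2r; rewrite ?nnegrE; try nonneg; rewrite lerDl.
exists b => //; apply/funext => z.
have [A HA] := entire_coeffs_summable z cb.
apply/esym; apply: (csum_unique HA) => e e0.
have r1 : 1 <= modulus z + 1 by rewrite lerDr; nonneg.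
have [_ [_ Hz]] := cE _ r1.
have [|n0 Hn0] := Hz z _ e e0; first by rewrite ltrDl.
exists n0 => n /Hn0; congr (modulus (_ - _) <= _).
by apply: eq_bigr => k _; rewrite bE.
Qed.

End Taylor.

(** * The exponential weights *)

Section Unimodal.
Variables (R : realType) (w : nat -> R) (p : nat).
Hypothesis w_up : forall n, (n < p)%N -> w n <= w n.+1.
Hypothesis w_down : forall n, (p <= n)%N -> w n.+1 <= w n.
Hypothesis w_ge0 : forall n, 0 <= w n.

Lemma unimodal_variation_up m : (m <= p)%N -> \sum_(n < m) `|w n.+1 - w n| = w m - w 0%N.
Proof.
elim: m => [|m IH] mp; first by rewrite big_ord0 subrr.
by rewrite big_ord_recr /= IH 1?ltnW // ger0_norm ?subr_ge0 ?w_up //; ring.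
Qed.

Lemma unimodal_variation_down k :
  \sum_(n < p + k) `|w n.+1 - w n| = 2 * w p - w 0%N - w (p + k)%N.
Proof.
elim: k => [|k IH]; first by rewrite addn0 unimodal_variation_up //; ring.
rewrite addnS big_ord_recr /= IH distrC ger0_norm ?subr_ge0; first by ring.
by apply: w_down; exact: leq_addr.
Qed.

Lemma unimodal_variation m : \sum_(n < m) `|w n.+1 - w n| <= 2 * w p.
Proof.
apply: (@le_trans _ _ (\sum_(n < p + m) `|w n.+1 - w n|)).
  rewrite addnC big_split_ord /= lerDl; apply: sumr_ge0 => i _; exact: normr_ge0.
by rewrite unimodal_variation_down -addrA gerDl -opprD oppr_le0 addr_ge0.
Qed.

Lemma unimodal_le_peak n : w n <= w p.
Proof.
have [np|/ltnW pn] := leqP n p.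
  rewrite -(subKn np); elim: (p - n)%N => [|k IH]; first by rewrite subn0 lexx.
  apply: le_trans IH; have [kp|pk] := ltnP k p; last first.
    by rewrite (_ : (p - k.+1 = p - k)%N) ?lexx //; lia.
  have -> : (p - k = (p - k.+1).+1)%N by lia.
  by apply: w_up; lia.
rewrite -(subnKC pn); elim: (n - p)%N => [|k IH]; first by rewrite addn0 lexx.
by rewrite addnS; apply: le_trans IH; apply: w_down; exact: leq_addr.
Qed.

End Unimodal.

Section PoissonWeights.
Variable R : realType.
Implicit Types (r : R) (n m k : nat).

Lemma ew_up r n : 0 <= r -> n.+1%:R <= r -> ew r n <= ew r n.+1.
Proof.
move=> r0 nr; rewrite ewS; apply: ler_peMl; first exact: ew_ge0.
by rewrite ler_pdivlMr ?ltr0n // mul1r.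
Qed.

Lemma ew_down r n : 0 <= r -> r <= n.+1%:R -> ew r n.+1 <= ew r n.
Proof.
move=> r0 nr; rewrite ewS; apply: ler_piMl; first exact: ew_ge0.
by rewrite ler_pdivrMr ?ltr0n // mul1r.
Qed.

Lemma ew_upto_top r n : 0 <= r -> (n < Num.truncn r)%N -> ew r n <= ew r n.+1.
Proof. by move=> r0 nr; apply: ew_up => //; rewrite -truncn_gt_nat. Qed.

Lemma ew_from_top r n : 0 <= r -> (Num.truncn r <= n)%N -> ew r n.+1 <= ew r n.
Proof. by move=> r0; rewrite truncn_le_nat => /ltW; exact: ew_down. Qed.

(** With [p] the integer part of [r], the successive ratios [r / (p + j)] are at least
    [1 - j / (p + 1)], and a product of such factors is at least 1 minus the sum of the
    [j / (p + 1)]. *)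
Lemma ew_after_top r k : 0 <= r -> (k * k.+1 <= (Num.truncn r).+1)%N ->
  (1 - (k * k.+1)%:R / (2 * (Num.truncn r).+1%:R)) * ew r (Num.truncn r)
    <= ew r (Num.truncn r + k)%N.
Proof.
move=> r0; set p := Num.truncn r.
have pr : p%:R <= r by have /andP[] := truncn_itv r0.
elim: k => [|k IH] kp; first by rewrite mul0n mul0r subr0 mul1r addn0.
have {}IH := IH (leq_trans (leq_mul (leqnSn _) (leqnSn _)) kp).
rewrite addnS ewS; set q := r / _.
have p10 : 0 < p.+1%:R :> R by rewrite ltr0n.
have pk0 : 0 < (p + k).+1%:R :> R by rewrite ltr0n.
have q0 : 0 <= q by rewrite divr_ge0.
have q1 : 1 - k.+1%:R / p.+1%:R <= q.
  apply: (@le_trans _ _ (p%:R / (p + k).+1%:R)); last by rewrite /q ler_pM2r ?invr_gt0.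
  have -> : p%:R / (p + k).+1%:R = 1 - k.+1%:R / (p + k).+1%:R :> R.
    rewrite -[X in X - _](divff (lt0r_neq0 pk0)) -mulrBl; congr (_ / _).
    by rewrite -addnS natrD addrK.
  rewrite lerD2l lerN2 ler_wpM2l // lef_pV2 ?posrE // ler_nat; lia.
have w0 := ew_ge0 p r0.
apply: (le_trans _ (ler_wpM2l q0 IH)); rewrite [leRHS]mulrA ler_wpM2r //.
set b := (k * k.+1)%:R / _.
have b1 : b <= 1.
  rewrite /b ler_pdivrMr ?mulr_gt0 // mul1r -natrM ler_nat.
  have := leq_mul (leqnSn k) (leqnSn k.+1); lia.
have b0 : 0 <= b by rewrite divr_ge0 // mulr_ge0.
apply: (@le_trans _ _ ((1 - k.+1%:R / p.+1%:R) * (1 - b))); last first.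
  by rewrite ler_wpM2r // subr_ge0.
have -> : (k.+1 * k.+2)%:R / (2 * p.+1%:R) = k.+1%:R / p.+1%:R + b :> R.
  rewrite /b; have -> : (k.+1 * k.+2)%:R = 2 * k.+1%:R + (k * k.+1)%:R :> R.
    by rewrite -natrM -natrD; congr (_%:R); lia.
  by field; rewrite lt0r_neq0.
have : 0 <= k.+1%:R / p.+1%:R * b by rewrite mulr_ge0 // divr_ge0.
set a := _ / _; nra.
Qed.

(** No asymptotics of the factorial are used: the [m] weights from the peak on, with [m] the integer
    part of [sqrt r], are at least half the peak, and their sum is at most [expR r]. The constant 4
    comes from this half and from [sqrt r <= 2 m]. *)
Lemma ew_max r n : 0 <= r -> Num.sqrt r * ew r n <= 4 * expR r.
Proof.
move=> r0; set p := Num.truncn r.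
apply: (@le_trans _ _ (Num.sqrt r * ew r p)).
  rewrite ler_wpM2l ?sqrtr_ge0 //; apply: unimodal_le_peak => k.
  - exact: ew_upto_top.
  - exact: ew_from_top.
have s0 := sqrtr_ge0 r; pose m := Num.truncn (Num.sqrt r).
have /andP[ms sm] := truncn_itv s0; rewrite -/m in ms sm.
have w0 := ew_ge0 p r0.
have [m0|m0] := posnP m.
  rewrite m0 in sm; apply: (@le_trans _ _ (1 * ew r p)); first by rewrite ler_wpM2r // ltW.
  have := ew_le_expR p r0; have := expR_ge0 r; lra.
have mp : (m * m <= p)%N.
  rewrite truncn_ge_nat // natrM -[leRHS](sqr_sqrtr r0) expr2; exact: ler_pM.
have H : m%:R * (ew r p / 2) <= expR r.
  apply: (le_trans _ (sum_ew_le (p + m) r0)); rewrite big_split_ord /=.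
  apply: ler_wpDl; first by apply: sumr_ge0 => i _; exact: ew_ge0.
  have -> : m%:R * (ew r p / 2) = \sum_(k < m) ew r p / 2.
    by rewrite sumr_const card_ord mulr_natl.
  apply: ler_sum => k _; have km := ltn_ord k.
  have kk : (k * k.+1 <= p.+1)%N.
    apply: leq_trans (leq_trans mp (leqnSn _)); apply: leq_mul => //; exact: ltnW.
  apply: le_trans (ew_after_top r0 kk); rewrite mulrC ler_wpM2r //.
  apply: (@le_trans _ _ (1 - 1 / 2)); first by lra.
  rewrite lerD2l lerN2 ler_pdivrMr ?mulr_gt0 ?ltr0n // mulrA divfK // mul1r ler_nat.
  exact: kk.
have sm2 : Num.sqrt r <= 2 * m%:R.
  apply: (le_trans (ltW sm)); rewrite -natrM ler_nat; lia.
apply: (@le_trans _ _ (2 * m%:R * ew r p)); first by rewrite ler_wpM2r.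
lra.
Qed.

Lemma ew_variation r m : 0 <= r ->
  Num.sqrt r * \sum_(n < m) `|ew r n.+1 - ew r n| <= 8 * expR r.
Proof.
move=> r0; apply: (@le_trans _ _ (Num.sqrt r * (2 * ew r (Num.truncn r)))).
  rewrite ler_wpM2l ?sqrtr_ge0 //; apply: unimodal_variation => k.
  - exact: ew_upto_top.
  - exact: ew_from_top.
  - exact: ew_ge0.
by have := ew_max (Num.truncn r) r0; lra.
Qed.

(** [(2 + y) / (2 - y)] is a Pade approximant of the exponential. The difference of the two sides
    vanishes at 0 and has derivative [1 - (1 - x) e^x >= 0]. *)
Lemma expR_pade (y : R) : 0 <= y -> (2 - y) * expR y <= 2 + y.
Proof.
move=> y0; pose g (x : R) := 2 + x - (2 - x) * expR x.
pose dg (x : R) := 1 - (1 - x) * expR x.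
have dgP (x : R) : is_derive x (1 : R) g (dg x).
  apply: is_derive_eq; rewrite /dg /GRing.scale /=; ring.
have cg : {within `[0, y], continuous g}.
  apply: continuous_subspaceT => x; apply/differentiable_continuous/derivable1_diffP.
  by have [] := dgP x.
have [c] := MVT_segment y0 (fun x _ => dgP x) cg.
rewrite in_itv /= => /andP[c0 _]; rewrite /g expR0 !subr0 !addr0 mulr1 subrr subr0 => E.
suff : 0 <= dg c * y by rewrite -E subr_ge0.
rewrite mulr_ge0 // /dg subr_ge0.
have := expR_ge1Dx (- c); rewrite expRN => h.
by rewrite -ler_pdivlMr ?expR_gt0 // mul1r; exact: h.
Qed.

Lemma expR_pade_le (x : R) : 0 <= x -> expR (2 * x / (2 + x)) <= 1 + x.
Proof.
move=> x0; have x2 : 0 < 2 + x by lra.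
have y0 : 0 <= 2 * x / (2 + x) by nonneg.
have := expR_pade y0.
have -> : 2 - 2 * x / (2 + x) = 4 / (2 + x) by field; rewrite lt0r_neq0.
have -> : 2 + 2 * x / (2 + x) = 4 / (2 + x) * (1 + x) by field; rewrite lt0r_neq0.
by rewrite ler_pM2l // divr_gt0.
Qed.

Lemma expR_quadratic_le (x : R) : 0 <= x -> expR (x - x ^+ 2 / 2) <= 1 + x.
Proof.
move=> x0; apply: le_trans (expR_pade_le x0); rewrite ler_expR.
have x2 : 0 < 2 + x by lra.
rewrite ler_pdivlMr // -subr_ge0 [leRHS](_ : _ = x ^+ 3 / 2); last by field.
by rewrite divr_ge0 // exprn_ge0.
Qed.

(** The square of [n! <= e sqrt n (n / e)^n], free of roots and shifted to [n.+1]. The induction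
    step is [e^2 <= (1 + 1/x)^(2x + 1)], which is [expR_pade_le] at [1/x]. *)
Lemma fact_sqr_le n :
  n.+1`!%:R ^+ 2 * expR (2 * n.+1%:R) <= expR 2 * n.+1%:R ^+ (2 * n.+1).+1 :> R.
Proof.
elim: n => [|n IH]; first by rewrite !expr1n mul1r !mulr1.
set x : R := n.+1%:R in IH *; have x0 : 0 < x by rewrite ltr0n.
have E : expR 2 <= (1 + x^-1) ^+ (2 * n.+1).+1 :> R.
  have -> : expR 2 = expR (2 * x^-1 / (2 + x^-1)) ^+ (2 * n.+1).+1 :> R.
    rewrite -expRM_natl; congr expR.
    have -> : (2 * n.+1).+1%:R = 2 * x + 1 :> R by rewrite -addn1 natrD natrM.
    by field; rewrite ?lt0r_neq0.
  apply: lerXn2r; rewrite ?nnegrE; try nonneg.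
  by apply: expR_pade_le; rewrite invr_ge0 ltW.
have xS : n.+2%:R = x + 1 by rewrite -natr1.
rewrite factS natrM xS.
have -> : 2 * (x + 1) = 2 + 2 * x by ring.
rewrite expRD exprMn.
apply: (@le_trans _ _ ((x + 1) ^+ 2 * expR 2 * (expR 2 * x ^+ (2 * n.+1).+1))).
  rewrite [leLHS](_ : _ = (x + 1) ^+ 2 * expR 2 * (n.+1`!%:R ^+ 2 * expR (2 * x)));
    last by ring.
  by apply: ler_wpM2l IH; nonneg.
have -> : ((2 * n.+2).+1 = 2 + (2 * n.+1).+1)%N by lia.
rewrite exprD [leRHS](_ : _ = (x + 1) ^+ 2 * expR 2 * (x + 1) ^+ (2 * n.+1).+1);
  last by ring.
apply: ler_wpM2l; first nonneg.
have -> : x + 1 = (1 + x^-1) * x by rewrite mulrDl mul1r mulVf ?lt0r_neq0.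
by rewrite exprMn; apply: ler_wpM2r; first nonneg.
Qed.

Lemma fact_le n : (0 < n)%N ->
  n`!%:R <= expR 1 * Num.sqrt n%:R * n%:R ^+ n * expR (- n%:R) :> R.
Proof.
case: n => // n _; set x : R := n.+1%:R; have x0 : 0 < x by rewrite ltr0n.
rewrite -(@ler_pXn2r _ 2) ?nnegrE; [|by []|by []|]; last first.
  by rewrite !mulr_ge0 ?expR_ge0 ?sqrtr_ge0 ?exprn_ge0 // ltW.
rewrite expRN -(@ler_pM2r _ (expR (2 * x))) ?expR_gt0 //.
apply: (le_trans (fact_sqr_le n)); rewrite -/x.
have e2 : expR 2 = expR 1 ^+ 2 :> R by rewrite -expRM_natl mulr1.
have e2x : expR (2 * x) = expR x ^+ 2 by rewrite -expRM_natl.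
rewrite e2 e2x [leRHS](_ : _ = expR 1 ^+ 2 * (Num.sqrt x ^+ 2 * (x ^+ n.+1) ^+ 2)).
  by rewrite sqr_sqrtr ?(ltW x0) // -exprM -exprS mulnC.
by field; rewrite lt0r_neq0 ?expR_gt0.
Qed.

(** Writing [r = n (1 + y)] with [y >= 0], the inequality [1 + y >= e^(y - y^2/2)] produces the
    Gaussian factor and [fact_le] the constant [e^(-1)]. *)
Lemma ew_lower r n : (0 < n)%N -> n%:R <= r ->
  expR (-1) * expR (- ((r - n%:R) ^+ 2 / (2 * n%:R))) * expR r <= Num.sqrt n%:R * ew r n.
Proof.
move=> n0 nr; set x : R := n%:R in nr *; have x0 : 0 < x by rewrite ltr0n.
pose y := (r - x) / x; have y0 : 0 <= y by rewrite /y; nonneg.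
have rE : r = x * (1 + y) by rewrite /y; field; rewrite lt0r_neq0.
have rn : x ^+ n * expR (r - x - (r - x) ^+ 2 / (2 * x)) <= r ^+ n.
  rewrite [leRHS](_ : _ = x ^+ n * (1 + y) ^+ n) ?ler_wpM2l ?exprn_ge0 ?(ltW x0) //; last by rewrite -exprMn -rE.
  have -> : expR (r - x - (r - x) ^+ 2 / (2 * x)) = expR (y - y ^+ 2 / 2) ^+ n.
    by rewrite -expRM_natl -/x; congr expR; rewrite /y; field; rewrite lt0r_neq0.
  by apply: lerXn2r; rewrite ?nnegrE; try nonneg; exact: expR_quadratic_le.
have f0 : 0 < n`!%:R :> R by rewrite ltr0n fact_gt0.
rewrite /ew mulrA ler_pdivlMr //.
have := fact_le n0; rewrite -/x => Hf.
apply: (@le_trans _ _ (expR (-1) * expR (- ((r - x) ^+ 2 / (2 * x))) * expR r *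
   (expR 1 * Num.sqrt x * x ^+ n * expR (- x)))).
  by apply: ler_wpM2l => //; nonneg.
apply: (le_trans _ (ler_wpM2l (sqrtr_ge0 x) rn)).
rewrite le_eqVlt; apply/orP; left; apply/eqP.
rewrite [expR (r - x - _)]expRD [expR (r - x)]expRD [expR (-1)]expRN; field.
by rewrite lt0r_neq0 ?expR_gt0.
Qed.

End PoissonWeights.

(** * Integral means *)

Section IntegralMeans.
Variable R : realType.
Local Notation C := (Cfield R).
Implicit Types (f g : C -> C) (p q r A B : R).

Lemma continuous_powR_comp (h : R -> R) p : 0 < p -> continuous h ->
  (forall x, 0 <= h x) -> continuous (fun x => h x `^ p).
Proof.
move=> p0 ch h0 x; have [hx|hx] := eqVneq (h x) 0.
- apply/cvgrPdist_lt => e e0; rewrite hx powR0 ?gt_eqF //.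
  have d0 : 0 < e `^ p^-1 by rewrite powR_gt0.
  move/cvgrPdist_lt: (ch x) => /(_ _ d0); apply: filterS => y.
  rewrite hx !sub0r !normrN ger0_norm // => hy.
  rewrite ger0_norm ?powR_ge0 //.
  have -> : e = (e `^ p^-1) `^ p by rewrite -powRrM mulVf ?gt_eqF // powRr1 // ltW.
  by apply: gt0_ltr_powR => //; rewrite nnegrE ?powR_ge0.
- have hx0 : h x \in `]0, +oo[%R by rewrite in_itv /= andbT lt_neqAle eq_sym hx h0.
  have cp : {for h x, continuous (fun a : R => a `^ p)}.
    apply/differentiable_continuous/derivable1_diffP.
    exact: derivable_powR hx0.
  exact: (@continuous_comp _ _ _ h (fun a : R => a `^ p) x (ch x) cp).
Qed.

Lemma powRV (a p : R) : 0 <= a -> a^-1 `^ p = (a `^ p)^-1.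
Proof. by move=> a0; rewrite -(powR_inv1 a0) -(powR_inv1 (powR_ge0 a p)) powRAC. Qed.

Definition circle_modulus f r (t : R) := modulus (f (circle_point r t)).

Lemma continuous_circle_modulus f r : entire f -> continuous (circle_modulus f r).
Proof.
move=> ef; apply: (@ccont_modulus R (fun t => f (circle_point r t))).
exact/entire_comp_ccont/ccont_circle_point.
Qed.

Lemma continuous_circle_modulus_powR f r p : entire f -> 0 < p ->
  continuous (fun t => circle_modulus f r t `^ p).
Proof.
move=> ef p0; apply: continuous_powR_comp => //; first exact: continuous_circle_modulus.
by move=> x; exact: modulus_ge0.
Qed.

Lemma integral_mean_le f r p A : entire f -> 0 < p -> 0 <= A ->
  (integral_mean p f r <= A) =
  (rint 0 (2 * pi) (fun t => circle_modulus f r t `^ p) <= 2 * pi * A `^ p).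
Proof.
move=> ef p0 A0; rewrite /integral_mean.
rewrite -/(rint 0 (2 * pi) (fun t => circle_modulus f r t `^ p)).
set I := rint _ _ _.
have I0 : 0 <= (2 * pi)^-1 * I.
  rewrite mulr_ge0 ?invr_ge0 ?(ltW (pi2_gt0 R)) //.
  by apply: rint_ge0 => x; exact: powR_ge0.
transitivity (((2 * pi)^-1 * I) <= A `^ p); last first.
  by rewrite mulrC ler_pdivrMr ?pi2_gt0 // mulrC.
apply/idP/idP => H.
- have -> : (2 * pi)^-1 * I = (((2 * pi)^-1 * I) `^ p^-1) `^ p.
    by rewrite -powRrM mulVf ?gt_eqF // powRr1.
  by apply: ge0_ler_powR; rewrite ?(ltW p0) // nnegrE powR_ge0.
- have -> : A = (A `^ p) `^ p^-1 by rewrite -powRrM mulfV ?gt_eqF // powRr1.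
  by apply: ge0_ler_powR; rewrite ?invr_ge0 ?(ltW p0) // nnegrE powR_ge0.
Qed.

Lemma le_integral_mean f r p A : entire f -> 0 < p -> 0 <= A ->
  integral_mean p f r <= A ->
  rint 0 (2 * pi) (fun t => circle_modulus f r t `^ p) <= 2 * pi * A `^ p.
Proof. by move=> ef p0 A0; rewrite integral_mean_le. Qed.

Lemma integral_mean_le_of f r p A : entire f -> 0 < p -> 0 <= A ->
  rint 0 (2 * pi) (fun t => circle_modulus f r t `^ p) <= 2 * pi * A `^ p ->
  integral_mean p f r <= A.
Proof. by move=> ef p0 A0; rewrite integral_mean_le. Qed.

Lemma circle_modulus_le_max f r t : entire f -> circle_modulus f r t <= max_modulus f r.
Proof.
move=> ef; apply: ub_le_sup; last by exists t.
by have [B HB] := entire_bounded_circle r ef; exists B => _ [s _ <-]; exact: HB.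
Qed.

Lemma max_modulus_le f r A : (forall t, circle_modulus f r t <= A) -> max_modulus f r <= A.
Proof.
move=> H; apply: ge_sup; first by exists (circle_modulus f r 0); exists 0.
by move=> _ [t _ <-]; exact: H.
Qed.

Lemma integral_mean_ge0 f r p : 0 <= integral_mean p f r.
Proof. exact: powR_ge0. Qed.

Lemma Lp_mean_le_sup f r (p : \bar R) A : entire f -> (1%:E <= p)%E -> 0 <= A ->
  (forall t, circle_modulus f r t <= A) -> Lp_mean p f r <= A.
Proof.
case: p => [p| |] //= ef; last by move=> _ A0 H; exact: max_modulus_le.
rewrite lee_fin => p1 A0 H; have p0 : 0 < p by apply: lt_le_trans p1.
apply: integral_mean_le_of => //.
apply: (@le_trans _ _ (rint 0 (2 * pi) (fun=> A `^ p))); last first.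
  by rewrite rint_cst ?(ltW (pi2_gt0 R)) // subr0 mulrC.
apply: ler_rint; [exact: continuous_circle_modulus_powR | exact: cst_continuous |].
move=> t _; apply: ge0_ler_powR; rewrite ?(ltW p0) // nnegrE //; exact: modulus_ge0.
Qed.

(* Minkowski's inequality, through the convexity of the power function. *)
Lemma Lp_mean_add f g r (p : \bar R) A B : entire f -> entire g -> (1%:E <= p)%E ->
  0 < A -> 0 < B -> Lp_mean p f r <= A -> Lp_mean p g r <= B ->
  Lp_mean p (fun z => f z + g z) r <= A + B.
Proof.
move=> ef eg p1 A0 B0.
have efg : entire (fun z => f z + g z).
  move=> z; have [] // := cderivP (cderivD (derivable_cderiv (ef z)) (derivable_cderiv (eg z))).
case: p p1 => [p| |] //=; last first.
  move=> _ fA gB; apply: max_modulus_le => t; apply: le_trans (modulusD _ _) _.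
  by apply: lerD; [apply: le_trans fA|apply: le_trans gB]; exact: circle_modulus_le_max.
rewrite lee_fin => p1; have p0 : 0 < p by apply: lt_le_trans p1.
have AB0 : 0 < A + B by exact: addr_gt0.
move=> /(le_integral_mean ef p0 (ltW A0)) fA /(le_integral_mean eg p0 (ltW B0)) gB.
apply: (integral_mean_le_of efg p0 (ltW AB0)).
(* With these weights [(x + y) / (A + B)] is the convex combination of [x / A] and [y / B]. *)
pose s := A / (A + B); pose s' := B / (A + B).
have ss : s + s' = 1 by rewrite /s /s' -mulrDl mulfV ?gt_eqF.
have s0 : 0 <= s by rewrite /s; nonneg.
have s'0 : 0 <= s' by rewrite /s'; nonneg.
have s1 : s <= 1 by rewrite -ss lerDl.
have conv (x y : R) : 0 <= x -> 0 <= y ->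
    (x + y) `^ p <= (A + B) `^ p * (s * (x `^ p / A `^ p) + s' * (y `^ p / B `^ p)).
  move=> x0 y0.
  have os : s' = unstable.onem s by rewrite /unstable.onem -ss addrC addKr.
  have : (s * (x / A) + s' * (y / B)) `^ p <= s * (x / A) `^ p + s' * (y / B) `^ p.
    rewrite os; apply: (@convex_powR R p p1 (Itv01 s0 s1) (x / A) (y / B)).
    - by rewrite inE /= in_itv /= andbT divr_ge0 // ltW.
    - by rewrite inE /= in_itv /= andbT divr_ge0 // ltW.
  have -> : s * (x / A) + s' * (y / B) = (x + y) / (A + B).
    by rewrite /s /s'; field; rewrite !gt_eqF.
  have [A0' B0'] := (ltW A0, ltW B0).
  rewrite (@powRM _ x A^-1) ?invr_ge0 // (@powRM _ y B^-1) ?invr_ge0 //.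
  rewrite (@powRM _ (x + y)) ?invr_ge0 ?addr_ge0 ?(ltW AB0) //.
  rewrite !powRV ?(ltW A0) ?(ltW B0) ?(ltW AB0) //.
  have P0 : 0 < (A + B) `^ p by rewrite powR_gt0.
  by rewrite ler_pdivrMr // mulrC.
have cf := @continuous_circle_modulus_powR f r p ef p0.
have cg := @continuous_circle_modulus_powR g r p eg p0.
have cs (h : R -> R) (k : R) : continuous h -> continuous (fun x : R => k * h x).
  by move=> ch x; apply: cvgM; [exact: cvg_cst | exact: ch].
pose a := (A + B) `^ p * (s / A `^ p); pose b := (A + B) `^ p * (s' / B `^ p).
apply: (@le_trans _ _ (rint 0 (2 * pi) (fun t =>
   a * circle_modulus f r t `^ p + b * circle_modulus g r t `^ p))).
  apply: ler_rint; first exact: continuous_circle_modulus_powR.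
    by move=> x; apply: cvgD; [exact: (cs _ a cf x) | exact: (cs _ b cg x)].
  move=> t _; have -> : a * circle_modulus f r t `^ p + b * circle_modulus g r t `^ p =
    (A + B) `^ p * (s * (circle_modulus f r t `^ p / A `^ p) +
       s' * (circle_modulus g r t `^ p / B `^ p)) by rewrite /a /b; ring.
  apply: le_trans (conv _ _ (modulus_ge0 _) (modulus_ge0 _)).
  apply: ge0_ler_powR; rewrite ?(ltW p0) // ?nnegrE ?addr_ge0 ?modulus_ge0 //.
  exact: modulusD.
rewrite rintD; try exact: cs; rewrite !rintZ //.
have a0 : 0 <= a by rewrite /a mulr_ge0 ?powR_ge0 // divr_ge0 // powR_ge0.
have b0 : 0 <= b by rewrite /b mulr_ge0 ?powR_ge0 // divr_ge0 // powR_ge0.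
apply: (le_trans (lerD (ler_wpM2l a0 fA) (ler_wpM2l b0 gB))).
rewrite /a /b [leLHS](_ : _ = 2 * pi * (A + B) `^ p * (s + s')); last first.
  by field; rewrite !gt_eqF ?powR_gt0.
by rewrite ss mulr1.
Qed.

End IntegralMeans.

(** * Orthogonality on the circle *)

Section Parseval.
Variable R : realType.
Local Notation C := (Cfield R).
Local Notation ReC := (@complex.Re R).
Local Notation ImC := (@complex.Im R).

Lemma ccont_cis_nat n : ccont (fun t : R => cis (n%:R * t)).
Proof.
rewrite (_ : (fun t => _) = fun t => cis t ^+ n); first exact/ccontX/ccont_cis.
by apply/funext => t; rewrite cisX.
Qed.

Lemma ccont_cis_natV n : ccont (fun t : R => (cis (n%:R * t))^-1).
Proof. by apply: ccontV; [exact: ccont_cis_nat | move=> t; exact: cis_neq0]. Qed.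

Lemma cint_cis_orth m n :
  cint 0 (2 * pi) (fun t : R => cis (m%:R * t) * (cis (n%:R * t))^-1) =
    if m == n then (2 * pi)%:C%C else 0 :> C.
Proof.
have [->|mn] := eqVneq m n.
  by rewrite -cint_one; apply: eq_cint => t _; rewrite mulfV //; exact: cis_neq0.
have [lt|lt|E] := ltngtP m n.
- rewrite -(@cint_cis_natN R (n - m)) ?subn_gt0 //; apply: eq_cint => t _.
  rewrite -{1}(subnK (ltnW lt)) natrD mulrDl cisD invfM mulrCA mulfV ?mulr1 //.
  exact: cis_neq0.
- rewrite -(@cint_cis_nat R (m - n)) ?subn_gt0 //; apply: eq_cint => t _.
  by rewrite -{1}(subnK (ltnW lt)) natrD mulrDl cisD -mulrA mulfV ?mulr1 //; exact: cis_neq0.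
- by rewrite E eqxx in mn.
Qed.

Lemma conjc_cis (t : R) : (cis t)^*%C = (cis t)^-1 :> C.
Proof. by rewrite -cisN; apply: complex_ext => /=; rewrite ?cosN ?sinN. Qed.

Lemma modulus_conjc (z : C) : modulus (z^*%C : C) = modulus z.
Proof. by case: z => a b; rewrite /modulus /= sqrrN. Qed.

Lemma mulcJ (z : C) : z * (z^*%C : C) = (modulus z ^+ 2)%:C%C.
Proof.
apply: complex_ext; rewrite ?CReM ?CImM modulus_sqr; case: z => a b /=; ring.
Qed.

Lemma conjc_mul (z w : C) : ((z * w)^*%C : C) = z^*%C * w^*%C.
Proof. by case: z => a b; case: w => c d; apply: complex_ext => /=; ring. Qed.

Lemma conjc_sum (I : Type) (s : seq I) (F : I -> C) :
  ((\sum_(i <- s) F i)^*%C : C) = \sum_(i <- s) (F i)^*%C.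
Proof.
elim: s => [|i s IH]; first by rewrite !big_nil conjc0.
rewrite !big_cons -IH; case: (F i) => a b; case: (\sum_(j <- s) _) => c d.
by apply: complex_ext => //=; rewrite opprD.
Qed.

Definition trig_sum (s : nat -> C) n (t : R) : C := \sum_(k < n) s k * cis (k%:R * t).

Lemma ccont_trig_sum s n : ccont (trig_sum s n).
Proof.
by apply: ccont_sum => k; apply: ccontM; [exact: ccont_cst | exact: ccont_cis_nat].
Qed.

Lemma conjc_trig_sum s n t :
  ((trig_sum s n t)^*%C : C) = \sum_(k < n) (s k)^*%C * (cis (k%:R * t))^-1.
Proof.
rewrite /trig_sum conjc_sum; apply: eq_bigr => k _.
by rewrite conjc_mul conjc_cis.
Qed.

Lemma parseval s n :
  rint 0 (2 * pi) (fun t => modulus (trig_sum s n t) ^+ 2) =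
    2 * pi * \sum_(k < n) modulus (s k) ^+ 2.
Proof.
have E : cint 0 (2 * pi) (fun t => \sum_(k < n) \sum_(l < n)
    (s k * (s l)^*%C) * (cis (k%:R * t) * (cis (l%:R * t))^-1)) =
   \sum_(k < n) (modulus (s k) ^+ 2)%:C%C * (2 * pi)%:C%C :> C.
  have cc (k l : nat) : ccont (fun t : R => cis (k%:R * t) * (cis (l%:R * t))^-1).
    by apply: ccontM; [exact: ccont_cis_nat | exact: ccont_cis_natV].
  rewrite (cint_sum _ (F := fun (k : 'I_n) t => \sum_(l < n)
    (s k * (s l)^*%C) * (cis (k%:R * t) * (cis (l%:R * t))^-1))); last first.
    by move=> k; apply: ccont_sum => l; apply: ccontM => //; exact: ccont_cst.
  apply: eq_bigr => k _.
  rewrite (cint_sum _ (F := fun (l : 'I_n) t =>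
    (s k * (s l)^*%C) * (cis (k%:R * t) * (cis (l%:R * t))^-1))); last first.
    by move=> l; apply: ccontM => //; exact: ccont_cst.
  rewrite (bigD1 k) //= big1 => [|l lk]; last first.
    by rewrite cintZ // cint_cis_orth ifN ?mulr0 // eq_sym.
  by rewrite cintZ // cint_cis_orth eqxx addr0 mulcJ.
have := congr1 ReC E; rewrite Re_cint CRe_sum => E'.
rewrite mulr_sumr -[RHS](_ : \sum_(k < n) ReC ((modulus (s k) ^+ 2)%:C%C * (2 * pi)%:C%C) = _).
  rewrite -E'; apply: eq_rint => t _.
  have -> : \sum_(k < n) \sum_(l < n)
    (s k * (s l)^*%C) * (cis (k%:R * t) * (cis (l%:R * t))^-1) =
    trig_sum s n t * (trig_sum s n t)^*%C.
    rewrite conjc_trig_sum /trig_sum mulr_suml; apply: eq_bigr => k _.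
    by rewrite mulr_sumr; apply: eq_bigr => l _; ring.
  by rewrite mulcJ.
by apply: eq_bigr => k _; rewrite CReM /=; ring.
Qed.

End Parseval.

(** * Taylor coefficients as integrals over a circle *)

Section CoefficientExtraction.
Variable R : realType.
Local Notation C := (Cfield R).
Local Notation ReC := (@complex.Re R).

Lemma bounded_sum_tail (v : nat -> R) (B : R) : (forall n, 0 <= v n) ->
  (forall n, \sum_(k < n) v k <= B) -> forall e, 0 < e ->
  exists n0, forall n, (n0 <= n)%N -> forall m, \sum_(k < m) v (n + k)%N <= e.
Proof.
move=> v0 vB e e0; pose E := range (fun n => \sum_(k < n) v k).
have hE : has_sup E.
  by split; [exists (\sum_(k < 0) v k); exists 0%N | exists B => _ [n _ <-]].
have [_ [n0 _ <-] Hn0] := sup_adherent e0 hE.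
exists n0 => n n0n m; have /(_ (\sum_(k < n + m) v k)) := @ub_le_sup _ E hE.2.
rewrite big_split_ord /= => /(_ _) H.
have {}H : \sum_(k < n) v k + \sum_(k < m) v (n + k)%N <= sup E.
  by apply: H; exists (n + m)%N => //; rewrite big_split_ord.
have : \sum_(k < n0) v k <= \sum_(k < n) v k.
  rewrite -(subnKC n0n) big_split_ord /= lerDl; apply: sumr_ge0 => i _; exact: v0.
move: Hn0 H; lra.
Qed.

Lemma ew_circle_point r (t : R) n :
  ew (circle_point r t) n = (ew r n)%:C%C * cis (n%:R * t) :> C.
Proof.
rewrite circle_pointE ewM /ew rmorphM /= rmorphXn /= fmorphV rmorph_nat cisX /=.
by rewrite -mulrA [_^-1 * _]mulrC.
Qed.

Variables (b : nat -> C) (r : R).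
Hypotheses (cb : entire_coeffs b) (r0 : 0 <= r).

Let s k := b k * (ew r k)%:C%C.

Let modulus_s k : modulus (s k) = modulus (b k) * ew r k.
Proof. by rewrite /s modulusM modulus_real ger0_norm // ew_ge0. Qed.

Lemma egf_circle_approx e : 0 < e -> exists n0, forall n, (n0 <= n)%N -> forall t,
  modulus (egf b (circle_point r t) - trig_sum s n t) <= e.
Proof.
move=> e0; have [K HK] := cb r0.
have [n0 Hn0] := @bounded_sum_tail (fun k => modulus (b k) * ew r k) K
  (fun k => mulr_ge0 (modulus_ge0 _) (ew_ge0 k r0)) HK e e0.
exists n0 => n n0n t.
have -> : trig_sum s n t = \sum_(k < n) b k * ew (circle_point r t) k.
  by apply: eq_bigr => k _; rewrite ew_circle_point mulrA.
have mc : modulus (circle_point r t) = r by exact: modulus_circle_point.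
apply: (csum_tail (u := fun k => b k * ew (circle_point r t) k) (A := K)).
  by apply: egf_summable; rewrite mc.
move=> m; apply: le_trans (Hn0 n n0n m); apply: ler_sum => k _.
by rewrite modulusM modulus_ew mc.
Qed.

Lemma coefficient_extraction n :
  cint 0 (2 * pi) (fun t => egf b (circle_point r t) * (cis (n%:R * t))^-1) =
    (2 * pi)%:C%C * s n.
Proof.
have ee : entire (egf b) by exact: entire_egf.
have cf : ccont (fun t => egf b (circle_point r t)).
  exact/entire_comp_ccont/ccont_circle_point.
have p0 := pi2_gt0 R.
apply: eq_of_modulus_le => e e0.
have e1 : 0 < e / (2 * (2 * pi)) by rewrite divr_gt0 // mulr_gt0.
have [n0 /(_ (maxn n0 n.+1) (leq_maxl _ _))] := egf_circle_approx e1.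
have := leq_maxr n0 n.+1; set m := maxn _ _ => nm H.
have -> : (2 * pi)%:C%C * s n =
    cint 0 (2 * pi) (fun t => trig_sum s m t * (cis (n%:R * t))^-1).
  transitivity (cint 0 (2 * pi) (fun t => \sum_(k < m)
      s k * (cis (k%:R * t) * (cis (n%:R * t))^-1))); last first.
    by apply: eq_cint => t _; rewrite mulr_suml; apply: eq_bigr => k _; rewrite mulrA.
  have cc (k l : nat) : ccont (fun t : R => cis (k%:R * t) * (cis (l%:R * t))^-1).
    by apply: ccontM; [exact: ccont_cis_nat | exact: ccont_cis_natV].
  rewrite (cint_sum _ (F := fun (k : 'I_m) t =>
    s k * (cis (k%:R * t) * (cis (n%:R * t))^-1))); last first.
    by move=> k; apply: ccontM => //; exact: ccont_cst.
  rewrite (bigD1 (Ordinal nm)) //= big1 => [|k kn]; last first.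
    by rewrite cintZ // cint_cis_orth ifN ?mulr0.
  by rewrite cintZ // cint_cis_orth eqxx addr0 mulrC.
rewrite -cintB; last 2 first.
- by apply: ccontM => //; exact: ccont_cis_natV.
- by apply: ccontM; [exact: ccont_trig_sum | exact: ccont_cis_natV].
apply: (@le_trans _ _ (2 * (e / (2 * (2 * pi)) * (2 * pi - 0)))); last first.
  have aux (q x : R) : q != 0 -> 2 * (x / (2 * q) * q) = x by move=> q0; field.
  by rewrite subr0 aux // gt_eqF.
apply: modulus_cint_le; first exact: ltW.
  apply: ccontB; apply: ccontM => //; try exact: ccont_cis_natV.
  exact: ccont_trig_sum.
by move=> t _; rewrite -mulrBl modulusM modulusV modulus_cis invr1 mulr1.
Qed.

Lemma coefficient_le_mean n : 0 < r ->
  modulus (b n) * ew r n <= 2 * integral_mean 1 (egf b) r.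
Proof.
move=> r1; have ee : entire (egf b) by exact: entire_egf.
have cf : ccont (fun t => egf b (circle_point r t)).
  exact/entire_comp_ccont/ccont_circle_point.
have p0 := pi2_gt0 R.
have := @modulus_cint R 0 (2 * pi) _ (ccontM cf (ccont_cis_natV n)).
rewrite coefficient_extraction modulusM modulus_real gtr0_norm // modulus_s.
have I0 := integral_mean_ge0 (egf b) r 1.
have := @le_integral_mean R (egf b) r 1 _ ee ltr01 I0 (lexx _).
rewrite powRr1 // => H1 H2; rewrite -(@ler_pM2l _ (2 * pi)) //.
apply: (le_trans H2); rewrite mulrCA ler_pM2l //; apply: le_trans H1.
rewrite le_eqVlt; apply/orP; left; apply/eqP; apply: eq_rint => t _.
by rewrite modulusM modulusV modulus_cis invr1 mulr1 powRr1 // modulus_ge0.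
Qed.

(* Pairing with a trigonometric polynomial whose coefficients are the signs of
   the Taylor coefficients turns the sum of their moduli into an integral. *)
Lemma coefficient_sum_le (P : pred nat) n :
  exists2 h : R -> C, ccont h &
   [/\ forall t, modulus (h t) <= (\sum_(k < n) P k)%:R,
     rint 0 (2 * pi) (fun t => modulus (h t) ^+ 2) <= 2 * pi * (\sum_(k < n) P k)%:R &
     2 * pi * \sum_(k < n | P k) modulus (b k) * ew r k <=
       2 * rint 0 (2 * pi) (fun t => circle_modulus (egf b) r t * modulus (h t))].
Proof.
pose sg k : C := if P k then b k * ((modulus (b k))^-1)%:C%C else 0.
have msg k : modulus (sg k) <= (P k)%:R.
  rewrite /sg; case: (P k); last by rewrite modulus0.
  have [->|bk] := eqVneq (b k) 0; first by rewrite mul0r modulus0.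
  rewrite modulusM modulus_real ger0_norm ?invr_ge0 ?modulus_ge0 // mulfV //.
  by rewrite modulus_eq0.
have natS : (\sum_(k < n) P k)%:R = \sum_(k < n) (P k)%:R :> R by rewrite natr_sum.
exists (trig_sum sg n); first exact: ccont_trig_sum.
split.
- move=> t; apply: le_trans (modulus_sum _ _ _) _; rewrite natS; apply: ler_sum => k _.
  by rewrite modulusM modulus_cis mulr1.
- rewrite parseval ler_pM2l ?pi2_gt0 // natS; apply: ler_sum => k _.
  have := msg k; have := modulus_ge0 (sg k).
  case: (P k) => /= h1 h2; [by apply: exprn_ile1|].
  have -> : modulus (sg k) = 0 by apply/eqP; rewrite eq_le h2.
  by rewrite expr0n.
have ee : entire (egf b) by exact: entire_egf.
have cf : ccont (fun t => egf b (circle_point r t)).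
  exact/entire_comp_ccont/ccont_circle_point.
pose g t := \sum_(k < n) (sg k)^*%C * (egf b (circle_point r t) * (cis (k%:R * t))^-1).
have ck (k : nat) : ccont (fun t => egf b (circle_point r t) * (cis (k%:R * t))^-1).
  by apply: ccontM => //; exact: ccont_cis_natV.
have cg : ccont g by apply: ccont_sum => k; apply: ccontM => //; exact: ccont_cst.
have gE t : g t = egf b (circle_point r t) * (trig_sum sg n t)^*%C.
  by rewrite conjc_trig_sum mulr_sumr; apply: eq_bigr => k _; rewrite mulrCA.
have := modulus_cint 0 (2 * pi) cg.
have -> : cint 0 (2 * pi) g =
    (2 * pi * \sum_(k < n | P k) modulus (b k) * ew r k)%:C%C.
  rewrite /g (cint_sum _ (F := fun (k : 'I_n) t =>
    (sg k)^*%C * (egf b (circle_point r t) * (cis (k%:R * t))^-1))); last first.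
    by move=> k; apply: ccontM => //; exact: ccont_cst.
  rewrite rmorphM /= (rmorph_sum (real_complex R)) /= mulr_sumr [RHS]big_mkcond /=.
  apply: eq_bigr => k _; rewrite cintZ // coefficient_extraction /sg /s.
  case: (P k); last by rewrite conjc0 mul0r.
  have [->|bk] := eqVneq (b k) 0; first by rewrite mul0r conjc0 modulus0 !mul0r rmorph0 mulr0.
  have mb : (modulus (b k))%:C%C * ((modulus (b k))^-1)%:C%C = 1 :> C.
    by rewrite -rmorphM /= mulfV ?rmorph1 // modulus_eq0.
  rewrite conjc_mul conjc_real [LHS](_ : _ = (2 * pi)%:C%C * (ew r k)%:C%C *
     (b k * (b k)^*%C) * ((modulus (b k))^-1)%:C%C); last by ring.
  rewrite mulcJ rmorphXn rmorphM /= expr2 [LHS](_ : _ = (2 * pi)%:C%C * ((modulus (b k))%:C%C *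
     (ew r k)%:C%C) * ((modulus (b k))%:C%C * ((modulus (b k))^-1)%:C%C)); last by ring.
  by rewrite mb mulr1 !rmorphM.
rewrite modulus_real ger0_norm; last first.
  rewrite mulr_ge0 ?(ltW (pi2_gt0 R)) //; apply: sumr_ge0 => k _.
  by rewrite mulr_ge0 ?modulus_ge0 ?ew_ge0.
move/le_trans; apply; rewrite ler_pM2l // le_eqVlt; apply/orP; left; apply/eqP.
by apply: eq_rint => t _; rewrite gE modulusM modulus_conjc.
Qed.

End CoefficientExtraction.

(** * Optimality *)

Section Pairing.
Variable R : realType.
Local Notation C := (Cfield R).
Variables (f : C -> C) (r L A : R) (h : R -> C).
Hypotheses (ef : entire f) (L1 : 1 <= L) (A0 : 0 < A) (ch : ccont h).
Hypotheses (hL : forall t, modulus (h t) <= L)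
  (h2 : rint 0 (2 * pi) (fun t => modulus (h t) ^+ 2) <= 2 * pi * L).

Let F := circle_modulus f r.
Let H t := modulus (h t).

Let F0 t : 0 <= F t. Proof. exact: modulus_ge0. Qed.
Let H0 t : 0 <= H t. Proof. exact: modulus_ge0. Qed.
Let cF : continuous F. Proof. exact: continuous_circle_modulus. Qed.
Let cH : continuous H. Proof. exact: ccont_modulus. Qed.
Let L0 : 0 < L. Proof. exact: lt_le_trans ltr01 L1. Qed.
Let p20 : 0 <= 2 * pi :> R. Proof. exact: ltW (pi2_gt0 R). Qed.

Let cZ (k : R) (g : R -> R) : continuous g -> continuous (fun x : R => k * g x).
Proof. by move=> cg x; apply: cvgM; [exact: cvg_cst | exact: cg]. Qed.

Let cD (g k : R -> R) : continuous g -> continuous k -> continuous (fun x : R => g x + k x).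
Proof. by move=> cg ck x; apply: cvgD; [exact: cg | exact: ck]. Qed.

Let cFH : continuous (fun t => F t * H t).
Proof. by move=> x; apply: cvgM; [exact: cF | exact: cH]. Qed.

Let cH2 : continuous (fun t => H t ^+ 2).
Proof. by move=> x; rewrite /=; apply: cvgM; exact: cH. Qed.

(** Hoelder's inequality with conjugate exponent [q > 2]: the two bounds on [h] make the mean of
    [|h|^q] at most [L^(q-1)], and [(q - 1) / q = 1 / p]. It is proved by Young's inequality at each
    point; bounding the weights [1/p] and [1/q] by 1 costs the factor 2. *)
Lemma pairing_small p : 1 < p -> p < 2 -> Lp_mean p%:E f r <= A ->
  rint 0 (2 * pi) (fun t => F t * H t) <= 2 * pi * (2 * (A * L `^ p^-1)).
Proof.
move=> p1 p2; have p0 : 0 < p by apply: lt_trans p1.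
move=> /(le_integral_mean ef p0 (ltW A0)) fA.
pose q := p / (p - 1); have q0 : 0 < q by rewrite divr_gt0 // subr_gt0.
have q2 : 2 < q by rewrite ltr_pdivlMr ?subr_gt0 //; lra.
have pm : p - 1 != 0 by rewrite subr_eq0 gt_eqF.
have pn : p != 0 by rewrite gt_eqF.
have pq : p^-1 + q^-1 = 1 by rewrite /q; field; rewrite pn pm.
pose B := L `^ p^-1; have B0 : 0 < B by rewrite powR_gt0.
have cFp := @continuous_circle_modulus_powR R f r p ef p0.
pose a := A * B / A `^ p; pose b := A * B / L.
have a0 : 0 <= a by rewrite /a !mulr_ge0 ?invr_ge0 ?powR_ge0 ?ltW.
have b0 : 0 <= b by rewrite /b !mulr_ge0 ?invr_ge0 ?powR_ge0 ?ltW.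
apply: (@le_trans _ _ (rint 0 (2 * pi) (fun t => a * F t `^ p + b * H t ^+ 2))).
  apply: ler_rint => //; first by apply: cD; exact: cZ.
  move=> t _; have Hq : H t `^ q <= L `^ (q - 2) * H t ^+ 2.
    have [->|Ht] := eqVneq (H t) 0; first by rewrite powR0 ?gt_eqF // expr0n mulr0.
    have -> : H t `^ q = H t `^ (q - 2) * H t ^+ 2.
      rewrite -powR_mulrn // -powRD ?subrK //; apply/implyP => _; exact: Ht.
    rewrite ler_wpM2r ?sqr_ge0 //; apply: ge0_ler_powR; rewrite ?nnegrE ?(ltW L0) ?hL //.
    by rewrite subr_ge0 ltW.
  have := conjugate_powR (divr_ge0 (F0 t) (ltW A0)) (divr_ge0 (H0 t) (ltW B0)) p0 q0 pq.
  rewrite !powRM ?invr_ge0 ?(ltW A0) ?(ltW B0) // !powRV ?(ltW A0) ?(ltW B0) //.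
  have -> : B `^ q = L `^ (q - 1).
    by rewrite /B -powRrM; congr (_ `^ _); rewrite /q; field; rewrite pn pm.
  set X := F t `^ p; set Y := H t `^ q in Hq * => HY.
  have X0 : 0 <= X by exact: powR_ge0.
  have Y0 : 0 <= Y by exact: powR_ge0.
  have Lq : 0 < L `^ (q - 1) by rewrite powR_gt0.
  have Ap : 0 < A `^ p by rewrite powR_gt0.
  have e1 : X / A `^ p / p <= X / A `^ p.
    by rewrite ler_pdivrMr // ler_peMr ?(ltW p1) // divr_ge0 // ltW.
  have e2 : Y / L `^ (q - 1) / q <= H t ^+ 2 / L.
    apply: (@le_trans _ _ (Y / L `^ (q - 1))).
      rewrite ler_pdivrMr // ler_peMr //; first by rewrite divr_ge0 // ltW.
      by apply: ltW; apply: lt_trans q2; lra.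
    rewrite ler_pdivrMr //; apply: (le_trans Hq).
    have -> : L `^ (q - 1) = L `^ (q - 2) * L.
      rewrite -{3}(powRr1 (ltW L0)) -powRD; first by congr (_ `^ _); ring.
      by apply/implyP => _; rewrite gt_eqF.
    rewrite le_eqVlt; apply/orP; left; apply/eqP.
    have Ln : L != 0 by rewrite gt_eqF.
    by move: (L `^ (q - 2)) => u; field.
  rewrite /a /b [leLHS](_ : _ = A * B * (F t / A * (H t / B))); last first.
    by field; rewrite !gt_eqF.
  rewrite [leRHS](_ : _ = A * B * (X / A `^ p + H t ^+ 2 / L)); last by ring.
  apply: ler_wpM2l; first by rewrite mulr_ge0 ?ltW.
  by apply: (le_trans HY); exact: lerD.
rewrite rintD; try exact: cZ; rewrite !rintZ //.
apply: (le_trans (lerD (ler_wpM2l a0 fA) (ler_wpM2l b0 h2))).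
rewrite le_eqVlt; apply/orP; left; apply/eqP; rewrite /a /b.
have Ap : A `^ p != 0 by rewrite gt_eqF // powR_gt0.
have Ln : L != 0 by rewrite gt_eqF.
move: (A `^ p) Ap (2 * pi) => u un v.
by rewrite -/B; field; rewrite un Ln.
Qed.

(** For finite [p] it suffices that [(F / A)^2 <= 1 + (F / A)^p], and for [p = +oo] that
    [(F / A)^2 <= 1]; then [x y <= (x^2 + y^2) / 2], with [H] normalised by [sqrt L], acts as the
    Cauchy-Schwarz inequality. *)
Lemma pairing_large (p : \bar R) : (2%:E <= p)%E -> Lp_mean p f r <= A ->
  rint 0 (2 * pi) (fun t => F t * H t) <= 2 * pi * (2 * (A * L `^ 2^-1)).
Proof.
move=> p2 fA; set B := L `^ 2^-1; have B0 : 0 < B by rewrite powR_gt0.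
have B2 : B ^+ 2 = L by rewrite -powR_mulrn ?powR_ge0 // -powRrM mulVf // powRr1 // ltW.
have [X [cX HX IX]] : exists X : R -> R, [/\ continuous X,
    forall t, (F t / A) ^+ 2 <= 1 + X t & rint 0 (2 * pi) X <= 2 * pi].
  case: p p2 fA => [p| |] //=; last first.
    move=> _ fA; exists (fun=> 0); split; first exact: cst_continuous.
      move=> t; rewrite addr0 expr_le1 //; last by rewrite divr_ge0 // ltW.
      by rewrite ler_pdivrMr // mul1r; apply: le_trans fA; exact: circle_modulus_le_max.
    by rewrite rint_cst // mul0r.
  rewrite lee_fin => p2; have p0 : 0 < p by apply: lt_le_trans p2.
  move=> /(le_integral_mean ef p0 (ltW A0)) fA.
  have Ap : 0 < A `^ p by rewrite powR_gt0.
  have cFp := @continuous_circle_modulus_powR R f r p ef p0.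
  exists (fun t => (A `^ p)^-1 * F t `^ p); split; first exact: cZ.
  - move=> t; set x := F t / A; have x0 : 0 <= x by rewrite divr_ge0 // ltW.
    have -> : (A `^ p)^-1 * F t `^ p = x `^ p.
      by rewrite /x powRM ?invr_ge0 ?(ltW A0) // powRV ?(ltW A0) // mulrC.
    have [x1|/ltW x1] := leP x 1.
      by apply: (@le_trans _ _ 1); [rewrite expr_le1 | rewrite lerDl powR_ge0].
    apply: (@le_trans _ _ (x `^ p)); last by rewrite lerDr.
    by rewrite -powR_mulrn //; exact: ler_powR.
  - by rewrite rintZ // mulrC ler_pdivrMr.
pose g t := A * B / 2 + (A * B / 2 * X t + A * B / 2 / L * H t ^+ 2).
have k0 : 0 <= A * B / 2 by rewrite !mulr_ge0 ?invr_ge0 ?ltW.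
apply: (@le_trans _ _ (rint 0 (2 * pi) g)).
  apply: ler_rint => //.
    by apply: cD; [exact: cst_continuous | apply: cD; exact: cZ].
  move=> t _; have := HX t; set x := F t / A => hx.
  have -> : F t * H t = A * B * (x * (H t / B)) by rewrite /x; field; rewrite !gt_eqF.
  have -> : g t = A * B * ((1 + X t + (H t / B) ^+ 2) / 2).
    by rewrite /g expr_div_n B2; field; rewrite gt_eqF.
  apply: ler_wpM2l; first by rewrite mulr_ge0 ?ltW.
  by have := sqr_ge0 (x - H t / B); rewrite sqrrB -mulr_natl; move: hx; lra.
rewrite /g rintD; [|exact: cst_continuous|by apply: cD; exact: cZ].
rewrite rint_cst // subr0 rintD; try exact: cZ; rewrite !rintZ //.
have L0' : 0 <= A * B / 2 / L by rewrite divr_ge0 // ltW.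
apply: (le_trans (lerD (lexx _) (lerD (ler_wpM2l k0 IX) (ler_wpM2l L0' h2)))).
have -> : A * B / 2 / L * (2 * pi * L) = A * B / 2 * (2 * pi).
  have Ln : L != 0 by rewrite gt_eqF.
  by move: (2 * pi) => v; field.
have : 0 <= A * B / 2 * (2 * pi) by rewrite mulr_ge0.
move: (2 * pi) => v; lra.
Qed.

Lemma growth_exponent_gt0 (p : \bar R) : (1 < p)%E -> 0 < growth_exponent p <= 1.
Proof.
rewrite /growth_exponent; case: ifP => [_|/negbT]; first by lra.
case: p => [p| |] //=; last by rewrite leey.
rewrite lte_fin => _ p1; have p0 : 0 < p by apply: lt_trans p1.
by rewrite divr_gt0 ?mulr_gt0 // ler_pdivrMr ?mulr_gt0 // mul1r; lra.
Qed.

(** The exponents 1/2 and 1/p of [L] are both twice the growth exponent: when [L] is of order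
    [sqrt r], the power of [L] is of order [r^a(p)]. *)
Lemma pairing (p : \bar R) : (1 < p)%E -> Lp_mean p f r <= A ->
  rint 0 (2 * pi) (fun t => F t * H t) <=
    2 * pi * (2 * (A * L `^ (2 * growth_exponent p))).
Proof.
move=> p1 fA; rewrite /growth_exponent; case: ifP => [p2|/negbT].
  have -> : 2 * (1 / 4) = 2^-1 :> R by lra.
  exact: pairing_large fA.
case: p p1 fA => [p| |] //; last by rewrite leey.
rewrite lte_fin lee_fin -ltNge => p1 fA p2 /=.
have -> : 2 * (1 / (2 * p)) = p^-1 by field; rewrite gt_eqF // (lt_trans _ p1).
exact: pairing_small.
Qed.

End Pairing.

Lemma sum_blocks (V : nmodType) (F : nat -> V) m L :
  \sum_(k < m * L) F k = \sum_(j < m) \sum_(i < L) F (j * L + i)%N.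
Proof.
elim: m => [|m IH]; first by rewrite !big_ord0.
by rewrite mulSnr big_split_ord big_ord_recr /= IH.
Qed.

(** * Lower density and upper limits *)

Section DensityAndLimsup.
Variable R : realType.
Local Notation C := (Cfield R).

Definition count_upto (A : set nat) n := (\sum_(1 <= k < n.+1) `[< A k >])%N.

Lemma lower_density_gt0P (A : set nat) : (0 < lower_density R A)%E <->
  exists2 d : R, 0 < d & exists n0, forall n, (n0 <= n)%N -> d * n%:R <= (count_upto A n)%:R.
Proof.
pose u n := ((count_upto A n)%:R / n%:R : R).
have -> : lower_density R A = ereal_sup [set ereal_inf ((fun n => (u n)%:E) @` V) | V in \oo].
  by rewrite /lower_density -limf_einfE.
split.
- move=> /ereal_sup_gt[_ [V [n0 _ nV] <-]] V0.
  have [c c0 cV] : exists2 c : R, 0 < c & (c%:E <= ereal_inf ((fun n => (u n)%:E) @` V))%E.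
    case: (ereal_inf _) V0 => [c| |] //= c0; first by exists c; rewrite ?lexx // -lte_fin.
    by exists 1 => //; rewrite leey.
  exists c => //; exists (maxn n0 1) => n; rewrite geq_max => /andP[nn n1].
  rewrite -ler_pdivlMr ?ltr0n // -lee_fin; apply: (le_trans cV).
  by apply: ereal_inf_lbound; exists n => //; apply: nV.
- move=> [d d0 [n0 Hn0]]; apply: (@lt_le_trans _ _ d%:E); first by rewrite lte_fin.
  apply: le_ereal_sup_tmp.
  exists (ereal_inf ((fun n => (u n)%:E) @` [set n | (maxn n0 1 <= n)%N])).
    by exists [set n | (maxn n0 1 <= n)%N] => //; exists (maxn n0 1).
  apply: le_ereal_inf_tmp => _ [n /= nn <-]; move: nn; rewrite geq_max => /andP[nn n1].
  by rewrite lee_fin /u ler_pdivlMr ?ltr0n //; exact: Hn0.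
Qed.

Lemma limsup_pinfty_ge (g : R -> R) c :
  (forall M, exists2 r, M < r & c <= g r) -> (c%:E <= limsup_pinfty g)%E.
Proof.
move=> H; rewrite /limsup_pinfty limf_esupE; apply: le_ereal_inf_tmp => _ [V [M [_ MV]] <-].
have [r Mr cr] := H M; apply: le_ereal_sup_tmp; exists (g r)%:E; last by rewrite lee_fin.
by exists r => //; exact: MV.
Qed.

Lemma limsup_pinfty_eq_pinfty (g : R -> R) :
  (forall c M, exists2 r, M < r & c <= g r) -> limsup_pinfty g = +oo%E.
Proof.
by move=> H; apply: eq_infty => c; apply: limsup_pinfty_ge; exact: H.
Qed.

Lemma sum_below_le (x : R) n : 0 <= x -> \sum_(k < n) (k%:R < x)%R%:R <= x + 1.
Proof.
move=> x0; suff [_ //] : \sum_(k < n) (k%:R < x)%R%:R <= n%:R :> R /\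
  \sum_(k < n) (k%:R < x)%R%:R <= x + 1.
elim: n => [|n [IH1 IH2]]; first by rewrite big_ord0; split => //; apply: addr_ge0.
rewrite big_ord_recr /= -natr1; have [nx|nx] := ltP n%:R x.
  by split; [rewrite lerD2r | apply: lerD => //; apply: le_trans IH1 (ltW nx)].
by rewrite addr0; split => //; apply: (le_trans IH1); rewrite lerDl.
Qed.

(** Cut [[0, L^2)] into [L] windows. Those with [j < d L / 2] hold about half of the required
    [d L^2] points at most; were all the others to hold fewer than [d L / 4], the total would be too
    small. The lower bound on [j] places the window at indices of order [L^2]. *)
Lemma dense_window (A : set nat) (d : R) n0 : 0 < d -> d <= 1 ->
  (forall n, (n0 <= n)%N -> d * n%:R <= (count_upto A n)%:R) ->
  forall L, (n0 < L)%N -> 8 / d < L%:R ->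
  exists j, [/\ (j < L)%N, d / 2 * L%:R <= j%:R &
    d / 4 * L%:R <= (\sum_(i < L) `[< A (j * L + i)%N >])%:R].
Proof.
move=> d0 d1 HA L n0L Ld; apply: contrapT => H.
have L0 : 0 < L%:R :> R by rewrite ltr0n; lia.
pose W j := (\sum_(i < L) `[< A (j * L + i)%N >])%N.
have WL j : (W j <= L)%N.
  apply: (@leq_trans (\sum_(i < L) 1)%N); last by rewrite sum1_card card_ord.
  by apply: leq_sum => i _; case: (`[< _ >]).
have Wj j : (j < L)%N -> (W j)%:R <= L%:R * (j%:R < d / 2 * L%:R)%R%:R + d / 4 * L%:R.
  move=> jL; have dL : 0 <= d / 4 * L%:R by rewrite !mulr_ge0 ?invr_ge0 ?ltW.
  have [jd|jd] := ltP j%:R (d / 2 * L%:R).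
    by rewrite mulr1; apply: ler_wpDr => //; rewrite ler_nat.
  rewrite mulr0 add0r leNgt; apply/negP => /ltW hW; apply: H; exists j; split=> //.
have tot : (count_upto A (L * L).-1)%:R <= \sum_(j < L) (W j)%:R :> R.
  have -> : \sum_(j < L) (W j)%:R = \sum_(k < L * L) (`[< A k >])%:R :> R.
    rewrite (sum_blocks (fun k => (`[< A k >])%:R)); apply: eq_bigr => j _.
    by rewrite /W natr_sum.
  have LL : (0 < L * L)%N by rewrite muln_gt0; lia.
  rewrite /count_upto prednK // natr_sum.
  by rewrite -(big_mkord xpredT (fun k => (`[< A k >])%:R)) [leRHS]big_ltn // lerDr.
have n0LL : (n0 <= (L * L).-1)%N.
  have : (L * 1 <= L * L)%N by apply: leq_mul => //; lia.
  lia.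
have := le_trans (HA _ n0LL) tot.
have : \sum_(j < L) (W j)%:R <= L%:R * (d / 2 * L%:R + 1) + d / 4 * L%:R * L%:R :> R.
  apply: (@le_trans _ _ (\sum_(j < L) (L%:R * (j%:R < d / 2 * L%:R)%R%:R + d / 4 * L%:R))).
    by apply: ler_sum => j _; exact: Wj.
  rewrite big_split /= -mulr_sumr sumr_const card_ord -[X in _ + X <= _]mulr_natr lerD2r.
  apply: ler_wpM2l; first exact: ltW.
  by apply: sum_below_le; nonneg.
have -> : (L * L).-1%:R = L%:R * L%:R - 1 :> R.
  by rewrite -subn1 natrB ?natrM // muln_gt0; lia.
have L1 : 1 <= L%:R :> R by rewrite ler1n; lia.
move: Ld; rewrite ltr_pdivrMr // => Ld h1 h2.
have : 8 * L%:R < L%:R * d * L%:R by rewrite ltr_pM2r.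
have : d * 1 <= 1 by rewrite mulr1.
move: h1 h2; nra.
Qed.

End DensityAndLimsup.

(** * Lower bounds for the growth *)

Section Optimality.
Variable R : realType.
Local Notation C := (Cfield R).

Lemma entire_coeffs_shiftn (b : nat -> C) n :
  entire_coeffs b -> entire_coeffs (fun k => b (n + k)%N).
Proof.
move=> cb; elim: n => [//|n IH]; have := entire_coeffs_shift IH.
by congr entire_coeffs; apply/funext => k; rewrite addnS.
Qed.

(** The condition [c < |g(0)|] is open in the compact-open topology, and the [n]-th derivative of
    [egf b] at 0 is [b n]. The constant [c + 1] shows that it can be met. *)
Lemma hypercyclic_coeffs (b : nat -> C) (c : R) : 0 <= c -> entire_coeffs b ->
  D_frequently_hypercyclic (egf b) ->
  (0 < lower_density R [set n | (1 <= n)%N /\ (c < modulus (b n))%R])%E.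
Proof.
move=> c0 cb Hf.
pose O : set {compact-open, C -> C} := [set g | g @` [set 0] `<=` [set w | c < modulus w]].
have oO : open O.
  apply: compact_open_open; first exact: compact_set1.
  rewrite openE => w /= cw; apply/nbhs_modulusP; exists (modulus w - c); first by rewrite subr_gt0.
  by move=> w'; have := modulus_triB w w'; rewrite modulusBC /=; lra.
have := Hf (O `&` @entire R) (ex_intro2 _ _ O oO erefl).
have -> : [set n | (1 <= n)%N /\ (O `&` @entire R) (derive1n n (egf b))] =
   [set n | (1 <= n)%N /\ c < modulus (b n)].
  apply/seteqP; split => n /= [n1].
    rewrite derive1n_egf // => -[/(_ (egf (fun k => b (n + k)%N) 0)) H _].
    by split=> //; have := H (ex_intro2 _ _ 0 erefl erefl); rewrite egf_at0 addn0.
  move=> cbn; split=> //; rewrite derive1n_egf //; split.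
    by move=> _ [_ -> <-]; rewrite /= egf_at0 addn0.
  exact/entire_egf/entire_coeffs_shiftn.
apply; exists (fun=> (c + 1)%:C%C); split.
  by move=> _ [_ _ <-] /=; rewrite modulus_real ger0_norm ?addr_ge0 // ltrDl.
by move=> z; exact: derivable_cst.
Qed.

Lemma lower_density_infinite (A : set nat) : (0 < lower_density R A)%E ->
  forall m, exists2 n, (m < n)%N & A n.
Proof.
move=> /lower_density_gt0P[d d0 [n0 Hn0]] m; apply: contrapT => H.
have cm n : (count_upto A n <= m)%N.
  rewrite /count_upto; have [nm|/ltnW mn] := leqP n m.
    apply: (@leq_trans (\sum_(1 <= k < n.+1) 1)%N).
      by apply: leq_sum => k _; case: `[< _ >].
    by rewrite sum_nat_const_nat muln1 subn1.
  have -> : (\sum_(1 <= k < n.+1) `[< A k >] =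
      \sum_(1 <= k < m.+1) `[< A k >] + \sum_(m.+1 <= k < n.+1) `[< A k >])%N.
    by rewrite -big_cat_nat.
  have -> : (\sum_(m.+1 <= k < n.+1) `[< A k >] = 0)%N.
    rewrite big_nat_cond big1 // => k /andP[/andP[mk _] _]; case: asboolP => // Ak.
    by exfalso; apply: H; exists k.
  rewrite addn0; apply: (@leq_trans (\sum_(1 <= k < m.+1) 1)%N).
    by apply: leq_sum => k _; case: `[< _ >].
  by rewrite sum_nat_const_nat muln1 subn1.
pose n := maxn n0 (Num.truncn (m%:R / d)).+1.
have := Hn0 n (leq_maxl _ _); apply/negP; rewrite -ltNge.
apply: (@le_lt_trans _ _ m%:R); first by rewrite ler_nat.
rewrite mulrC -ltr_pdivrMr //.
apply: (@lt_le_trans _ _ (Num.truncn (m%:R / d)).+1%:R); first exact: truncnS_gt.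
by rewrite ler_nat leq_maxr.
Qed.

Theorem optimal_one (f : C -> C) : entire f -> D_frequently_hypercyclic f ->
  limsup_pinfty (fun r : R => r `^ (1 / 2) * expR (- r) * Lp_mean 1%:E f r) = +oo%E.
Proof.
move=> /entire_egfP[b cb ->] Hf; apply: limsup_pinfty_eq_pinfty => c M.
(* The radius will be the index [n] itself, where [sqrt n * ew n n] is at least [e^(n - 1)]: this
   loses the factor [expR 1]. The 2 is that of [coefficient_le_mean]. *)
have k0 : 0 <= `|c| * 2 * expR 1 by nonneg.
have [n Mn [n1 bn]] := lower_density_infinite (hypercyclic_coeffs k0 cb Hf) (Num.truncn `|M|).
have nM : M < n%:R.
  apply: le_lt_trans (ler_norm M) _; apply: lt_le_trans (truncnS_gt _) _.
  by rewrite ler_nat.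
exists n%:R => //; set r : R := n%:R.
have r0 : 0 < r by rewrite ltr0n.
have hc := coefficient_le_mean cb (ltW r0) n r0.
have hl := ew_lower n1 (lexx r).
rewrite -/r subrr expr0n mul0r oppr0 expR0 mulr1 in hl.
rewrite /Lp_mean; set I := integral_mean _ _ _ in hc *.
have -> : r `^ (1 / 2) = Num.sqrt r by rewrite div1r powR12_sqrt // ltW.
apply: le_trans (ler_norm c) _.
rewrite -(@ler_pM2r _ (2 * expR 1 * expR r)) ?mulr_gt0 ?expR_gt0 //.
apply: (@le_trans _ _ (modulus (b n) * expR r)).
  by rewrite !mulrA ler_wpM2r ?expR_ge0 // ltW.
rewrite (expRN 1) in hl; rewrite (expRN r); have er := expR_gt0 r; have e1 := expR_gt0 (1 : R).
have -> : Num.sqrt r * (expR r)^-1 * I * (2 * expR 1 * expR r) =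
   expR 1 * Num.sqrt r * (2 * I) by field; rewrite gt_eqF.
apply: (@le_trans _ _ (modulus (b n) * (expR 1 * (Num.sqrt r * ew r n)))).
  rewrite ler_wpM2l ?modulus_ge0 //.
  by have := ler_wpM2l (ltW e1) hl; rewrite mulrA mulfV ?mul1r // gt_eqF.
have -> : modulus (b n) * (expR 1 * (Num.sqrt r * ew r n)) =
  expR 1 * Num.sqrt r * (modulus (b n) * ew r n) by ring.
by apply: ler_wpM2l => //; rewrite mulr_ge0 ?sqrtr_ge0 ?ltW.
Qed.

Theorem optimal_Lp (p : \bar R) (f : C -> C) : (1 < p)%E -> entire f ->
  D_frequently_hypercyclic f ->
  (0 < limsup_pinfty (fun r : R =>
     (r `^ growth_exponent p * expR (- r) * Lp_mean p f r)%R))%E.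
Proof.
move=> p1 /entire_egfP[b cb ->] Hf; set a := growth_exponent p.
have /andP[a0 a1] : 0 < a <= 1 by exact: growth_exponent_gt0.
set A := [set n | (1 <= n)%N /\ 1 < modulus (b n)].
have /lower_density_gt0P[d' d'0 [n0 Hn0]] := hypercyclic_coeffs ler01 cb Hf.
pose d := Num.min d' 1; have d0 : 0 < d by rewrite lt_min d'0 ltr01.
have d1 : d <= 1 by rewrite ge_min lexx orbT.
have {}Hn0 n : (n0 <= n)%N -> d * n%:R <= (count_upto A n)%:R.
  move=> /Hn0; apply: le_trans; rewrite ler_wpM2r // ge_min lexx //.
(* [kap e^r] bounds [sqrt k * ew r k] from below on the window: there [k >= d L^2 / 2] and
   [r - k <= L], so the Gaussian exponent is at most [1 / d]. *)
pose kap := expR (-1) * expR (- d^-1); have kap0 : 0 < kap by rewrite mulr_gt0 ?expR_gt0.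
(* The last factor bounds [(r / L^2)^a] from below, since [r >= d L^2 / 2] and [a <= 1]. *)
pose c := kap * d / 32 * (d / 2).
have kd0 : 0 < kap * d by exact: mulr_gt0.
have c0 : 0 < c by rewrite /c; apply: mulr_gt0; exact: divr_gt0.
apply: (@lt_le_trans _ _ c%:E); first by rewrite lte_fin.
apply: limsup_pinfty_ge => M.
pose L := (maxn n0 (maxn (Num.truncn (8 / d)) (Num.truncn `|M|))).+1.
have n0L : (n0 < L)%N by rewrite ltnS leq_maxl.
have Ld : 8 / d < L%:R.
  by apply: (lt_le_trans (truncnS_gt _)); rewrite ler_nat /L ltnS !leq_max leqnn ?orbT.
have ML : M < L%:R.
  apply: le_lt_trans (ler_norm M) _; apply: (lt_le_trans (truncnS_gt _)).
  by rewrite ler_nat /L ltnS !leq_max leqnn ?orbT.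
have [j [jL dj Wj]] := dense_window d0 d1 Hn0 n0L Ld.
have L0 : 0 < L%:R :> R by rewrite ltr0n.
have L1 : 1 <= L%:R :> R by rewrite ler1n.
have j0 : 0 < j%:R :> R by apply: lt_le_trans dj; rewrite mulr_gt0 ?divr_gt0.
(* The right end of the window, so that its indices satisfy [k <= r] as [ew_lower] requires. *)
pose r : R := (j.+1 * L)%:R.
have rE : r = j.+1%:R * L%:R by rewrite /r natrM.
exists r; first by apply: lt_le_trans ML _; rewrite ler_nat leq_pmull.
have r0 : 0 < r by rewrite ltr0n muln_gt0.
pose P k := (j * L <= k)%N && `[< A k >].
have WE : (\sum_(k < j.+1 * L) P k)%N = (\sum_(i < L) `[< A (j * L + i)%N >])%N.
  rewrite mulSnr big_split_ord /= big1 ?add0n => [|k _]; last first.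
    by rewrite /P leqNgt ltn_ord.
  by apply: eq_bigr => i _; rewrite /P leq_addr.
have WL : (\sum_(k < j.+1 * L) P k <= L)%N.
  rewrite WE; apply: (@leq_trans (\sum_(i < L) 1)%N); last by rewrite sum1_card card_ord.
  by apply: leq_sum => i _; case: (`[< _ >]).
have [h ch [h1 h2 h3]] := coefficient_sum_le cb (ltW r0) P (j.+1 * L).
have lower : d / 4 * kap * expR r <= \sum_(k < j.+1 * L | P k) modulus (b k) * ew r k.
  apply: (@le_trans _ _ (\sum_(k < j.+1 * L | P k) (kap * expR r / L%:R))).
    have -> : \sum_(k < j.+1 * L | P k) (kap * expR r / L%:R) =
        kap * expR r / L%:R * (\sum_(k < j.+1 * L) P k)%:R.
      rewrite natr_sum mulr_sumr big_mkcond /=; apply: eq_bigr => k _.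
      by case: (P k); rewrite ?mulr1 ?mulr0.
    rewrite WE; have kL : 0 <= kap * expR r / L%:R by rewrite divr_ge0 ?mulr_ge0 ?expR_ge0 ?ltW.
    apply: le_trans (ler_wpM2l kL Wj); rewrite le_eqVlt; apply/orP; left; apply/eqP.
    by field; rewrite gt_eqF.
  apply: ler_sum => k /andP[jk /asboolP[k1 bk]].
  have kr : k%:R <= r by rewrite ler_nat ltnW.
  apply: (@le_trans _ _ (1 * ew r k)); last by rewrite ler_wpM2r ?ew_ge0 ?(ltW r0) ?(ltW bk).
  rewrite mul1r ler_pdivrMr //.
  have sk : Num.sqrt k%:R <= L%:R :> R.
    rewrite -(@ler_pXn2r _ 2) ?nnegrE ?sqrtr_ge0 // sqr_sqrtr // -natrX ler_nat.
    apply: (@leq_trans (j.+1 * L)); first by rewrite ltnW.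
    by rewrite -mulnn leq_mul.
  apply: (@le_trans _ _ (Num.sqrt k%:R * ew r k)); last first.
    by rewrite mulrC ler_wpM2l ?ew_ge0 ?(ltW r0).
  apply: le_trans (ew_lower k1 kr); rewrite ler_wpM2r ?expR_ge0 // /kap.
  rewrite ler_wpM2l ?expR_ge0 // ler_expR lerN2.
  have k0 : 0 < k%:R :> R by rewrite ltr0n.
  rewrite ler_pdivrMr ?mulr_gt0 //.
  have jk' : j%:R * L%:R <= k%:R :> R by rewrite -natrM ler_nat.
  have rk : r - k%:R <= L%:R by rewrite rE -natr1 mulrDl mul1r; lra.
  apply: (@le_trans _ _ (L%:R ^+ 2)).
    by apply: lerXn2r; rewrite ?nnegrE ?subr_ge0.
  have dk : d / 2 * L%:R * L%:R <= k%:R by apply: le_trans jk'; rewrite ler_pM2r.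
  rewrite -(@ler_pM2l _ d) // [leRHS]mulrA mulfV ?gt_eqF // mul1r expr2.
  by move: dk; lra.
rewrite leNgt; apply/negP => Hlt.
(* Were the mean above [B], the value at [r] would reach [c]. Were it at most [B], the pairing would
   bound by [kap d e^r / 8] a sum that is at least [kap d e^r / 4]. *)
pose B := kap * d / 32 * expR r * L%:R `^ (- (2 * a)).
have B0 : 0 < B by rewrite /B !mulr_gt0 ?expR_gt0 ?powR_gt0.
have ra0 : 0 < r `^ a * expR (- r) by rewrite mulr_gt0 ?expR_gt0 ?powR_gt0.
have LB : Lp_mean p (egf b) r <= B.
  rewrite leNgt; apply/negP => BL.
  suff : c <= r `^ a * expR (- r) * Lp_mean p (egf b) r by rewrite leNgt Hlt.
  apply: le_trans (ler_wpM2l (ltW ra0) (ltW BL)).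
  have ra : d / 2 * L%:R `^ (2 * a) <= r `^ a.
    apply: (@le_trans _ _ ((d / 2) `^ a * L%:R `^ (2 * a))).
      rewrite ler_wpM2r ?powR_ge0 //; apply: ger1_powR => //.
      by rewrite divr_gt0 //=; lra.
    rewrite powRrM powR_mulrn ?(ltW L0) // -powRM ?sqr_ge0 ?divr_ge0 ?(ltW d0) //.
    apply: ge0_ler_powR; rewrite ?nnegrE ?mulr_ge0 ?divr_ge0 ?sqr_ge0 ?(ltW d0) ?(ltW r0) ?(ltW a0) //.
    rewrite rE expr2 mulrA ler_wpM2r // ; apply: le_trans dj _.
    by rewrite ler_nat.
  have L2 : 0 < L%:R `^ (2 * a) :> R by rewrite powR_gt0.
  have -> : r `^ a * expR (- r) * B = r `^ a * (kap * d / 32 / L%:R `^ (2 * a)).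
    by rewrite /B powRN expRN; field; rewrite !gt_eqF ?expR_gt0.
  have k16 : 0 <= kap * d / 32 / L%:R `^ (2 * a).
    by apply: divr_ge0; [apply: divr_ge0 => //; exact: ltW | exact: ltW].
  apply: le_trans (ler_wpM2r k16 ra); rewrite /c.
  by rewrite le_eqVlt; apply/orP; left; apply/eqP; field; rewrite gt_eqF.
have eb : entire (egf b) by exact: entire_egf.
have hL t : modulus (h t) <= L%:R by apply: le_trans (h1 t) _; rewrite ler_nat.
have hL2 : rint 0 (2 * pi) (fun t => modulus (h t) ^+ 2) <= 2 * pi * L%:R.
  by apply: (le_trans h2); rewrite ler_pM2l ?pi2_gt0 // ler_nat.
have := pairing eb L1 B0 ch hL hL2 p1 LB; rewrite -/a => H.
have := le_trans (ler_wpM2l (ltW (pi2_gt0 R)) lower) h3; apply/negP; rewrite -ltNge.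
apply: (le_lt_trans (ler_wpM2l (ler0n R 2) H)).
have -> : 2 * (2 * pi * (2 * (B * L%:R `^ (2 * a)))) = 2 * pi * (4 * (B * L%:R `^ (2 * a))).
  by ring.
rewrite ltr_pM2l ?pi2_gt0 // /B powRN mulfVK ?gt_eqF ?powR_gt0 //.
have : 0 < kap * d * expR r by rewrite !mulr_gt0 ?expR_gt0.
by lra.
Qed.

End Optimality.

(** * Rudin-Shapiro signs *)

Section RudinShapiro.
Variable R : realType.
Local Notation C := (Cfield R).

Fixpoint rs_fuel k n : bool :=
  if k is k'.+1 then (odd n && odd n./2) (+) rs_fuel k' n./2 else false.

Lemma rs_fuel_enough k l n : (n <= k)%N -> (n <= l)%N -> rs_fuel k n = rs_fuel l n.
Proof.
elim: k l n => [|k IH] [|l] n //=.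
- rewrite leqn0 => /eqP -> _ /=; elim: l => //= l <- //.
- move=> _; rewrite leqn0 => /eqP -> /=; elim: k {IH} => //= k -> //.
- by move=> nk nl; congr (_ (+) _); apply: IH; lia.
Qed.

(* Parity of the number of blocks 11 in the binary expansion. *)
Definition rs n : bool := rs_fuel n n.

Lemma rsE n : rs n = (odd n && odd n./2) (+) rs n./2.
Proof.
case: n => // n; rewrite /rs [LHS]/=; congr (_ (+) _).
by apply: rs_fuel_enough; lia.
Qed.

Lemma rs_double n : rs n.*2 = rs n.
Proof. by rewrite rsE odd_double doubleK. Qed.

Lemma rs_doubleS n : rs n.*2.+1 = odd n (+) rs n.
Proof. by rewrite rsE /= odd_double uphalf_double. Qed.

(* Rudin-Shapiro signs, possibly twisted by (-1)^j and by a global sign. *)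
Definition rs_sign (s t : bool) (j : nat) : R := (-1) ^+ (rs j (+) (t && odd j) (+) s).

Lemma rs_sign_even s t j : rs_sign s t j.*2 = rs_sign s false j.
Proof. by rewrite /rs_sign rs_double odd_double andbF addbF. Qed.

Lemma rs_sign_odd s t j : rs_sign s t j.*2.+1 = rs_sign (s (+) t) true j.
Proof.
rewrite /rs_sign rs_doubleS /= odd_double; congr (_ ^+ nat_of_bool _).
by case: s; case: t; case: (odd j); case: (rs j).
Qed.

Definition rs_family : set (nat -> R) := [set e | exists s t, e = rs_sign s t].

Lemma rs_family_unit e j : rs_family e -> e j = 1 \/ e j = -1.
Proof. by move=> [s [t ->]]; rewrite /rs_sign; case: (_ (+) s); [right|left]. Qed.

Lemma rs_family_sample e (b : bool) : rs_family e -> rs_family (fun j => e (j.*2 + b)%N).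
Proof.
move=> [s [t ->]]; case: b.
  by exists (s (+) t), true; apply/funext => j; rewrite addn1 rs_sign_odd.
by exists s, false; apply/funext => j; rewrite addn0 rs_sign_even.
Qed.

(** The signs at [4n + 2] and [4n + 3] are opposite: ending in 11 instead of 10 adds exactly one
    block 11. One of them is therefore 1. *)
Lemma rs_sign_plus n : exists2 i, (i < 4)%N & rs_sign false false (4 * n + i) = 1.
Proof.
have E2 : rs_sign false false (4 * n + 2) = (-1) ^+ (odd n (+) rs n).
  rewrite (_ : (4 * n + 2 = (n.*2.+1).*2)%N); last by lia.
  by rewrite rs_sign_even /rs_sign rs_doubleS andFb !addbF.
have E3 : rs_sign false false (4 * n + 3) = - (-1) ^+ (odd n (+) rs n).
  rewrite (_ : (4 * n + 3 = (n.*2.+1).*2.+1)%N); last by lia.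
  rewrite rs_sign_odd /rs_sign rs_doubleS /= odd_double.
  by case: (odd n (+) rs n); rewrite /= ?expr0 ?expr1 ?opprK.
case b : (odd n (+) rs n).
  by exists 3%N => //; rewrite E3 b opprK.
by exists 2%N => //; rewrite E2 b.
Qed.

Definition rs_block (t : bool) k q (x : C) : C :=
  \sum_(j < 2 ^ k) (rs_sign false t (q * 2 ^ k + j))%:C%C * x ^+ j.

Lemma sum_even_odd (V : nmodType) (F : nat -> V) n :
  \sum_(j < n.*2) F j = \sum_(j < n) F j.*2 + \sum_(j < n) F j.*2.+1.
Proof.
elim: n => [|n IH]; first by rewrite !big_ord0 addr0.
by rewrite doubleS !big_ord_recr /= IH -!addrA; congr (_ + _); rewrite addrCA.
Qed.

Lemma rs_blockS t k q x : rs_block t k.+1 q x =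
  rs_block false k q (x ^+ 2) + (-1) ^+ t * (x * rs_block true k q (x ^+ 2)).
Proof.
rewrite {1}/rs_block expnS mul2n (sum_even_odd (fun j =>
  (rs_sign false t (q * (2 ^ k).*2 + j))%:C%C * x ^+ j)); congr (_ + _).
  apply: eq_bigr => j _; rewrite -exprM mul2n; congr (_%:C%C * _).
  by rewrite -doubleMr -doubleD rs_sign_even.
rewrite /rs_block !mulr_sumr; apply: eq_bigr => j _.
rewrite exprS -exprM mul2n -doubleMr addnS -doubleD rs_sign_odd addFb.
have -> : rs_sign t true (q * 2 ^ k + j) = (-1) ^+ t * rs_sign false true (q * 2 ^ k + j).
  by rewrite /rs_sign addbF signr_addb mulrC.
by rewrite rmorphM /= rmorphXn rmorphN rmorph1 /=; ring.
Qed.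

Lemma parallelogram (u v : C) :
  modulus (u + v) ^+ 2 + modulus (u - v) ^+ 2 = 2 * (modulus u ^+ 2 + modulus v ^+ 2).
Proof. by rewrite !modulus_sqr; case: u => a b; case: v => c d /=; ring. Qed.

(** By [rs_blockS] the two blocks are [P(x^2) + x Q(x^2)] and [P(x^2) - x Q(x^2)], so the
    parallelogram law doubles the sum of squares at each step, wherever the block is placed. *)
Lemma rs_block_pair k q x : modulus x = 1 ->
  modulus (rs_block false k q x) ^+ 2 + modulus (rs_block true k q x) ^+ 2 = 2 ^+ k.+1.
Proof.
elim: k x => [|k IH] x x1.
  have E t : modulus (rs_block t 0 q x) = 1.
    rewrite /rs_block big_ord1 expr0 mulr1 modulus_real /rs_sign.
    by rewrite normrX normrN1 expr1n.
  by rewrite !E !expr1n expr1.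
rewrite !rs_blockS expr0 expr1 mul1r mulN1r parallelogram modulusM x1 mul1r.
by rewrite IH ?modulusX ?x1 ?expr1n // exprS.
Qed.

Lemma rs_block_le t k q x : modulus x = 1 ->
  modulus (rs_block t k q x) <= Num.sqrt (2 ^+ k.+1).
Proof.
move=> x1; rewrite -(rs_block_pair k q x1) -[leLHS]ger0_norm ?modulus_ge0 // -sqrtr_sqr.
by rewrite ler_sqrt ?addr_ge0 ?sqr_ge0 //; case: t; rewrite ?lerDl ?lerDr sqr_ge0.
Qed.

(** A prefix either fits in the first half of the block or is that half followed by a prefix of the
    second. The constant 4 survives the induction because [sqrt 2 + 4 <= 4 sqrt 2], that is
    [4/3 <= sqrt 2]. *)
Lemma rs_prefix_le t k q x m : modulus x = 1 -> (m <= 2 ^ k)%N ->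
  modulus (\sum_(j < m) (rs_sign false t (q * 2 ^ k + j))%:C%C * x ^+ j)
    <= 4 * Num.sqrt (2 ^+ k).
Proof.
move=> x1; have s2 : Num.sqrt 2 ^+ 2 = 2 :> R by rewrite sqr_sqrtr.
have s20 : 0 <= Num.sqrt 2 :> R by exact: sqrtr_ge0.
have s4 : 4 / 3 <= Num.sqrt 2 :> R.
  by rewrite -(@ler_pXn2r _ 2) ?nnegrE ?divr_ge0 // s2 expr2; lra.
have sS k' : Num.sqrt (2 ^+ k'.+1) = Num.sqrt 2 * Num.sqrt (2 ^+ k') :> R.
  by rewrite exprS sqrtrM.
elim: k q m => [|k IH] q m mk.
  apply: (@le_trans _ _ 1); last by rewrite expr0 sqrtr1 mulr1 ler1n.
  apply: le_trans (modulus_sum _ _ _) _; apply: (@le_trans _ _ (\sum_(j < m) 1)).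
    apply: ler_sum => j _; rewrite modulusM modulus_real /rs_sign normrX normrN1 expr1n.
    by rewrite modulusX x1 expr1n mulr1.
  by rewrite sumr_const card_ord -[leRHS]/(1%:R) ler_nat.
have S0 := sqrtr_ge0 (2 ^+ k : R); rewrite sS.
have [ml|lm] := leqP m (2 ^ k).
  have := IH q.*2 m ml; rewrite -muln2 -mulnA -expnS => /le_trans; apply.
  have : 1 <= Num.sqrt 2 :> R by lra.
  nra.
have E : (q * 2 ^ k.+1 = q.*2 * 2 ^ k)%N by rewrite -muln2 -mulnA -expnS.
have -> : m = (2 ^ k + (m - 2 ^ k))%N by lia.
rewrite big_split_ord /= E; apply: le_trans (modulusD _ _) _.
have h1 : modulus (rs_block t k q.*2 x) <= Num.sqrt 2 * Num.sqrt (2 ^+ k).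
  by rewrite -sS; exact: rs_block_le.
have h2 : modulus (\sum_(j < m - 2 ^ k)
    (rs_sign false t (q.*2 * 2 ^ k + (2 ^ k + j)))%:C%C * x ^+ (2 ^ k + j))
    <= 4 * Num.sqrt (2 ^+ k).
  have mk' : (m - 2 ^ k <= 2 ^ k)%N by rewrite expnS in mk; lia.
  have := IH q.*2.+1 _ mk'.
  rewrite [X in modulus X <= _ -> _](_ : _ = \sum_(j < m - 2 ^ k)
    (rs_sign false t (q.*2 * 2 ^ k + (2 ^ k + j)))%:C%C * x ^+ j); last first.
    by apply: eq_bigr => j _; rewrite mulSnr -addnA.
  apply: le_trans; rewrite le_eqVlt; apply/orP; left; apply/eqP.
  transitivity (modulus (x ^+ (2 ^ k) * \sum_(j < m - 2 ^ k)
    (rs_sign false t (q.*2 * 2 ^ k + (2 ^ k + j)))%:C%C * x ^+ j)).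
    by congr modulus; rewrite mulr_sumr; apply: eq_bigr => j _; rewrite exprD mulrCA.
  by rewrite modulusM modulusX x1 expr1n mul1r.
apply: (le_trans (lerD h1 h2)); nra.
Qed.

End RudinShapiro.

(** * Residue classes *)

Section AbelSummation.
Variable R : realType.
Local Notation C := (Cfield R).
Variables (w : nat -> R) (s : nat -> C).
Hypothesis w0 : forall n, 0 <= w n.

Lemma abel_identity (v : nat -> R) (u : nat -> C) M :
  \sum_(n < M) (v n)%:C%C * u n =
    (v M)%:C%C * \sum_(n < M) u n
      - \sum_(n < M) (v n.+1 - v n)%:C%C * \sum_(k < n.+1) u k.
Proof.
elim: M => [|M IH]; first by rewrite !big_ord0 mulr0 subr0.
rewrite !big_ord_recr /= IH rmorphB /=; set A := \sum_(n < M) u n; ring.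
Qed.

(** The boundary term [v M] is bounded by the mean of [v] over the block plus its variation, and not
    by the maximum: over consecutive blocks the means then add up to the total sum divided by the
    block length. *)
Lemma abel_block (v : nat -> R) (u : nat -> C) M S : (0 < M)%N ->
  (forall n, 0 <= v n) ->
  (forall m, (m <= M)%N -> modulus (\sum_(n < m) u n) <= S) ->
  modulus (\sum_(n < M) (v n)%:C%C * u n) <=
    S * ((\sum_(n < M) v n) / M%:R + 2 * \sum_(n < M) `|v n.+1 - v n|).
Proof.
move=> M0 v0 uS; set TV := \sum_(n < M) `|v n.+1 - v n|.
have S0 : 0 <= S by apply: le_trans (uS 0%N (leq0n _)); exact: modulus_ge0.
have vM : v M <= (\sum_(n < M) v n) / M%:R + TV.
  have step k : (k <= M)%N -> v M <= v k + \sum_(n < M) `|v n.+1 - v n|.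
    move=> kM; have : v M <= v k + \sum_(n < M - k) `|v (k + n).+1 - v (k + n)%N|.
      rewrite -{1}(subnKC kM); elim: (M - k)%N => [|m IH]; first by rewrite addn0 big_ord0 addr0.
      rewrite big_ord_recr /= addnS; have := ler_norm (v (k + m).+1 - v (k + m)%N).
      by move: IH; lra.
    move=> /le_trans; apply; rewrite lerD2l.
    have -> : \sum_(n < M) `|v n.+1 - v n| = \sum_(n < k + (M - k)) `|v n.+1 - v n|.
      by rewrite subnKC.
    rewrite big_split_ord /= lerDr.
    by apply: sumr_ge0 => i _; exact: normr_ge0.
  rewrite -lerBlDr ler_pdivlMr ?ltr0n // mulrC.
  have -> : M%:R * (v M - TV) = \sum_(n < M) (v M - TV) by rewrite sumr_const card_ord mulr_natl.
  by apply: ler_sum => k _; rewrite lerBlDr; apply: step; exact: ltnW.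
rewrite abel_identity; apply: le_trans (modulusB _ _) _.
have h1 : modulus ((v M)%:C%C * \sum_(n < M) u n) <= v M * S.
  by rewrite modulusM modulus_real ger0_norm // ler_wpM2l // uS.
have h2 : modulus (\sum_(n < M) (v n.+1 - v n)%:C%C * \sum_(k < n.+1) u k) <= TV * S.
  apply: le_trans (modulus_sum _ _ _) _; rewrite /TV mulr_suml; apply: ler_sum => n _.
  by rewrite modulusM modulus_real ler_wpM2l // uS.
apply: (le_trans (lerD h1 h2)); rewrite -mulrDl mulrC; apply: ler_wpM2l => //.
by move: vM; lra.
Qed.

Lemma abel_windows Lam S Q : (0 < Lam)%N ->
  (forall q m, (m <= Lam)%N -> modulus (\sum_(n < m) s (q * Lam + n)%N) <= S) ->
  modulus (\sum_(n < Q * Lam) (w n)%:C%C * s n) <=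
    S * ((\sum_(n < Q * Lam) w n) / Lam%:R + 2 * \sum_(n < Q * Lam) `|w n.+1 - w n|).
Proof.
move=> L0 H; rewrite (sum_blocks (fun n => (w n)%:C%C * s n)) (sum_blocks w).
rewrite (sum_blocks (fun n => `|w n.+1 - w n|)) mulr_suml (mulr_sumr _ _ _ 2) -big_split /=.
rewrite mulr_sumr; apply: le_trans (modulus_sum _ _ _) _; apply: ler_sum => q _.
have := @abel_block (fun n => w (q * Lam + n)%N) (fun n => s (q * Lam + n)%N) Lam S L0
   (fun n => w0 _) (H q).
move=> /le_trans; apply; rewrite le_eqVlt; apply/orP; left; apply/eqP.
by congr (_ * (_ + 2 * _)); apply: eq_bigr => n _; rewrite addnS.
Qed.

End AbelSummation.

(** * Ramps and uniform bounds for residue classes *)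

Section RampedWeights.
Variable R : realType.
Local Notation C := (Cfield R).
Implicit Types (N n m : nat) (r : R).

(* A ramp increasing from 0 to 1, for which the weighted exponential series
   stays explicit: it subtracts from a series its value at a shrunk argument. *)
Definition ramp N n : R := 1 - (1 - N%:R^-1) ^+ n.

Lemma ramp_base N : (0 < N)%N -> 0 <= (1 - N%:R^-1 : R) <= 1.
Proof.
move=> N0; rewrite subr_ge0 gerBl invr_ge0 ler0n andbT invf_le1 ?ltr0n //.
by rewrite ler1n.
Qed.

Lemma ramp_ge0 N n : (0 < N)%N -> 0 <= ramp N n.
Proof. by move=> /ramp_base/andP[h0 h1]; rewrite subr_ge0 exprn_ile1. Qed.

Lemma ramp_le1 N n : (0 < N)%N -> ramp N n <= 1.
Proof. by move=> /ramp_base/andP[h0 h1]; rewrite gerBl exprn_ge0. Qed.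

Lemma ramp_mono N n : (0 < N)%N -> ramp N n <= ramp N n.+1.
Proof.
move=> /ramp_base/andP[h0 h1]; rewrite lerD2l lerN2 exprS ler_piMl ?exprn_ge0 //.
Qed.

Lemma ramp_le N n : (0 < N)%N -> ramp N n <= n%:R / N%:R.
Proof.
move=> N0; have /andP[h0 h1] := ramp_base N0.
elim: n => [|n IH]; first by rewrite /ramp expr0 subrr mul0r.
have -> : ramp N n.+1 = ramp N n + N%:R^-1 * (1 - N%:R^-1) ^+ n.
  by rewrite /ramp exprS; ring.
rewrite -natr1 mulrDl mul1r; apply: lerD => //.
by rewrite ler_piMr ?invr_ge0 // exprn_ile1.
Qed.

Definition ramped N r n : R := ramp N n * ew r n.

Lemma ramped_ge0 N r n : (0 < N)%N -> 0 <= r -> 0 <= ramped N r n.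
Proof. by move=> N0 r0; rewrite mulr_ge0 ?ramp_ge0 ?ew_ge0. Qed.

Lemma sum_ramped_le N r m : (0 < N)%N -> 0 <= r -> \sum_(n < m) ramped N r n <= expR r.
Proof.
move=> N0 r0; apply: le_trans (sum_ew_le m r0); apply: ler_sum => n _.
by rewrite ler_piMl ?ew_ge0 ?ramp_le1.
Qed.

Lemma sum_nat_ew_le r m : 0 <= r -> \sum_(n < m) n%:R * ew r n <= r * expR r.
Proof.
move=> r0; case: m => [|m]; first by rewrite big_ord0 mulr_ge0 ?expR_ge0.
rewrite big_ord_recl mul0r add0r /=.
under eq_bigr => n _ do rewrite /bump /= add1n ewS'.
by rewrite -mulr_sumr ler_wpM2l // sum_ew_le.
Qed.

Lemma sum_ramped_small N r m : (0 < N)%N -> 0 <= r ->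
  \sum_(n < m) ramped N r n <= r / N%:R * expR r.
Proof.
move=> N0 r0; apply: (@le_trans _ _ (N%:R^-1 * \sum_(n < m) n%:R * ew r n)).
  rewrite mulr_sumr; apply: ler_sum => n _; rewrite mulrA ler_wpM2r ?ew_ge0 //.
  by rewrite mulrC ramp_le.
by rewrite [leRHS]mulrAC mulrC ler_wpM2r ?invr_ge0 // sum_nat_ew_le.
Qed.

(** Product rule, with [12 = 8 + 4]: 8 for the variation of the weights, 4 for their maximum times
    the total increase of the ramp, which is at most 1. *)
Lemma ramped_variation N r m : (0 < N)%N -> 0 <= r ->
  Num.sqrt r * \sum_(n < m) `|ramped N r n.+1 - ramped N r n| <= 12 * expR r.
Proof.
move=> N0 r0; have s0 := sqrtr_ge0 r.
have h1 : \sum_(n < m) `|ramped N r n.+1 - ramped N r n| <=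
    \sum_(n < m) `|ew r n.+1 - ew r n| + \sum_(n < m) ew r n * (ramp N n.+1 - ramp N n).
  rewrite -big_split /=; apply: ler_sum => n _.
  have -> : ramped N r n.+1 - ramped N r n =
    ramp N n.+1 * (ew r n.+1 - ew r n) + ew r n * (ramp N n.+1 - ramp N n).
    by rewrite /ramped; ring.
  apply: le_trans (ler_normD _ _) _; rewrite (normrM (ramp _ _)) (normrM (ew _ _)); apply: lerD.
    by rewrite ger0_norm ?ramp_ge0 // ler_piMl ?ramp_le1.
  by rewrite ger0_norm ?ew_ge0 // ger0_norm // subr_ge0 ramp_mono.
have h2 : Num.sqrt r * \sum_(n < m) ew r n * (ramp N n.+1 - ramp N n) <= 4 * expR r.
  apply: (@le_trans _ _ (\sum_(n < m) 4 * expR r * (ramp N n.+1 - ramp N n))).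
    rewrite mulr_sumr; apply: ler_sum => n _; rewrite mulrA ler_wpM2r //.
      by rewrite subr_ge0 ramp_mono.
    exact: ew_max.
  rewrite -mulr_sumr -[leRHS]mulr1 ler_wpM2l ?mulr_ge0 ?expR_ge0 //.
  have -> : \sum_(n < m) (ramp N n.+1 - ramp N n) = ramp N m - ramp N 0.
    elim: m {h1} => [|k IH]; first by rewrite big_ord0 subrr.
    by rewrite big_ord_recr /= IH; ring.
  by rewrite {2}/ramp expr0 subrr subr0 ramp_le1.
have := ler_wpM2l s0 h1; rewrite mulrDr => /le_trans; apply.
have := ew_variation m r0; move: h2; lra.
Qed.

Definition residue_coeffs (e : nat -> R) (al i N : nat) (n : nat) : C :=
  if (n %% al == i)%N then (e (n %/ al)%N * ramp N n)%:C%C else 0.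

Definition unit_signs (e : nat -> R) := forall j, `|e j| = 1.

Lemma modulus_residue_coeffs e al i N n : unit_signs e -> (0 < N)%N ->
  modulus (residue_coeffs e al i N n) <= ramp N n.
Proof.
move=> e1 N0; rewrite /residue_coeffs; case: ifP => _; last by rewrite modulus0 ramp_ge0.
by rewrite modulus_real normrM e1 mul1r ger0_norm // ramp_ge0.
Qed.

Lemma bounded_entire_coeffs (c : nat -> C) (B : R) : (forall n, modulus (c n) <= B) ->
  entire_coeffs c.
Proof.
move=> cB rho rho0; exists (B * expR rho) => n.
have B0 : 0 <= B by apply: le_trans (cB 0%N); exact: modulus_ge0.
apply: (@le_trans _ _ (\sum_(k < n) B * ew rho k)).
  by apply: ler_sum => k _; rewrite ler_wpM2r ?ew_ge0.
by rewrite -mulr_sumr ler_wpM2l // sum_ew_le.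
Qed.

Lemma entire_residue e al i N : unit_signs e -> (0 < N)%N ->
  entire_coeffs (residue_coeffs e al i N).
Proof.
move=> e1 N0; apply: (@bounded_entire_coeffs _ 1) => n.
by apply: le_trans (modulus_residue_coeffs _ _ _ e1 N0) _; exact: ramp_le1.
Qed.

Lemma residue_small e al i N r t : unit_signs e -> (0 < N)%N -> 0 <= r ->
  circle_modulus (egf (residue_coeffs e al i N)) r t <= r / N%:R * expR r.
Proof.
move=> e1 N0 r0; apply: csum_le; apply: egf_summable => m.
rewrite modulus_circle_point //; apply: le_trans (sum_ramped_small m N0 r0).
by apply: ler_sum => n _; rewrite ler_wpM2r ?ew_ge0 // modulus_residue_coeffs.
Qed.

(** [m'] is the number of indices below [m] in the class, namely the integer part of
    [(m + al - 1 - i) / al]. *)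
Lemma sum_residue (V : nmodType) (G : nat -> V) al i m : (i < al)%N ->
  exists2 m', (m' * al <= m + (al - 1 - i) < m' * al + al)%N &
    \sum_(n < m) (if (n %% al == i)%N then G (n %/ al)%N else 0) = \sum_(j < m') G j.
Proof.
move=> ial; elim: m => [|m [m' /andP[h1 h2] IH]].
  by exists 0%N; [lia | rewrite !big_ord0].
have dm := divn_eq m al; have lt_m := ltn_pmod m (leq_ltn_trans (leq0n _) ial).
rewrite big_ord_recr /= IH; case: ifP => [/eqP mi|/eqP mi].
  have E : m' = (m %/ al)%N by nia.
  by exists m'.+1; [rewrite mulSn; lia | rewrite big_ord_recr /= -E].
exists m'; last by rewrite addr0.
apply/andP; split; first by lia.
have : (m + (al - 1 - i)).+1 <> (m' * al + al)%N; last by lia.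
move=> E; apply: mi.
have -> : (m = m' * al + i)%N by lia.
by rewrite modnMDl modn_small.
Qed.

(** Along a class modulo [al] the phases form a geometric progression of ratio [cis (al t)]; up to a
    unimodular factor the sum is a prefix of a block of [e]. *)
Lemma residue_prefix e al i k S (t : R) q m : (i < al)%N ->
  (forall q m (x : C), modulus x = 1 -> (m <= 2 ^ k)%N ->
     modulus (\sum_(j < m) (e (q * 2 ^ k + j)%N)%:C%C * x ^+ j) <= S) ->
  (m <= al * 2 ^ k)%N ->
  modulus (\sum_(n < m) (fun n => if (n %% al == i)%N then
     (e (n %/ al)%N)%:C%C * cis (n%:R * t) else 0) (q * (al * 2 ^ k) + n)%N) <= S.
Proof.
move=> ial HS mal; have al0 : (0 < al)%N by exact: leq_ltn_trans ial.
have eqn (n : nat) : (q * (al * 2 ^ k) + n = (q * 2 ^ k) * al + n)%N.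
  by rewrite -mulnA [(2 ^ k * al)%N]mulnC.
pose G j : C := (e (q * 2 ^ k + j)%N)%:C%C *
   (cis ((q * 2 ^ k * al + i)%:R * t) * cis (al%:R * t) ^+ j).
have -> : \sum_(n < m) (fun n => if (n %% al == i)%N then
     (e (n %/ al)%N)%:C%C * cis (n%:R * t) else 0) (q * (al * 2 ^ k) + n)%N =
   \sum_(n < m) (if (n %% al == i)%N then G (n %/ al)%N else 0).
  apply: eq_bigr => n _; rewrite eqn modnMDl; case: ifP => // /eqP ni.
  rewrite divnMDl // /G; congr (_ * _); rewrite cisX -cisD; congr cis.
  rewrite {1}(divn_eq n al) ni !natrD !natrM; ring.
have [m' /andP[h1 h2] ->] := sum_residue G m ial.
have m'k : (m' <= 2 ^ k)%N by nia.
have -> : \sum_(j < m') G j = cis ((q * 2 ^ k * al + i)%:R * t) *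
   \sum_(j < m') (e (q * 2 ^ k + j)%N)%:C%C * cis (al%:R * t) ^+ j.
  by rewrite mulr_sumr; apply: eq_bigr => j _; rewrite /G mulrCA.
by rewrite modulusM modulus_cis mul1r; apply: HS => //; exact: modulus_cis.
Qed.

(** Abel summation over windows of length [al * 2 ^ k]; [24 = 2 * 12] comes from [ramped_variation].
    The parameter [k] stays free: constant signs use [k = 0], Rudin-Shapiro signs a window of order
    [sqrt r]. *)
Lemma residue_sup e al i k S N r t : unit_signs e -> (0 < N)%N -> 0 <= r -> (i < al)%N ->
  (forall q m (x : C), modulus x = 1 -> (m <= 2 ^ k)%N ->
     modulus (\sum_(j < m) (e (q * 2 ^ k + j)%N)%:C%C * x ^+ j) <= S) ->
  Num.sqrt r * circle_modulus (egf (residue_coeffs e al i N)) r t <=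
    S * (Num.sqrt r / (al * 2 ^ k)%:R + 24) * expR r.
Proof.
move=> e1 N0 r0 ial HS; set Lam := (al * 2 ^ k)%N.
have L0 : (0 < Lam)%N by rewrite muln_gt0 expn_gt0 (leq_ltn_trans _ ial).
have S0 : 0 <= S.
  by apply: le_trans (HS 0%N 0%N 1 (modulus1 _) (leq0n _)); exact: modulus_ge0.
have s0 := sqrtr_ge0 r.
pose s n : C := if (n %% al == i)%N then (e (n %/ al)%N)%:C%C * cis (n%:R * t) else 0.
have [K HK] := entire_coeffs_summable (circle_point r t) (entire_residue al i e1 N0).
have part Q : Num.sqrt r * modulus (\sum_(n < Q * Lam)
    residue_coeffs e al i N n * ew (circle_point r t) n) <=
    S * (Num.sqrt r / Lam%:R + 24) * expR r.
  have -> : \sum_(n < Q * Lam) residue_coeffs e al i N n * ew (circle_point r t) n =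
     \sum_(n < Q * Lam) (ramped N r n)%:C%C * s n.
    apply: eq_bigr => n _; rewrite /residue_coeffs /s ew_circle_point.
    case: ifP => _; last by rewrite mul0r mulr0.
    by rewrite /ramped !rmorphM /=; ring.
  have := abel_windows (s := s) (fun n => ramped_ge0 n N0 r0) Q L0
    (fun q m => @residue_prefix e al i k S t q m ial HS).
  move=> /(ler_wpM2l s0) /le_trans; apply.
  have hA := sum_ramped_le (Q * Lam) N0 r0; have hT := ramped_variation (Q * Lam) N0 r0.
  move: hA hT; set A := \sum_(n < _) ramped _ _ _; set TV := \sum_(n < _) `|_| => hA hT.
  have -> : Num.sqrt r * (S * (A / Lam%:R + 2 * TV)) =
    S * (Num.sqrt r / Lam%:R * A + 2 * (Num.sqrt r * TV)) by ring.
  rewrite -[leRHS]mulrA ler_wpM2l // [leRHS]mulrDl; apply: lerD; last by lra.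
  by rewrite ler_wpM2l // divr_ge0.
apply/ler_addgt0Pr => eps eps0.
have d0 : 0 < eps / (1 + Num.sqrt r) by rewrite divr_gt0 // ltr_pwDl.
have [n0 /(_ (n0 * Lam)%N (leq_pmulr _ L0))] := csum_approx HK d0.
rewrite /circle_modulus -/(egf _ _); set F := egf _ _; set P := \sum_(n < _) _ => FP.
have FE : modulus F <= modulus P + eps / (1 + Num.sqrt r).
  rewrite -{1}(subrK P F); apply: le_trans (modulusD _ _) _.
  by rewrite addrC lerD2l.
apply: (le_trans (ler_wpM2l s0 FE)); rewrite mulrDr; apply: lerD; first exact: part.
rewrite mulrCA -[leRHS]mulr1 ler_wpM2l ?(ltW eps0) // ler_pdivrMr ?ltr_pwDl //.
by rewrite mul1r lerDr.
Qed.

End RampedWeights.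

(** * Integral means of exponentials *)

Section ExponentialMeans.
Variable R : realType.
Local Notation C := (Cfield R).
Implicit Types (b c : nat -> C) (r : R) (z x : C).

(** One trigonometric sum within [sqrt X] of [egf b] stands in for Parseval's identity of the
    series; [(u + v)^2 <= 2 u^2 + 2 v^2] gives the constant 4. *)
Lemma rint_egf_sqr_le b r X : entire_coeffs b -> 0 <= r -> 0 < X ->
  (forall n, \sum_(k < n) (modulus (b k) * ew r k) ^+ 2 <= X) ->
  rint 0 (2 * pi) (fun t => circle_modulus (egf b) r t ^+ 2) <= 2 * pi * (4 * X).
Proof.
move=> cb r0 X0 H; have sX : 0 < Num.sqrt X by rewrite sqrtr_gt0.
have [n /(_ n (leqnn n)) Hn] := egf_circle_approx cb r0 sX.
set s := (fun k => _) in Hn; have cT := ccont_trig_sum s n.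
have cf : continuous (circle_modulus (egf b) r).
  exact/continuous_circle_modulus/entire_egf.
have c2 (g : R -> R) : continuous g -> continuous (fun t : R => g t ^+ 2).
  by move=> cg t; apply: cvgM; exact: cg.
have cZ (k : R) (g : R -> R) : continuous g -> continuous (fun t : R => k * g t).
  by move=> cg t; apply: cvgM; [exact: cvg_cst | exact: cg].
have cD (k : R) (g : R -> R) : continuous g -> continuous (fun t : R => g t + k).
  by move=> cg t; apply: cvgD; [exact: cg | exact: cvg_cst].
have cT2 := c2 _ (ccont_modulus cT).
apply: (@le_trans _ _ (rint 0 (2 * pi) (fun t => 2 * modulus (trig_sum s n t) ^+ 2 + 2 * X))).
  apply: ler_rint; [exact: c2 | exact/cD/cZ | move=> t _].
  have h : circle_modulus (egf b) r t <= modulus (trig_sum s n t) + Num.sqrt X.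
    rewrite /circle_modulus -{1}(subrK (trig_sum s n t) (egf b _)).
    by apply: le_trans (modulusD _ _) _; rewrite addrC lerD2l Hn.
  have h0 : 0 <= circle_modulus (egf b) r t by exact: modulus_ge0.
  have m0 := modulus_ge0 (trig_sum s n t).
  have hv : 0 <= modulus (trig_sum s n t) + Num.sqrt X by rewrite addr_ge0 // ltW.
  have h2 : circle_modulus (egf b) r t ^+ 2 <= (modulus (trig_sum s n t) + Num.sqrt X) ^+ 2.
    by rewrite lerXn2r.
  apply: le_trans h2 _; rewrite -{2}(sqr_sqrtr (ltW X0)).
  by have := sqr_ge0 (modulus (trig_sum s n t) - Num.sqrt X); lra.
rewrite rintD; [|exact: cZ|by move=> t; exact: cvg_cst].
rewrite rintZ // parseval rint_cst; last exact/ltW/pi2_gt0.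
have := pi2_gt0 R; move: (2 * pi) => P P0.
have : \sum_(k < n) modulus (s k) ^+ 2 <= X.
  apply: le_trans (H n); apply: ler_sum => k _.
  by rewrite /s modulusM modulus_real (ger0_norm (ew_ge0 _ r0)).
move: (\sum_(k < n) _) => S SX; rewrite subr0; have := ler_wpM2l (ltW P0) SX; lra.
Qed.

Lemma entire_coeffs_geom x : entire_coeffs (fun n => x ^+ n).
Proof.
move=> rho rho0; exists (expR (modulus x * rho)) => n.
apply: le_trans (sum_ew_le n (mulr_ge0 (modulus_ge0 x) rho0)).
by apply: ler_sum => k _; rewrite ewM modulusX.
Qed.

Lemma egf_geom x z : egf (fun n => x ^+ n) z = egf (fun=> 1) (x * z).
Proof. by congr csum; apply/funext => n; rewrite ewM mul1r. Qed.

Lemma derive1n_fixed (h : C -> C) n : derive1 h = h -> derive1n n h = h.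
Proof. by move=> hh; elim: n => [//|n IH]; rewrite derive1nS IH. Qed.

(** The square [h] of [e^(z/2)] satisfies [h' = h] and [h 0 = 1], so all its Taylor coefficients are
    1. No product of series is computed. *)
Lemma exponential_double z : egf (fun=> 1) z = egf (fun=> 1) (z / 2) ^+ 2 :> C.
Proof.
pose g : C -> C := egf (fun n => 2^-1 ^+ n).
have cg := entire_coeffs_geom 2^-1; have eg : entire g by exact: entire_egf.
have g' w : derive1 g w = 2^-1 * g w.
  have [_ ->] := cderivP (egf_deriv w cg).
  have [K HK] := cg (modulus w) (modulus_ge0 w).
  rewrite /g /egf -(csumZ _ (egf_summable HK)); congr csum.
  by apply/funext => n; rewrite exprS mulrA.
pose h : C -> C := g * g.
have eh : entire h by move=> w; apply: derivableM; exact: eg.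
have h' : derive1 h = h.
  apply/funext => w; rewrite derive1E deriveM; [|exact: eg|exact: eg].
  rewrite -!derive1E g' /h /=.
  have -> : (g * g) w = g w * g w by [].
  rewrite /GRing.scale /= mulrA [g w * 2^-1]mulrC -mulrA -mulrDl.
  have -> : 2^-1 + 2^-1 = 1 :> C by rewrite -mulr2n -[_ *+ 2]mulr_natr mulVf ?pnatr_eq0.
  by rewrite mul1r.
have [b cb hb] := entire_egfP eh.
have bE : b = fun=> 1.
  apply/funext => n; have := derive1n_egf n cb; rewrite -hb.
  rewrite (derive1n_fixed n h') => /(congr1 (fun f => f 0)); rewrite egf_at0 addn0 => <-.
  by rewrite -[h 0]/(g 0 * g 0) /g egf_at0 expr0 mulr1.
have -> : egf (fun=> 1) z = h z by rewrite hb bE.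
by rewrite -[h z]/(g z * g z) /g egf_geom expr2 [2^-1 * z]mulrC.
Qed.

Lemma rint_egf_geom x r : x != 0 -> 0 < r ->
  Num.sqrt (modulus x * r) *
    rint 0 (2 * pi) (circle_modulus (egf (fun n => x ^+ n)) r) <=
  2 * pi * (32 * expR (modulus x * r)).
Proof.
move=> x0 r0; have m0 : 0 < modulus x by rewrite lt_neqAle eq_sym modulus_eq0 x0 modulus_ge0.
pose y : R := modulus x * r / 2; have y0 : 0 < y by rewrite divr_gt0 // mulr_gt0.
have E : circle_modulus (egf (fun n => x ^+ n)) r =
  fun t => circle_modulus (egf (fun n => (x / 2) ^+ n)) r t ^+ 2.
  apply/funext => t; rewrite /circle_modulus !egf_geom exponential_double modulusX.
  by rewrite mulrAC.
have sy : 0 < Num.sqrt y by rewrite sqrtr_gt0.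
have yE : y + y = modulus x * r by rewrite /y; lra.
have m2 : modulus (x / 2) = modulus x / 2.
  by rewrite modulusM modulusV modulus_nat.
have := @rint_egf_sqr_le (fun n => (x / 2) ^+ n) r (4 * expR (y + y) / Num.sqrt y)
  (entire_coeffs_geom _) (ltW r0).
rewrite -E => /(_ _ _)/(ler_wpM2l (sqrtr_ge0 (y + y))).
rewrite yE => H.
have s2 : Num.sqrt (modulus x * r) <= 2 * Num.sqrt y.
  have -> : 2 * Num.sqrt y = Num.sqrt (4 * y).
    have -> : 4 = 2 ^+ 2 :> R by ring.
    by rewrite (sqrtrM _ (sqr_ge0 2)) sqrtr_sqr ger0_norm.
  by rewrite ler_sqrt -?yE; lra.
apply: le_trans (H _ _) _.
- by rewrite divr_gt0 ?mulr_gt0 ?expR_gt0.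
(* The sum of the squares is at most the largest weight, [4 e^y / sqrt y], times the sum of the
   weights, [e^y]. *)
- move=> n; rewrite -yE expRD ler_pdivlMr // mulrC mulr_sumr.
  apply: (@le_trans _ _ (\sum_(k < n) 4 * expR y * ew y k)).
    apply: ler_sum => k _; rewrite modulusX m2 -ewM.
    rewrite (_ : modulus x / 2 * r = y); last by rewrite /y mulrAC.
    rewrite expr2 (mulrA (Num.sqrt y)); apply: ler_wpM2r; first exact/ew_ge0/ltW.
    exact/ew_max/ltW.
  rewrite -mulr_sumr mulrA; apply: ler_wpM2l; first by nonneg.
  exact/sum_ew_le/ltW.
set s := Num.sqrt (_ * _); have -> : s * (2 * pi * (4 * (4 * expR (modulus x * r) / Num.sqrt y)))
  = 2 * pi * (16 * expR (modulus x * r)) * (s / Num.sqrt y) by ring.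
have -> : 2 * pi * (32 * expR (modulus x * r)) =
   2 * pi * (16 * expR (modulus x * r)) * 2 :> R by ring.
apply: ler_wpM2l; last by rewrite ler_pdivrMr.
by apply: mulr_ge0; [exact/ltW/pi2_gt0 | nonneg].
Qed.

End ExponentialMeans.

(** * Integral means of residue classes *)

Section ResidueMeans.
Variable R : realType.
Local Notation C := (Cfield R).
Implicit Types (a b c : nat -> C) (r : R) (x : C) (N m n i : nat).

Lemma entire_coeffs_lin a b (k l : C) : entire_coeffs a -> entire_coeffs b ->
  entire_coeffs (fun n => k * a n + l * b n).
Proof.
move=> ca cb rho rho0; have [K HK] := ca _ rho0; have [L HL] := cb _ rho0.
exists (modulus k * K + modulus l * L) => n.
apply: le_trans (lerD (ler_wpM2l (modulus_ge0 k) (HK n)) (ler_wpM2l (modulus_ge0 l) (HL n))).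
rewrite !mulr_sumr -big_split /=; apply: ler_sum => j _.
rewrite (mulrA (modulus k)) (mulrA (modulus l)) -mulrDl; apply: ler_wpM2r; first exact: ew_ge0.
by apply: le_trans (modulusD _ _) _; rewrite !modulusM.
Qed.

Lemma egf_lin a b (k l : C) z : entire_coeffs a -> entire_coeffs b ->
  egf (fun n => k * a n + l * b n) z = k * egf a z + l * egf b z.
Proof.
move=> ca cb; have [K HK] := ca _ (modulus_ge0 z); have [L HL] := cb _ (modulus_ge0 z).
have [sa sb] := (egf_summable HK, egf_summable HL).
rewrite /egf -(csumZ k sa) -(csumZ l sb) -(csumD (abs_summableZ k sa) (abs_summableZ l sb)).
by congr csum; apply/funext => n; rewrite mulrDl (mulrA k) (mulrA l).
Qed.

Definition circle_integral (f : C -> C) r := rint 0 (2 * pi) (circle_modulus f r).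

Lemma circle_integral_lin a b (k l : C) r : entire_coeffs a -> entire_coeffs b ->
  circle_integral (egf (fun n => k * a n + l * b n)) r <=
    modulus k * circle_integral (egf a) r + modulus l * circle_integral (egf b) r.
Proof.
move=> ca cb; have [ea eb] := (entire_egf ca, entire_egf cb).
have eab := entire_egf (entire_coeffs_lin k l ca cb).
have cZ (u : R) (g : R -> R) : continuous g -> continuous (fun t : R => u * g t).
  by move=> cg t; apply: cvgM; [exact: cvg_cst | exact: cg].
have cD (g h : R -> R) : continuous g -> continuous h -> continuous (fun t : R => g t + h t).
  by move=> cg ch t; apply: cvgD; [exact: cg | exact: ch].
have [fa fb] := (continuous_circle_modulus (r := r) ea, continuous_circle_modulus (r := r) eb).
rewrite /circle_integral -(rintZ _ _ _ fa) -(rintZ _ _ _ fb) -rintD; [|exact: cZ|exact: cZ].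
apply: ler_rint; [exact: continuous_circle_modulus | by apply: cD; exact: cZ | move=> t _].
rewrite /circle_modulus egf_lin //; apply: le_trans (modulusD _ _) _.
by rewrite !modulusM.
Qed.

Definition twisted N x n : C := x ^+ n * (ramp R N n)%:C%C.

Lemma entire_twisted N x : (0 < N)%N -> entire_coeffs (twisted N x).
Proof.
move=> N0 rho rho0; have [K HK] := entire_coeffs_geom x rho0; exists K => n.
apply: le_trans (HK n); apply: ler_sum => k _; rewrite ler_wpM2r ?ew_ge0 // modulusM.
by rewrite modulus_real ger0_norm ?ramp_ge0 // ler_piMr ?modulus_ge0 ?ramp_le1.
Qed.

(** The ramp splits the series into those of ratios [x] and [q x] with [q = 1 - 1/N]. As [1 < N]
    gives [q >= 1/2], one has [sqrt r <= 2 sqrt (q r)], and the constants 32 and [2 * 32] add up to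
    96. *)
Lemma twisted_integral N x r : (1 < N)%N -> modulus x = 1 -> 0 < r ->
  Num.sqrt r * circle_integral (egf (twisted N x)) r <= 2 * pi * (96 * expR r).
Proof.
have arith (P I J s s' u u' : R) : s * I <= P * (32 * u) -> s' * J <= P * (32 * u') ->
  s * J <= 2 * s' * J -> P * u' <= P * u -> s * (I + J) <= P * (96 * u) by lra.
move=> N1 x1 r0; have N0 : (0 < N)%N by exact: ltnW.
pose q : R := 1 - N%:R^-1.
have q1 : q <= 1 by have /andP[] := ramp_base R N0.
have q2 : 2^-1 <= q.
  have : N%:R^-1 <= 2^-1 :> R by rewrite lef_pV2 ?posrE ?ltr0n // ler_nat.
  by rewrite /q; lra.
have x0 : x != 0 by rewrite -modulus_eq0 x1 oner_eq0.
have qx : modulus (q%:C%C * x) = q by rewrite modulusM modulus_real x1 mulr1 ger0_norm //; lra.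
have qx0 : q%:C%C * x != 0 by rewrite -modulus_eq0 qx; lra.
have E : twisted N x = fun n => 1 * x ^+ n + (-1) * (q%:C%C * x) ^+ n.
  apply/funext => n; rewrite /twisted /ramp -/q rmorphB rmorph1 rmorphXn /= exprMn.
  ring.
move: q q1 q2 qx qx0 E => q q1 q2 qx qx0 E.
have sq : Num.sqrt r <= 2 * Num.sqrt (q * r).
  have -> : 2 * Num.sqrt (q * r) = Num.sqrt (4 * (q * r)).
    have -> : 4 = 2 ^+ 2 :> R by ring.
    by rewrite (sqrtrM _ (sqr_ge0 2)) sqrtr_sqr ger0_norm.
  have h := ler_wpM2r (ltW r0) q2; rewrite ler_sqrt; lra.
have eq : expR (q * r) <= expR r by rewrite ler_expR ger_pMl //.
have h0 : circle_integral (egf (twisted N x)) r <=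
    circle_integral (egf (fun n => x ^+ n)) r +
    circle_integral (egf (fun n => (q%:C%C * x) ^+ n)) r.
  rewrite E; apply: le_trans (circle_integral_lin 1 (-1) r (entire_coeffs_geom x)
    (entire_coeffs_geom (q%:C%C * x))) _.
  have m1 : modulus (-1 : C) = 1 by rewrite (modulusN 1) modulus1.
  by rewrite m1 (modulus1 R); apply: lerD; rewrite -[leRHS]mul1r; exact: lexx.
apply: (le_trans (ler_wpM2l (sqrtr_ge0 r) h0)).
have h1 := rint_egf_geom x0 r0; have h2 := rint_egf_geom qx0 r0.
rewrite x1 mul1r -/(circle_integral _ _) in h1; rewrite qx -/(circle_integral _ _) in h2.
have I0 : 0 <= circle_integral (egf (fun n => (q%:C%C * x) ^+ n)) r.
  by apply: rint_ge0 => t; exact: modulus_ge0.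
exact: arith h1 h2 (ler_wpM2r I0 sq) (ler_wpM2l (ltW (pi2_gt0 R)) eq).
Qed.

Definition twisted_class N m i x n : C := if (n %% 2 ^ m == i)%N then twisted N x n else 0.

Lemma entire_twisted_class N m i x : (0 < N)%N -> entire_coeffs (twisted_class N m i x).
Proof.
move=> N0 rho rho0; have [K HK] := entire_twisted x N0 rho0; exists K => n.
apply: le_trans (HK n); apply: ler_sum => k _; rewrite ler_wpM2r ?ew_ge0 //.
by rewrite /twisted_class; case: ifP => _ //; rewrite modulus0 modulus_ge0.
Qed.

(** For [w = e^(i pi / 2^m)], on a class modulo [2^m] the factor [w^n] is a constant times the sign
    given by the parity of [n %/ 2^m]. Half the sum or difference of the plain and the normalised
    twisted series therefore selects one of the two classes modulo [2^(m+1)]. *)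
Lemma twisted_class_half N m i x : (i < 2 ^ m.+1)%N -> exists2 w : C * C,
   modulus w.1 = 1 /\ modulus w.2 = 1 &
   twisted_class N m.+1 i x = fun n => 2^-1 * twisted_class N m (i %% 2 ^ m) x n +
     (w.2 / 2) * twisted_class N m (i %% 2 ^ m) (x * w.1) n.
Proof.
move=> im; set al := (2 ^ m)%N; have al0 : (0 < al)%N by rewrite expn_gt0.
set i0 := (i %% al)%N; pose w : C := cis (pi / al%:R).
have wal : w ^+ al = -1.
  rewrite cisX mulrC divfK ?pnatr_eq0 -?lt0n //.
  by apply: complex_ext; rewrite /= ?cospi ?sinpi ?oppr0.
have w1 n : modulus (w ^+ n) = 1 by rewrite modulusX modulus_cis expr1n.
exists (w, (-1) ^+ (i %/ al) * (w ^+ i0)^-1).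
  by rewrite -(expr1 w) w1 modulusM modulusX modulusN modulus1 expr1n modulusV expr1 w1 invr1 mulr1.
apply/funext => n; rewrite /twisted_class /=.
have mE : (n %% 2 ^ m.+1 = odd (n %/ al) * al + n %% al)%N.
  have nE : (n = (n %/ al)./2 * (2 * al) + (odd (n %/ al) * al + n %% al))%N.
    rewrite [LHS](divn_eq n al) -{1}(odd_double_half (n %/ al)) mulnDl -muln2 -mulnA.
    by rewrite [LHS]addnAC addnC addnA addnC.
  rewrite {1}nE expnS modnMDl modn_small //; have := ltn_pmod n al0; case: odd; lia.
have b01 : (i %/ al = 0 \/ i %/ al = 1)%N.
  have : (i %/ al < 2)%N by rewrite ltn_divLR // -expnS.
  by case: (i %/ al)%N => [|[|//]]; [left|right].
have iE : (i = i %/ al * al + i0)%N by exact: divn_eq.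
have wi0 : w ^+ i0 != 0 by rewrite expf_neq0 // cis_neq0.
have half : 2^-1 + 2^-1 = 1 :> C by field.
have twE : (n %% al = i0)%N -> twisted N (x * w) n = (-1) ^+ (n %/ al) * w ^+ i0 * twisted N x n.
  move=> ni; rewrite /twisted exprMn (_ : w ^+ n = (-1) ^+ (n %/ al) * w ^+ i0); first by ring.
  by rewrite {1}(divn_eq n al) exprD mulnC exprM wal ni.
rewrite mE -/al; case: ifP => [/eqP H|H].
  have ni : (n %% al = i0)%N by rewrite /i0 -H modnMDl modn_mod.
  have ob : (-1) ^+ (n %/ al) = (-1) ^+ (i %/ al) :> C.
    rewrite -signr_odd; move: H; rewrite ni {1}iE => /addIn.
    by case: b01 => ->; case: odd => //=; lia.
  rewrite ni eqxx twE // ob; move: (twisted N x n) => u.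
  have -> : (-1) ^+ (i %/ al) * (w ^+ i0)^-1 / 2 * ((-1) ^+ (i %/ al) * w ^+ i0 * u) =
     ((-1) ^+ (i %/ al) * (-1) ^+ (i %/ al)) * 2^-1 * u by field.
  by rewrite -expr2 sqrr_sign mul1r -mulrDl half mul1r.
case: eqP => [ni|_]; last by rewrite !mulr0 addr0.
have ob : (-1) ^+ (n %/ al) = - (-1) ^+ (i %/ al) :> C.
  rewrite -signr_odd; move: H; rewrite ni {1}iE.
  by case: b01 => ->; case: odd; rewrite ?eqxx // => _; rewrite /= ?expr0 ?expr1 ?opprK.
rewrite twE // ob; move: (twisted N x n) => u.
have -> : (-1) ^+ (i %/ al) * (w ^+ i0)^-1 / 2 * (- (-1) ^+ (i %/ al) * w ^+ i0 * u) =
   - (((-1) ^+ (i %/ al) * (-1) ^+ (i %/ al)) * 2^-1 * u) by field.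
by rewrite -expr2 sqrr_sign mul1r subrr.
Qed.

(** Each halving is an average of two series of the previous level with unimodular multipliers, so
    the bound is the same for every [m]. *)
Lemma twisted_class_integral N m i x r : (1 < N)%N -> modulus x = 1 -> 0 < r -> (i < 2 ^ m)%N ->
  Num.sqrt r * circle_integral (egf (twisted_class N m i x)) r <= 2 * pi * (96 * expR r).
Proof.
move=> N1 x1 r0; have N0 := ltnW N1; elim: m i x x1 => [|m IH] i x x1 im.
  have -> : twisted_class N 0 i x = twisted N x; last exact: twisted_integral.
  by apply/funext => n; move: im; rewrite /twisted_class expn0 modn1 ltnS leqn0 => /eqP ->.
have i0m : (i %% 2 ^ m < 2 ^ m)%N by rewrite ltn_pmod // expn_gt0.
have [[w1 w2] /= [w11 w21] ->] := twisted_class_half N x im.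
have xw : modulus (x * w1) = 1 by rewrite modulusM x1 w11 mulr1.
have h2 : modulus (2^-1 : C) = 2^-1 by rewrite modulusV modulus_nat.
have hw : modulus (w2 / 2) = 2^-1 by rewrite modulusM w21 h2 mul1r.
have := circle_integral_lin 2^-1 (w2 / 2) r
  (entire_twisted_class m (i %% 2 ^ m) x N0) (entire_twisted_class m (i %% 2 ^ m) (x * w1) N0).
rewrite h2 hw => /(ler_wpM2l (sqrtr_ge0 r)) /le_trans; apply.
have := IH _ _ x1 i0m; have := IH _ _ xw i0m.
have arith (s I J P : R) : s * J <= P -> s * I <= P -> s * (2^-1 * I + 2^-1 * J) <= P by lra.
exact: arith.
Qed.

End ResidueMeans.

(** * Smallness of the classes at the three growth scales *)

Section ResidueClassBounds.
Variable R : realType.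
Local Notation C := (Cfield R).
Implicit Types (E : set (nat -> R)) (p : \bar R) (T : R -> R) (r eta : R).

(* Lacunary residue classes, ramped slowly enough, are negligible at the scale T. *)
Definition negligible_classes E p T := forall eta a0, 0 < eta ->
  exists m N0, (a0 <= 2 ^ m)%N /\ forall N, (N0 <= N)%N ->
    forall e i r, E e -> (i < 2 ^ m)%N -> 0 < r ->
      Lp_mean p (egf (residue_coeffs e (2 ^ m) i N)) r <= eta * T r.

Lemma powR_le_of_le r a X : 0 < r -> 1 <= X -> r <= X -> 0 <= a <= 1 -> r `^ a <= X.
Proof.
move=> r0 X1 rX /andP[a0 a1]; apply: (@le_trans _ _ (X `^ a)).
  by apply: ge0_ler_powR => //; rewrite nnegrE; lra.
by rewrite -[leRHS]powRr1 ?ler_powR //; lra.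
Qed.

Lemma residue_small_range e al i N r t a X eta : unit_signs e -> (0 < N)%N -> 0 < eta ->
  0 < r -> 1 <= X -> r <= X -> 0 <= a <= 1 -> X * X / eta <= N%:R ->
  circle_modulus (egf (residue_coeffs e al i N)) r t <= eta * (expR r / r `^ a).
Proof.
move=> e1 N0 eta0 r0 X1 rX a01 XN.
apply: (le_trans (residue_small al i t e1 N0 (ltW r0))).
have ra0 : 0 < r `^ a by rewrite powR_gt0.
have raX := powR_le_of_le r0 X1 rX a01.
have N0' : 0 < N%:R :> R by rewrite ltr0n.
have h : r * r `^ a <= X * X by apply: ler_pM => //; exact: ltW.
have : r / N%:R <= eta / r `^ a.
  rewrite ler_pdivrMr // mulrAC ler_pdivlMr //; apply: le_trans h _.
  by move: XN; rewrite ler_pdivrMr // [leRHS]mulrC.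
by move=> /(ler_wpM2r (expR_ge0 r)) /le_trans; apply; rewrite mulrAC mulrA.
Qed.

Lemma unit_prefix e (q m : nat) (x : C) : unit_signs e -> modulus x = 1 -> (m <= 2 ^ 0)%N ->
  modulus (\sum_(j < m) (e (q * 2 ^ 0 + j)%N)%:C%C * x ^+ j) <= 1.
Proof.
move=> e1 x1; case: m => [|[|//]] _; first by rewrite big_ord0 modulus0.
by rewrite big_ord1 modulusM modulusX x1 expr1n modulus_real e1 mulr1.
Qed.

Lemma residue_coeffs_one m i N :
  residue_coeffs (fun=> 1) (2 ^ m) i N = twisted_class N m i 1 :> (nat -> C).
Proof.
apply/funext => n; rewrite /residue_coeffs /twisted_class.
by case: ifP => // _; rewrite /twisted expr1n !mul1r.
Qed.

Lemma one_unit : unit_signs (fun=> 1 : R).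
Proof. by move=> j; exact: normr1. Qed.

Lemma exists_nat_ge (x : R) : exists n : nat, x <= n%:R.
Proof.
exists (Num.bound `|x|).
exact: le_trans (ler_norm _) (ltW (archi_boundP (normr_ge0 _))).
Qed.

Lemma exists_pow2 (a0 : nat) (x : R) : exists m : nat, (a0 <= 2 ^ m)%N /\ x <= (2 ^ m)%:R.
Proof.
have [n xn] := exists_nat_ge x; exists (a0 + n)%N.
have h := ltn_expl (a0 + n) (ltnSn 1); split; first by lia.
by apply: (le_trans xn); rewrite ler_nat; lia.
Qed.

Lemma powR_pred (u p : R) : 0 <= u -> 1 < p -> u `^ p = u `^ (p - 1) * u.
Proof.
move=> u0 p1; have E : p - 1 + 1 = p by rewrite subrK.
rewrite -{3}(powRr1 u0) -powRD ?E //; apply/implyP => /eqP; lra.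
Qed.

Lemma negligible_small_p (p : R) : 1 < p -> p <= 2 ->
  negligible_classes [set (fun=> 1)] p%:E (fun r => expR r / r `^ (1 / (2 * p))).
Proof.
move=> p1 p2 eta a0 eta0; have p0 : 0 < p by lra.
have p10 : 0 < p - 1 by lra.
(* With this [Y], [al >= 25 * Y] gives [96 (25 / al)^(p - 1) <= eta^p]; 96 is the constant of the
   integral bound and 25 that of the uniform bound. *)
pose Y := (96 / eta `^ p) `^ (p - 1)^-1.
have etap : 0 < eta `^ p by rewrite powR_gt0.
have [m [am Ym]] := exists_pow2 a0 (25 * Y); set al := (2 ^ m)%N in am Ym *.
have al0 : 1 <= al%:R :> R by rewrite ler1n expn_gt0.
(* Up to [X] the ramp alone makes a class small. Beyond it [al <= sqrt r], so that
   [1 / al + 24 / sqrt r <= 25 / al] in the uniform bound. *)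
pose X : R := al%:R ^+ 2; have X1 : 1 <= X by rewrite exprn_ege1.
have [N1 HN1] := exists_nat_ge (X * X / eta).
exists m, (maxn 2 N1); split => // N NN0 _ i r -> im r0.
have N2 : (1 < N)%N by apply: leq_trans NN0; exact: leq_maxl.
have N0 : (0 < N)%N by exact: ltnW.
have NX : X * X / eta <= N%:R.
  by apply: (le_trans HN1); rewrite ler_nat; apply: leq_trans NN0; exact: leq_maxr.
have ec := entire_egf (entire_residue al i one_unit N0).
have T0 : 0 < expR r / r `^ (1 / (2 * p)) by rewrite divr_gt0 ?expR_gt0 ?powR_gt0.
have a01 : 0 <= 1 / (2 * p) <= 1 by rewrite divr_ge0 ?ler_pdivrMr ?mul1r //; lra.
have [rX|Xr] := leP r X.
  apply: Lp_mean_le_sup => //; [by rewrite lee_fin ltW | by nonneg |] => t.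
  exact: (residue_small_range _ _ _ one_unit N0 eta0 r0 X1 rX a01 NX).
apply: integral_mean_le_of => //; first by nonneg.
set f := egf _; set M := 25 / al%:R * expR r.
have s0 : 0 < Num.sqrt r by rewrite sqrtr_gt0.
have als : al%:R <= Num.sqrt r.
  by rewrite -[leLHS]ger0_norm // -sqrtr_sqr ler_sqrt ?ltW.
have M0 : 0 <= M by rewrite /M; nonneg.
have fM t : circle_modulus f r t <= M.
  have := residue_sup t one_unit N0 (ltW r0) im
    (fun q n x x1 nk => unit_prefix q one_unit x1 nk).
  rewrite -/f expn0 muln1 mul1r /M => h; rewrite -(ler_pM2l s0); apply: (le_trans h).
  have -> : Num.sqrt r * (25 / al%:R * expR r) =
    (Num.sqrt r / al%:R + 24 * (Num.sqrt r / al%:R)) * expR r by ring.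
  rewrite ler_wpM2r ?expR_ge0 // lerD2l -{1}[24]mulr1 ler_wpM2l // ler_pdivlMr ?mul1r //.
  by rewrite ltr0n expn_gt0.
have cf : continuous (circle_modulus f r) by exact: continuous_circle_modulus.
(* Interpolation between the uniform and the first-power bound: [|f|^p <= M^(p - 1) |f|]. *)
have step : rint 0 (2 * pi) (fun t => circle_modulus f r t `^ p) <=
    M `^ (p - 1) * circle_integral f r.
  rewrite -rintZ //; apply: ler_rint.
  - exact: continuous_circle_modulus_powR.
  - by move=> t; apply: cvgM; [exact: cvg_cst | exact: cf].
  - move=> t _; have h0 : 0 <= circle_modulus f r t by exact: modulus_ge0.
    rewrite powR_pred //.
    by apply: ler_wpM2r => //; apply: ge0_ler_powR; rewrite ?nnegrE //; exact: ltW.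
apply: (le_trans step).
have I0 : circle_integral f r <= 2 * pi * (96 * expR r) / Num.sqrt r.
  rewrite ler_pdivlMr // mulrC /f residue_coeffs_one; apply: twisted_class_integral => //.
  exact: modulus1.
apply: (le_trans (ler_wpM2l (powR_ge0 _ _) I0)).
have e0 := expR_gt0 r.
have -> : (eta * (expR r / r `^ (1 / (2 * p)))) `^ p =
    eta `^ p * (expR r `^ (p - 1) * expR r / Num.sqrt r).
  rewrite powRM ?(ltW eta0) ?(ltW T0) //; congr (_ * _).
  rewrite powRM ?invr_ge0 ?powR_ge0 ?(ltW e0) // powRV ?powR_ge0 // -powRrM.
  have -> : 1 / (2 * p) * p = 2^-1 by field; lra.
  by rewrite powR12_sqrt ?(ltW r0) // powR_pred ?(ltW e0).
have Y0 : 0 < Y by rewrite powR_gt0 // divr_gt0.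
have hM : M `^ (p - 1) * 96 <= eta `^ p * expR r `^ (p - 1).
  have q0 : 0 <= 25 / al%:R :> R by rewrite divr_ge0.
  rewrite /M (powRM _ q0 (ltW e0)) mulrAC; apply: ler_wpM2r; first exact: powR_ge0.
  have : (25 / al%:R) `^ (p - 1) <= (Y^-1) `^ (p - 1).
    apply: ge0_ler_powR; rewrite ?nnegrE ?invr_ge0 ?(ltW p10) ?(ltW Y0) //.
    by rewrite ler_pdivrMr ?(lt_le_trans ltr01) // ler_pdivlMl // mulrC.
  rewrite powRV ?(ltW Y0) // /Y -powRrM mulVf ?gt_eqF // powRr1; last by nonneg.
  by move=> /(ler_wpM2r (ler0n R 96)) /le_trans; apply; rewrite invf_div divfK.
have P0 := ltW (pi2_gt0 R).
have h2 := ler_wpM2l (mulr_ge0 P0 (divr_ge0 (ltW e0) (ltW s0))) hM.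
apply: le_trans (le_trans _ h2) _; rewrite le_eqVlt; apply/orP; left; apply/eqP; clear.
  by move: (2 * pi) (M `^ _) => P u; ring.
by move: (2 * pi) (eta `^ _) (expR r `^ _) => P u v; ring.
Qed.

Lemma negligible_one phi : (forall r, 0 < r -> 1 <= phi r) -> phi r @[r --> +oo] --> +oo ->
  negligible_classes [set (fun=> 1)] 1%:E (fun r => phi r * (expR r / r `^ (1 / 2))).
Proof.
move=> phi1 phioo eta a0 eta0.
(* Any [m] with [2^m >= a0] will do: the bound on the first-power mean does not improve with [m]. *)
have [m [am _]] := exists_pow2 a0 0.
have [R0 HR0] : exists R0, forall r, R0 < r -> 96 / eta <= phi r.
  by move/cvgryPge : phioo => /(_ (96 / eta)) [R0 [_ H]]; exists R0.
pose X := Num.max 1 R0; have X1 : 1 <= X by rewrite le_max lexx.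
have [N1 HN1] := exists_nat_ge (X * X / eta).
exists m, (maxn 2 N1); split => // N NN0 _ i r -> im r0.
have N2 : (1 < N)%N by apply: leq_trans NN0; exact: leq_maxl.
have N0 : (0 < N)%N by exact: ltnW.
have NX : X * X / eta <= N%:R.
  by apply: (le_trans HN1); rewrite ler_nat; apply: leq_trans NN0; exact: leq_maxr.
have ec := entire_egf (entire_residue (2 ^ m) i one_unit N0).
have T0 : 0 < expR r / r `^ (1 / 2) by rewrite divr_gt0 ?expR_gt0 ?powR_gt0.
have a01 : 0 <= (1 / 2 : R) <= 1 by lra.
have ph0 : 0 <= phi r by apply: le_trans (phi1 r r0).
have [rX|Xr] := leP r X.
  apply: Lp_mean_le_sup => //; first by nonneg.
  move=> t; apply: le_trans (residue_small_range _ _ t one_unit N0 eta0 r0 X1 rX a01 NX) _.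
  by rewrite ler_wpM2l ?(ltW eta0) // ler_peMl ?(ltW T0) // phi1.
have cf := continuous_circle_modulus (r := r) ec.
apply: integral_mean_le_of => //; first by nonneg.
rewrite powRr1; last by nonneg.
rewrite (_ : rint _ _ _ =
  circle_integral (egf (residue_coeffs (fun=> 1) (2 ^ m) i N)) r); last first.
  by apply: eq_rint => t _; rewrite powRr1 //; exact: modulus_ge0.
have := @twisted_class_integral R N m i 1 r N2 (modulus1 _) r0 im.
rewrite -residue_coeffs_one mulrC -ler_pdivlMr ?sqrtr_gt0 // => /le_trans; apply.
rewrite -(mulrA (2 * pi)); apply: ler_wpM2l; first exact/ltW/pi2_gt0.
rewrite [in leRHS]mul1r powR12_sqrt ?(ltW r0) // mulrA -(mulrA 96).
apply: ler_wpM2r; first by rewrite divr_ge0 ?expR_ge0 ?sqrtr_ge0.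
rewrite -ler_pdivrMl // mulrC; apply: HR0; apply: le_lt_trans Xr.
by rewrite le_max lexx orbT.
Qed.

Lemma rs_prefix (e : nat -> R) k (q m : nat) (x : C) :
  rs_family e -> modulus x = 1 -> (m <= 2 ^ k)%N ->
  modulus (\sum_(j < m) (e (q * 2 ^ k + j)%N)%:C%C * x ^+ j) <= 4 * Num.sqrt (2 ^+ k).
Proof.
move=> [s [t ->]] x1 mk; apply: le_trans (rs_prefix_le t q x1 mk).
have E j : rs_sign R s t j = (-1) ^+ s * rs_sign R false t j.
  by rewrite /rs_sign addbF signr_addb mulrC.
under eq_bigr => j _ do rewrite E rmorphM /= -mulrA.
rewrite -mulr_sumr modulusM modulus_real normrX normrN normr1 expr1n mul1r.
exact: lexx.
Qed.

Lemma rs_unit (e : nat -> R) : rs_family e -> unit_signs e.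
Proof.
by move=> he j; have [->|->] := rs_family_unit j he; rewrite ?normrN normr1.
Qed.

Lemma dyadic_bracket (s : R) (al : nat) : (0 < al)%N -> al%:R <= s ->
  exists k, (al * 2 ^ k)%:R <= s < (al * 2 ^ k.+1)%:R.
Proof.
move=> al0 als; have [m [_ sm]] := exists_pow2 0 s.
have H : exists k, s < (al * 2 ^ k)%:R.
  exists m.+1; apply: (le_lt_trans sm); rewrite ltr_nat expnS.
  by have : (0 < 2 ^ m)%N by [rewrite expn_gt0]; nia.
have := ex_minnP H; case=> [[|k]] sk Hk.
  by move: sk; rewrite expn0 muln1 ltNge als.
exists k; rewrite sk andbT leNgt; apply/negP => /Hk; lia.
Qed.

Lemma negligible_rs p : (1%:E <= p)%E ->
  negligible_classes (@rs_family R) p (fun r => expR r / r `^ (1 / 4)).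
Proof.
move=> p1 eta a0 eta0.
(* [104 = 4 * 26], where 4 is the constant of the Rudin-Shapiro prefixes and 26 bounds
   [sqrt r / (al 2^k) + 24]. *)
have [m [am Ym]] := exists_pow2 a0 ((104 / eta) ^+ 2); set al := (2 ^ m)%N in am Ym *.
have aln0 : (0 < al)%N by rewrite expn_gt0.
have al0 : 1 <= al%:R :> R by rewrite ler1n.
pose X : R := al%:R ^+ 2; have X1 : 1 <= X by rewrite exprn_ege1.
have [N1 HN1] := exists_nat_ge (X * X / eta).
exists m, (maxn 2 N1); split => // N NN0 e i r he im r0.
have N0 : (0 < N)%N by apply: leq_trans NN0; rewrite leq_max.
have NX : X * X / eta <= N%:R.
  by apply: (le_trans HN1); rewrite ler_nat; apply: leq_trans NN0; exact: leq_maxr.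
have ec := entire_egf (entire_residue al i (rs_unit he) N0).
have T0 : 0 < expR r / r `^ (1 / 4) by rewrite divr_gt0 ?expR_gt0 ?powR_gt0.
have a01 : 0 <= (1 / 4 : R) <= 1 by lra.
apply: Lp_mean_le_sup => //; first by nonneg.
move=> t; have [rX|Xr] := leP r X.
  exact: (residue_small_range _ _ _ (rs_unit he) N0 eta0 r0 X1 rX a01 NX).
have s0 : 0 < Num.sqrt r by rewrite sqrtr_gt0.
have als : al%:R <= Num.sqrt r.
  by rewrite -[leLHS]ger0_norm // -sqrtr_sqr ler_sqrt ?ltW.
(* The window [al 2^k] is within a factor 2 of [sqrt r], which balances the mean term and the
   variation term of [residue_sup]. *)
have [k /andP[k1 k2]] := dyadic_bracket aln0 als.
have := residue_sup t (rs_unit he) N0 (ltW r0) im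
    (fun q n x x1 nk => rs_prefix q he x1 nk).
set cm := circle_modulus _ _ _; rewrite -/al => h.
have sr : Num.sqrt (Num.sqrt r) = r `^ (1 / 4).
  rewrite -!powR12_sqrt ?powR_ge0 ?(ltW r0) // -powRrM; congr (_ `^ _); lra.
have w0 : 0 < Num.sqrt (Num.sqrt r) by rewrite sqrtr_gt0.
set w := Num.sqrt (Num.sqrt r) in sr w0.
have ww : w * w = Num.sqrt r by rewrite -expr2 sqr_sqrtr ?sqrtr_ge0.
have k0 : 0 < Num.sqrt (2 ^+ k : R) by rewrite sqrtr_gt0 exprn_gt0.
have a0' : 0 < Num.sqrt (al%:R : R) by rewrite sqrtr_gt0 ltr0n.
have h1 : Num.sqrt (2 ^+ k) * Num.sqrt al%:R <= w.
  rewrite -sqrtrM ?exprn_ge0 // ler_sqrt ?sqrtr_ge0 // mulrC -natrX -natrM.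
  exact: k1.
have h2 : Num.sqrt r / (al * 2 ^ k)%:R + 24 <= 26.
  have : Num.sqrt r / (al * 2 ^ k)%:R <= 2; last by lra.
  rewrite ler_pdivrMr ?ltr0n ?muln_gt0 ?aln0 ?expn_gt0 // -natrM; apply: ltW.
  by move: k2; rewrite expnS mulnCA.
have h3 : Num.sqrt r * cm <= 104 * Num.sqrt (2 ^+ k) * expR r.
  apply: (le_trans (h k)); apply: ler_wpM2r; first exact: expR_ge0.
  apply: le_trans (ler_wpM2l _ h2) _; first by nonneg.
  by rewrite le_eqVlt; apply/orP; left; apply/eqP; ring.
have h4 : 104 / eta <= Num.sqrt al%:R.
  by rewrite -[leLHS]ger0_norm ?divr_ge0 ?(ltW eta0) // -sqrtr_sqr ler_sqrt.
rewrite -sr mulrA ler_pdivlMr // -(ler_pM2l w0).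
have -> : w * (cm * w) = Num.sqrt r * cm by rewrite -ww mulrCA mulrC.
apply: (le_trans h3); rewrite mulrA; apply: ler_wpM2r; first exact: expR_ge0.
apply: le_trans (ler_wpM2r (ltW eta0) h1); rewrite mulrC -mulrA; apply: ler_wpM2l; first exact: ltW.
by rewrite -ler_pdivrMr.
Qed.

End ResidueClassBounds.

(** * The layered series *)

Section LpMeanSums.
Variable R : realType.
Local Notation C := (Cfield R).
Implicit Types (c : nat -> C) (r : R) (p : \bar R).

Lemma sum_halfS_le k : \sum_(l < k) 2^-1 ^+ l.+1 <= 1 :> R.
Proof.
have -> : \sum_(l < k) 2^-1 ^+ l.+1 = 1 - 2^-1 ^+ k :> R.
  elim: k => [|k IH]; first by rewrite big_ord0 expr0 subrr.
  by rewrite big_ord_recr /= IH exprS; field.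
by rewrite gerBl exprn_ge0.
Qed.

Lemma egf_scale c (k : C) z : entire_coeffs c -> egf (fun n => k * c n) z = k * egf c z.
Proof.
move=> cc; have := egf_lin k 0 z cc cc; rewrite mul0r addr0 => <-.
by congr egf; apply/funext => n; rewrite mul0r addr0.
Qed.

Lemma entire_coeffs_scale c (k : C) : entire_coeffs c -> entire_coeffs (fun n => k * c n).
Proof.
move=> cc; have := entire_coeffs_lin k 0 cc cc; congr entire_coeffs.
by apply/funext => n; rewrite mul0r addr0.
Qed.

Lemma Lp_mean_scale c (k : C) K r p A : entire_coeffs c -> (1%:E <= p)%E -> 0 <= A ->
  modulus k <= K -> Lp_mean p (egf c) r <= A ->
  Lp_mean p (egf (fun n => k * c n)) r <= K * A.
Proof.
move=> cc p1 A0 kK; have K0 : 0 <= K by apply: le_trans kK; exact: modulus_ge0.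
have E t : circle_modulus (egf (fun n => k * c n)) r t = modulus k * circle_modulus (egf c) r t.
  by rewrite /circle_modulus egf_scale // modulusM.
have [ec ekc] := (entire_egf cc, entire_egf (entire_coeffs_scale k cc)).
case: p p1 => [p| |] //= p1 H; last first.
  apply: max_modulus_le => t; rewrite E; apply: ler_pM; rewrite ?modulus_ge0 //.
  by apply: le_trans H; exact: circle_modulus_le_max.
have p0 : 0 < p by move: p1; rewrite lee_fin; apply: lt_le_trans.
apply: integral_mean_le_of => //; first by nonneg.
have cf := continuous_circle_modulus_powR (r := r) ec p0.
have -> : rint 0 (2 * pi) (fun t => circle_modulus (egf (fun n => k * c n)) r t `^ p) =
    modulus k `^ p * rint 0 (2 * pi) (fun t => circle_modulus (egf c) r t `^ p).
  rewrite -rintZ //; apply: eq_rint => t _.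
  by rewrite E powRM //; exact: modulus_ge0.
rewrite powRM // mulrCA; apply: ler_pM; rewrite ?powR_ge0 //.
- by apply: rint_ge0 => t; exact: powR_ge0.
- by apply: ge0_ler_powR; rewrite ?nnegrE ?modulus_ge0 // ltW.
- exact: le_integral_mean.
Qed.

Lemma entire_coeffsD c c' : entire_coeffs c -> entire_coeffs c' ->
  entire_coeffs (fun n => c n + c' n).
Proof.
move=> cc cc'; have := entire_coeffs_lin 1 1 cc cc'; congr entire_coeffs.
by apply/funext => n; rewrite !mul1r.
Qed.

Lemma Lp_mean_egfD c c' r p A A' : entire_coeffs c -> entire_coeffs c' -> (1%:E <= p)%E ->
  0 < A -> 0 < A' -> Lp_mean p (egf c) r <= A -> Lp_mean p (egf c') r <= A' ->
  Lp_mean p (egf (fun n => c n + c' n)) r <= A + A'.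
Proof.
move=> cc cc' p1 A0 A'0 H H'; have := Lp_mean_add (entire_egf cc) (entire_egf cc') p1 A0 A'0 H H'.
congr (Lp_mean p _ r <= _); apply/funext => z.
have := egf_lin 1 1 z cc cc'; rewrite !mul1r => <-; congr egf; apply/funext => n.
by rewrite !mul1r.
Qed.

Lemma Lp_mean_small c r p A : 0 <= r -> (1%:E <= p)%E ->
  (forall n, \sum_(k < n) modulus (c k) * ew r k <= A) -> entire_coeffs c ->
  Lp_mean p (egf c) r <= A.
Proof.
move=> r0 p1 H cc; apply: Lp_mean_le_sup => //; first exact: entire_egf.
  by have := H 0%N; rewrite big_ord0.
by move=> t; apply/csum_le/egf_summable; rewrite modulus_circle_point.
Qed.

(** The slack [d] is there because [Lp_mean_add] needs positive bounds, whereas the empty sum has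
    bound 0. *)
Lemma Lp_mean_sum (c : nat -> nat -> C) (A : nat -> R) k r p d : 0 <= r -> (1%:E <= p)%E ->
  0 < d -> (forall i, (i < k)%N -> [/\ entire_coeffs (c i), 0 < A i &
    Lp_mean p (egf (c i)) r <= A i]) ->
  entire_coeffs (fun n => \sum_(i < k) c i n) /\
  Lp_mean p (egf (fun n => \sum_(i < k) c i n)) r <= \sum_(i < k) A i + d.
Proof.
move=> r0 p1 d0; elim: k => [|k IH] H.
  have E : (fun n => \sum_(i < 0) c i n) = fun=> 0 by apply/funext => n; rewrite big_ord0.
  have e0 : entire_coeffs (fun=> 0 : C).
    by apply: (@bounded_entire_coeffs _ _ 0) => n; rewrite modulus0.
  rewrite E; split=> //; apply: Lp_mean_small => // n.
  by rewrite big1 ?big_ord0 ?add0r ?ltW // => i _; rewrite modulus0 mul0r.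
have [e1 l1] := IH (fun i ik => H i (ltnW ik)); have [ek Ak Hk] := H k (ltnSn k).
have E : (fun n => \sum_(i < k.+1) c i n) = fun n => \sum_(i < k) c i n + c k n.
  by apply/funext => n; rewrite big_ord_recr.
rewrite E big_ord_recr /= addrAC; split; first exact: entire_coeffsD.
apply: Lp_mean_egfD => //; rewrite ltr_wpDl // sumr_ge0 // => i _.
by have [_ /ltW] := H i (ltnW (ltn_ord i)).
Qed.

End LpMeanSums.

(** * Layers, their sum and its growth *)

Section Construction.
Variable R : realType.
Local Notation C := (Cfield R).
Variables (E : set (nat -> R)) (e0 : nat -> R) (P : nat -> nat -> C) (B : nat -> R).
Variables (s m N : nat -> nat).
Hypothesis Eunit : forall e, E e -> unit_signs e.
Hypothesis Esample : forall e (b : bool), E e -> E (fun j => e (j.*2 + b)%N).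
Hypothesis Ee0 : E e0.
Hypothesis B1 : forall l, 1 <= B l.
Hypothesis PB : forall l j i, (j <= l)%N -> modulus (P j i) <= B l.
Hypothesis m_mono : forall l, (m l <= m l.+1)%N.
Hypothesis N0 : forall l, (0 < N l)%N.
Hypothesis NB : forall l, 2 ^+ l.+1 * (2 * B l) <= (N l)%:R.

Let al l := (2 ^ m l)%N.
Let al0 l : (0 < al l)%N. Proof. by rewrite expn_gt0. Qed.

(* The stage l.+1 writes the signed polynomials e0 (q) P_l at the multiples
   q al_l and erases what was there. *)
Fixpoint stage l n : C :=
  if l is l'.+1 then
    if (n %% al l' < s l')%N then (e0 (n %/ al l')%N)%:C%C * P l' (n %% al l')%N
    else stage l' n
  else 0.

(** The difference of stages both writes and erases: without the ramps, layers 0 to [k] would add up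
    exactly to [stage k.+1]. *)
Definition layer l n : C := (ramp R (N l) n)%:C%C * (stage l.+1 n - stage l n).

Definition limit_coeffs n : C := csum (fun l => layer l n).

Let B0 l : 0 <= B l. Proof. exact: le_trans (B1 l). Qed.

Lemma stage_le l n K : 0 <= K -> (forall j i, (j < l)%N -> modulus (P j i) <= K) ->
  modulus (stage l n) <= K.
Proof.
move=> K0; elim: l => [|l IH] H /=; first by rewrite modulus0.
case: ifP => _; last by apply: IH => j i jl; apply: H; exact: ltnW.
by rewrite modulusM modulus_real (Eunit Ee0) mul1r; exact: H.
Qed.

Lemma stageS_le l n : modulus (stage l.+1 n) <= B l.
Proof. by apply: stage_le => [|j i jl]; [exact: B0 | exact: PB]. Qed.

Lemma stage_diff_le l n : modulus (stage l.+1 n - stage l n) <= 2 * B l.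
Proof.
apply: le_trans (modulusB _ _) _; rewrite mulr2n mulrDl mul1r; apply: lerD; first exact: stageS_le.
by apply: stage_le => [|j i jl]; [exact: B0 | exact/PB/ltnW].
Qed.

Lemma stage_diff0 l n : (s l <= n %% al l)%N -> stage l.+1 n - stage l n = 0.
Proof. by move=> h /=; rewrite ltnNge h subrr. Qed.

Lemma layer_le_ramp l n : modulus (layer l n) <= ramp R (N l) n * (2 * B l).
Proof.
rewrite modulusM modulus_real ger0_norm ?ramp_ge0 //; apply: ler_wpM2l; rewrite ?ramp_ge0 //.
exact: stage_diff_le.
Qed.

(** A given index may be rewritten by infinitely many layers. Their sum converges because the ramp
    is at most [n / N l], with [N l] large against [2^(l+1)] times the size of the layer. *)
Lemma layer_le l n : modulus (layer l n) <= n%:R * 2^-1 ^+ l.+1.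
Proof.
apply: le_trans (layer_le_ramp l n) _.
apply: (@le_trans _ _ (n%:R / (N l)%:R * (2 * B l))).
  by apply: ler_wpM2r; [rewrite mulr_ge0 | exact: ramp_le].
rewrite -!mulrA; apply: ler_wpM2l => //; rewrite mulrC ler_pdivrMr ?ltr0n //.
by rewrite exprVn ler_pdivlMl ?exprn_gt0.
Qed.

Lemma layer_summable n : abs_summable (fun l => layer l n) n%:R.
Proof.
move=> k; apply: (@le_trans _ _ (\sum_(l < k) n%:R * 2^-1 ^+ l.+1)).
  by apply: ler_sum => l _; exact: layer_le.
by rewrite -mulr_sumr ler_piMr // sum_halfS_le.
Qed.

Lemma limit_coeffs_tail n L :
  modulus (limit_coeffs n - \sum_(l < L) layer l n) <= n%:R * 2^-1 ^+ L.
Proof.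
apply: (csum_tail (layer_summable n)) => k.
apply: (@le_trans _ _ (\sum_(l < k) n%:R * 2^-1 ^+ L * 2^-1 ^+ l.+1)).
  apply: ler_sum => l _; apply: le_trans (layer_le _ _) _.
  by rewrite -mulrA -exprD addnS.
by rewrite -mulr_sumr ler_piMr ?mulr_ge0 ?exprn_ge0 // sum_halfS_le.
Qed.

Lemma linear_entire_coeffs (c : nat -> C) (K : R) : 0 <= K ->
  (forall n, modulus (c n) <= n%:R * K) -> entire_coeffs c /\
  forall rho, 0 <= rho -> forall n, \sum_(k < n) modulus (c k) * ew rho k <= K * (rho * expR rho).
Proof.
move=> K0 H; have h rho : 0 <= rho -> forall n,
    \sum_(k < n) modulus (c k) * ew rho k <= K * (rho * expR rho).
  move=> rho0 n; apply: (@le_trans _ _ (\sum_(k < n) K * (k%:R * ew rho k))).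
    by apply: ler_sum => k _; rewrite (mulrA K) (mulrC K); apply: ler_wpM2r; [exact: ew_ge0 | exact: H].
  by rewrite -mulr_sumr ler_wpM2l // sum_nat_ew_le.
by split => // rho rho0; exists (K * (rho * expR rho)); exact: h.
Qed.

Lemma entire_limit_coeffs : entire_coeffs limit_coeffs.
Proof.
have [] // := @linear_entire_coeffs limit_coeffs 1 ler01 => n.
have := limit_coeffs_tail n 0; rewrite big_ord0 subr0 expr0; exact.
Qed.

Lemma entire_layer l : entire_coeffs (layer l).
Proof.
apply: (@bounded_entire_coeffs _ _ (2 * B l)) => n; apply: le_trans (layer_le_ramp l n) _.
by rewrite ler_piMl ?ramp_le1 // mulr_ge0.
Qed.

Lemma sample_pow d b e : (b < 2 ^ d)%N -> E e -> E (fun j => e (j * 2 ^ d + b)%N).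
Proof.
elim: d b e => [|d IH] b e.
  rewrite expn0 ltnS leqn0 => /eqP ->; congr E; apply/funext => j.
  by rewrite muln1 addn0.
move=> bd Ee; have h : (b./2 < 2 ^ d)%N by move: bd; rewrite expnS; lia.
have := IH _ _ h (Esample (odd b) Ee); congr E; apply/funext => j; congr e.
by rewrite expnS -{2}(odd_double_half b); lia.
Qed.

(** Every earlier period [al k] divides [2^M], so the remainder modulo [al k] depends on [i] alone
    and the quotient is [j 2^(M - m k)] plus a constant. The last stage that wrote there thus leaves
    a fixed coefficient times dyadic samples of [e0]. *)
Lemma stage_sample l M i : (forall l', (l' < l)%N -> (m l' <= M)%N) -> (i < 2 ^ M)%N ->
  exists2 e, E e & exists2 kappa : C, modulus kappa <= B l &
    forall j, stage l (j * 2 ^ M + i)%N = (e j)%:C%C * kappa.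
Proof.
move=> + iM; suff H k : (k <= l)%N -> (forall l', (l' < k)%N -> (m l' <= M)%N) ->
  exists2 e, E e & exists2 kappa : C, modulus kappa <= B l &
    forall j, stage k (j * 2 ^ M + i)%N = (e j)%:C%C * kappa by exact: H.
elim: k => [|k IH] kl H.
  by exists e0 => //; exists 0 => [|j]; rewrite ?modulus0 ?mulr0.
have mk := H k (ltnSn k); have MD : (2 ^ M = 2 ^ (M - m k) * al k)%N by rewrite -expnD subnK.
have modE j : ((j * 2 ^ M + i) %% al k = i %% al k)%N by rewrite MD mulnA modnMDl.
have divE j : ((j * 2 ^ M + i) %/ al k = j * 2 ^ (M - m k) + i %/ al k)%N.
  by rewrite MD mulnA divnMDl.
have [si|si] := boolP (i %% al k < s k)%N.
  exists (fun j => e0 (j * 2 ^ (M - m k) + i %/ al k)%N).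
    by apply: sample_pow => //; rewrite ltn_divLR // -MD.
  exists (P k (i %% al k)%N) => [|j]; first exact/PB/ltnW.
  by rewrite /= modE si divE.
have [e Ee [kappa kB Hk]] := IH (ltnW kl) (fun l' h => H l' (ltnW h)).
by exists e => //; exists kappa => // j; rewrite /= modE (negPf si) Hk.
Qed.

Variables (p : \bar R) (T : R -> R) (c : R) (eta : nat -> R).
Hypothesis p1 : (1%:E <= p)%E.
Hypothesis T0 : forall r, 0 < r -> 0 < T r.
Hypothesis c0 : 0 < c.
Hypothesis eta0 : forall l, 0 < eta l.
Hypothesis eta_le : forall l, (s l).+1%:R * (2 * B l * eta l) <= c * 2^-1 ^+ l.+1.
Hypothesis s_al : forall l, (s l <= al l)%N.
Hypothesis negligible : forall l e i r, E e -> (i < al l)%N -> 0 < r ->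
  Lp_mean p (egf (residue_coeffs e (al l) i (N l))) r <= eta l * T r.

Let m_le l l' : (l' <= l)%N -> (m l' <= m l)%N.
Proof. by move=> ll; apply: (homo_leq (r := leq)) ll => //; exact: leq_trans. Qed.

(** Only [s l] residue classes change, and on each of them the layer is what is written minus what
    is erased, two classes of mean at most [B l * eta l * T r]. The [+ 1] in [eta_le] pays for the
    slack of [Lp_mean_sum]. *)
Lemma layer_mean l r : 0 < r -> Lp_mean p (egf (layer l)) r <= c * 2^-1 ^+ l.+1 * T r.
Proof.
move=> r0; have Tr := T0 r0.
have H i : exists ek : (nat -> R) * C, (i < s l)%N -> [/\ E ek.1, modulus ek.2 <= B l &
    forall j, stage l (j * al l + i)%N = (ek.1 j)%:C%C * ek.2].
  have [il|] := boolP (i < s l)%N; last by exists (e0, 0).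
  have [e Ee [k kB Hk]] := @stage_sample l (m l) i (fun l' h => m_le (ltnW h))
    (leq_trans il (s_al l)).
  by exists (e, k).
have [ek Hek] := choice H; pose a := (al l).
pose g i n : C := P l i * residue_coeffs e0 a i (N l) n +
  (- (ek i).2) * residue_coeffs (ek i).1 a i (N l) n.
have gE : layer l = fun n => \sum_(i < s l) g i n.
  apply/funext => n; have nE := divn_eq n a; set i := (n %% a)%N in nE.
  have g0 k : k != i -> g k n = 0.
    by move=> ki; rewrite /g /residue_coeffs eq_sym (negPf ki) !mulr0 addr0.
  have [il|il] := ltnP i (s l); last first.
    rewrite /layer stage_diff0 // mulr0 big1 // => k _; apply: g0.
    by rewrite neq_ltn (leq_trans (ltn_ord k)).
  rewrite (bigD1 (Ordinal il)) //= big1 ?addr0 => [|k ki]; last exact: g0.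
  have [_ _ /(_ (n %/ a)%N)] := Hek i il; rewrite -nE => Hs.
  rewrite /layer Hs /= -/a il /g /residue_coeffs eqxx !rmorphM /=; ring.
have A0 : 0 < B l * eta l * T r by rewrite !mulr_gt0 // (lt_le_trans ltr01).
have aN e i := @entire_residue R e a i (N l).
have Hg i : (i < s l)%N -> [/\ entire_coeffs (g i), 0 < B l * eta l * T r + B l * eta l * T r &
    Lp_mean p (egf (g i)) r <= B l * eta l * T r + B l * eta l * T r].
  move=> il; have [Ee kB _] := Hek i il; have ia : (i < al l)%N by exact: leq_trans (s_al l).
  have ea := aN e0 i (Eunit Ee0) (N0 l); have eb := aN (ek i).1 i (Eunit Ee) (N0 l).
  split; [exact: entire_coeffs_lin | exact: addr_gt0 |].
  apply: Lp_mean_egfD => //; try exact: entire_coeffs_scale.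
    rewrite -mulrA; apply: Lp_mean_scale => //; [|exact: PB|exact: negligible].
    by rewrite mulr_ge0 ?(ltW Tr) ?(ltW (eta0 _)).
  rewrite -mulrA; apply: Lp_mean_scale => //; [|by rewrite modulusN|exact: negligible].
  by rewrite mulr_ge0 ?(ltW Tr) ?(ltW (eta0 _)).
have [_] := Lp_mean_sum (ltW r0) p1 (addr_gt0 A0 A0) Hg.
rewrite -gE => /le_trans; apply; rewrite sumr_const card_ord.
have := ler_wpM2r (ltW Tr) (eta_le l); rewrite -natr1 -mulr_natl.
move: (c * _) => y; lra.
Qed.

Lemma limit_mean r : 0 < r -> Lp_mean p (egf limit_coeffs) r <= c * T r.
Proof.
move=> r0; have Tr := T0 r0; apply/ler_addgt0Pr => eps eps0.
have X0 : 0 < r * expR r + 1 by rewrite ltr_wpDl // mulr_ge0 ?expR_ge0 ?(ltW r0).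
(* At fixed [r] the layers from [L] on are bounded uniformly on the circle, so that only finitely
   many means are added. *)
have [L HL] : exists L : nat, 2^-1 ^+ L * (r * expR r + 1) <= eps / 2.
  have [L HL] := exists_nat_ge ((r * expR r + 1) / (eps / 2)); exists L.
  rewrite exprVn [leLHS]mulrC ler_pdivrMr ?exprn_gt0 // [leRHS]mulrC -ler_pdivrMr ?divr_gt0 //.
  by apply: (le_trans HL); rewrite -natrX ler_nat; exact/ltnW/ltn_expl.
have e20 : 0 < eps / 2 by rewrite divr_gt0.
have Hl l : (l < L)%N -> [/\ entire_coeffs (layer l), 0 < c * 2^-1 ^+ l.+1 * T r &
    Lp_mean p (egf (layer l)) r <= c * 2^-1 ^+ l.+1 * T r].
  by move=> _; split; [exact: entire_layer | rewrite !mulr_gt0 ?exprn_gt0 | exact: layer_mean].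
have [eL HLs] := Lp_mean_sum (ltW r0) p1 e20 Hl.
pose rest n := limit_coeffs n - \sum_(l < L) layer l n.
have h20 : 0 <= 2^-1 ^+ L :> R by rewrite exprn_ge0.
have [er Hr] := @linear_entire_coeffs rest (2^-1 ^+ L) h20 (fun n => limit_coeffs_tail n L).
have Hrest : Lp_mean p (egf rest) r <= 2^-1 ^+ L * (r * expR r + 1).
  apply: Lp_mean_small => //; first exact: ltW.
  move=> n; apply: le_trans (Hr _ (ltW r0) n) _; rewrite ler_wpM2l ?exprn_ge0 //.
  by rewrite lerDl.
have rE : limit_coeffs = fun n => \sum_(l < L) layer l n + rest n.
  by apply/funext => n; rewrite /rest addrC subrK.
have S0 : 0 <= \sum_(l < L) c * 2^-1 ^+ l.+1 * T r.
  by apply: sumr_ge0 => l _; rewrite !mulr_ge0 ?exprn_ge0 ?(ltW c0) ?(ltW Tr).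
have h0 : 0 < 2^-1 ^+ L * (r * expR r + 1) by rewrite mulr_gt0 ?exprn_gt0.
have S1 : \sum_(l < L) c * 2^-1 ^+ l.+1 * T r <= c * T r.
  rewrite -mulr_suml -mulr_sumr mulrAC ler_piMr ?sum_halfS_le //.
  by rewrite mulr_ge0 ?(ltW c0) ?(ltW Tr).
rewrite {1}rE; apply: le_trans (Lp_mean_egfD eL er p1 _ h0 HLs Hrest) _; first by rewrite ltr_wpDl.
move: S1 HL; move: (\sum_(l < L) _) (c * T r) (2^-1 ^+ L * _) => u v w; lra.
Qed.

End Construction.

(** * Derivatives close to the prescribed polynomials *)

Section Approximation.
Variable R : realType.
Local Notation C := (Cfield R).
Variables (E : set (nat -> R)) (e0 : nat -> R) (P : nat -> nat -> C) (B : nat -> R).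
Variables (s m N : nat -> nat).
Hypothesis Eunit : forall e, E e -> unit_signs e.
Hypothesis Ee0 : E e0.
Hypothesis B1 : forall l, 1 <= B l.
Hypothesis PB : forall l j i, (j <= l)%N -> modulus (P j i) <= B l.
Hypothesis Ps : forall l i, (s l <= i)%N -> P l i = 0.
Hypothesis N0 : forall l, (0 < N l)%N.
Hypothesis NB : forall l, 2 ^+ l.+1 * (2 * B l) <= (N l)%:R.
Hypothesis s_al : forall l, (s l <= 2 ^ m l)%N.
Hypothesis Bs : forall l M, \sum_(i < M) (s l <= i)%N%:R * (2 * B l * ew l%:R i) <= 2^-1 ^+ l.

Let al l := (2 ^ m l)%N.
Let al0 l : (0 < al l)%N. Proof. by rewrite expn_gt0. Qed.
Let B0 l : 0 <= B l. Proof. exact: le_trans (B1 l). Qed.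

(* Before this time the ramp keeps layer l negligible. *)
Let onset l := (al l + l)%N.

Hypothesis N_onset : forall l,
  2 ^+ l * (2 * B l * ((onset l + l)%:R * expR l%:R)) <= (N l)%:R.

Let f := limit_coeffs e0 P s m N.

(** What the layers up to [k] still miss at time [n] because their ramps are below 1, measured on
    the disc of radius [k]. *)
Definition ramp_defect k n : R :=
  \sum_(l < k.+1) (1 - (N l)%:R^-1) ^+ n * (2 * B l) * expR k%:R.

(** Past the onset, [n] keeps distance [s l] from both ends of its block modulo [al l]: none of the
    [s l] indices from [n] on is rewritten by layer [l], not even at the start of the next block. *)
Definition undisturbed l n := ((n < onset l) || (s l <= n %% al l <= al l - s l))%N.

(** Before the onset the ramp is at most [(n + i) / N l] and [N_onset] concludes. Afterwards the
    layer vanishes at [n + i] for [i < s l], and beyond that the weights are negligible by the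
    choice of [s l]. *)
Lemma layer_undisturbed k l n M : (k < l)%N -> undisturbed l n ->
  \sum_(i < M) modulus (layer e0 P s m N l (n + i)) * ew k%:R i <= 2^-1 ^+ l.
Proof.
move=> kl; have kl' : k%:R <= l%:R :> R by rewrite ler_nat ltnW.
have k0 : 0 <= k%:R :> R by [].
case/orP => [nl|/andP[h1 h2]].
  apply: (@le_trans _ _
      (\sum_(i < M) (2 * B l / (N l)%:R) * (n%:R * ew k%:R i + i%:R * ew k%:R i))).
    apply: ler_sum => i _; rewrite -(mulrDl n%:R) (mulrA (2 * B l / _)).
    apply: ler_wpM2r; first exact: ew_ge0.
    apply: le_trans (layer_le_ramp s m Eunit Ee0 B1 PB N0 l _) _.
    rewrite [leLHS]mulrC -(mulrA (2 * B l)); apply: ler_wpM2l; first by rewrite mulr_ge0.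
    by rewrite [leRHS]mulrC -natrD; exact: ramp_le.
  rewrite -mulr_sumr big_split /= -mulr_sumr.
  have h : n%:R * (\sum_(i < M) ew k%:R i) + \sum_(i < M) i%:R * ew k%:R i <=
      (onset l + l)%:R * expR l%:R :> R.
    rewrite natrD mulrDl; apply: lerD.
      apply: ler_pM => //; first by apply: sumr_ge0 => i _; exact: ew_ge0.
        by rewrite ler_nat ltnW.
      by apply: le_trans (sum_ew_le _ k0) _; rewrite ler_expR.
    apply: le_trans (sum_nat_ew_le _ k0) _.
    by apply: ler_pM => //; rewrite ?expR_ge0 // ler_expR.
  apply: le_trans (ler_wpM2l _ h) _; first by rewrite divr_ge0 ?mulr_ge0.
  rewrite mulrAC ler_pdivrMr ?ltr0n // exprVn ler_pdivlMl ?exprn_gt0 //.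
apply: le_trans (Bs l M); apply: ler_sum => i _.
have [si|si] := leqP (s l) i.
  rewrite mul1r; apply: ler_pM; rewrite ?modulus_ge0 ?ew_ge0 //; last exact: ler_ew.
  apply: le_trans (layer_le_ramp s m Eunit Ee0 B1 PB N0 l _) _.
  by rewrite ler_piMl ?ramp_le1 // mulr_ge0.
rewrite mul0r /layer stage_diff0 ?mulr0 ?modulus0 ?mul0r // -/al.
have nE : ((n + i) %% al l = n %% al l + i)%N.
  rewrite {1}(divn_eq n (al l)) -addnA modnMDl modn_small //; lia.
by rewrite -/(al l) nE; lia.
Qed.

Lemma stage_at_multiple k q M : e0 q = 1 ->
  \sum_(i < M) modulus (stage e0 P s m k.+1 (q * al k + i) - P k i) * ew k%:R i <= 2^-1 ^+ k.
Proof.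
move=> eq1; apply: le_trans (Bs k M); apply: ler_sum => i _.
have [si|si] := leqP (s k) i.
  rewrite mul1r Ps // subr0; apply: ler_wpM2r; first exact: ew_ge0.
  by apply: le_trans (stageS_le s m Eunit Ee0 B1 PB k _) _; rewrite ler_peMl ?ler1n.
have ia : (i < al k)%N by exact: leq_trans (s_al k).
rewrite /= -/(al k) modnMDl (modn_small ia) si divnMDl // divn_small // addn0 eq1.
by rewrite mul1r subrr modulus0 !mul0r.
Qed.

Lemma limit_coeffs_near k q n M : n = (q * al k)%N -> e0 q = 1 ->
  ramp_defect k n <= 2^-1 ^+ k -> (forall l, (k < l)%N -> undisturbed l n) ->
  \sum_(i < M) modulus (f (n + i)%N - P k i) * ew k%:R i <= 3 * 2^-1 ^+ k.
Proof.
move=> nE eq1 Hd Hu; apply/ler_addgt0Pr => eps eps0.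
have k0 : 0 <= k%:R :> R by [].
pose X : R := (n + M)%:R * expR k%:R + 1.
have X0 : 0 < X by rewrite ltr_wpDl // mulr_ge0 ?expR_ge0.
have [L HL] : exists L : nat, 2^-1 ^+ L * X <= eps.
  have [L HL] := exists_nat_ge (X / eps); exists L.
  rewrite exprVn [leLHS]mulrC ler_pdivrMr ?exprn_gt0 // [leRHS]mulrC -ler_pdivrMr //.
  by apply: (le_trans HL); rewrite -natrX ler_nat; exact/ltnW/ltn_expl.
pose lay l i := layer e0 P s m N l (n + i)%N.
pose dif l i := stage e0 P s m l.+1 (n + i)%N - stage e0 P s m l (n + i)%N.
(* Four errors: [t1] the tail of the series of layers, [t2] the deficit of the ramps up to layer
   [k], [t3] the stage against [P k], [t4] the next [L] layers. The first is arbitrarily small and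
   each of the others costs [2^-k]. *)
pose t1 i := f (n + i)%N - \sum_(l < k.+1 + L) lay l i.
pose t2 i := \sum_(l < k.+1) ((1 - (N l)%:R^-1) ^+ (n + i))%:C%C * dif l i.
pose t3 i := stage e0 P s m k.+1 (n + i)%N - P k i.
pose t4 i := \sum_(l < L) lay (k.+1 + l)%N i.
have tele i : \sum_(l < k.+1) dif l i = stage e0 P s m k.+1 (n + i)%N.
  rewrite -(big_mkord xpredT (fun l => dif l i)).
  by rewrite (telescope_sumr (fun l => stage e0 P s m l (n + i)%N)) // subr0.
have tE i : f (n + i)%N - P k i = t1 i - t2 i + (t3 i + t4 i).
  have E12 : \sum_(l < k.+1) lay l i = \sum_(l < k.+1) dif l i - t2 i.
    rewrite -sumrB; apply: eq_bigr => l _.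
    rewrite /lay /layer /ramp rmorphB rmorph1 mulrBl mul1r; congr (_ - _).
  rewrite /t1 big_split_ord /= -/(t4 i) E12 tele /t3.
  move: (stage _ _ _ _ _ _) (t2 i) (t4 i) (f _) (P k i) => a b c d e; ring.
have w0 i : 0 <= ew (k%:R : R) i by exact: ew_ge0.
have h1 : \sum_(i < M) modulus (t1 i) * ew k%:R i <= eps.
  apply: le_trans HL; apply: (@le_trans _ _ (\sum_(i < M) (n + M)%:R * 2^-1 ^+ L * ew k%:R i)).
    apply: ler_sum => i _; apply: ler_wpM2r => //.
    apply: le_trans (limit_coeffs_tail s m Eunit Ee0 B1 PB N0 NB _ _) _.
    apply: ler_pM; rewrite ?exprn_ge0 // ?ler_nat; first by rewrite leq_add2l ltnW.
    by rewrite exprD ler_piMl ?exprn_ge0 // exprn_ile1 // invf_le1 // ler1n.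
  rewrite -mulr_sumr [(n + M)%:R * _]mulrC -mulrA; apply: ler_wpM2l; first exact: exprn_ge0.
  by rewrite /X ler_wpDr // ler_wpM2l // sum_ew_le.
have h2 : \sum_(i < M) modulus (t2 i) * ew k%:R i <= 2^-1 ^+ k.
  apply: le_trans Hd; rewrite /ramp_defect -mulr_suml.
  apply: le_trans (ler_wpM2l _ (sum_ew_le M k0)); last first.
    by apply: sumr_ge0 => l _; have /andP[h _] := ramp_base R (N0 l); rewrite !mulr_ge0 ?exprn_ge0.
  rewrite mulr_sumr; apply: ler_sum => i _; apply: ler_wpM2r => //.
  apply: le_trans (modulus_sum _ _ _) _; apply: ler_sum => l _.
  have /andP[q0 q1] := ramp_base R (N0 l).
  rewrite modulusM modulus_real ger0_norm ?exprn_ge0 //; apply: ler_pM; rewrite ?exprn_ge0 ?modulus_ge0 //.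
    by rewrite exprD ler_piMr ?exprn_ge0 // exprn_ile1.
  exact: (stage_diff_le s m Eunit Ee0 B1 PB).
have h3 : \sum_(i < M) modulus (t3 i) * ew k%:R i <= 2^-1 ^+ k.
  by rewrite /t3 nE; exact: stage_at_multiple.
have h4 : \sum_(i < M) modulus (t4 i) * ew k%:R i <= 2^-1 ^+ k.
  apply: (@le_trans _ _ (\sum_(i < M) \sum_(l < L) modulus (lay (k.+1 + l)%N i) * ew k%:R i)).
    by apply: ler_sum => i _; rewrite -mulr_suml; apply: ler_wpM2r => //; exact: modulus_sum.
  rewrite exchange_big /=; apply: (@le_trans _ _ (\sum_(l < L) 2^-1 ^+ k * 2^-1 ^+ l.+1)).
    apply: ler_sum => l _; rewrite -exprD addnS -addSn.
    have kl : (k < k.+1 + l)%N by rewrite addSn ltnS leq_addr.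
    exact: layer_undisturbed kl (Hu _ kl).
  by rewrite -mulr_sumr ler_piMr ?exprn_ge0 // sum_halfS_le.
apply: (@le_trans _ _ (\sum_(i < M) (modulus (t1 i) * ew k%:R i + modulus (t2 i) * ew k%:R i +
   (modulus (t3 i) * ew k%:R i + modulus (t4 i) * ew k%:R i)))).
  apply: ler_sum => i _; rewrite -!mulrDl; apply: ler_wpM2r => //; rewrite tE.
  apply: le_trans (modulusD _ _) _; apply: lerD; [exact: modulusB | exact: modulusD].
rewrite !big_split /=; move: h1 h2 h3 h4.
move: (\sum_(i < M) _) (\sum_(i < M) _) (\sum_(i < M) _) (\sum_(i < M) _) => a b c d.
move: (2^-1 ^+ k) => y; lra.
Qed.

Lemma derivatives_near k q n z : n = (q * al k)%N -> e0 q = 1 ->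
  ramp_defect k n <= 2^-1 ^+ k -> (forall l, (k < l)%N -> undisturbed l n) ->
  modulus z <= k%:R -> modulus (derive1n n (egf f) z - egf (P k) z) <= 3 * 2^-1 ^+ k.
Proof.
move=> nE eq1 Hd Hu zk.
have cf : entire_coeffs f by exact: (entire_limit_coeffs s m Eunit Ee0 B1 PB N0 NB).
have cP : entire_coeffs (P k) by apply: (@bounded_entire_coeffs _ _ (B k)) => i; exact: PB.
rewrite derive1n_egf //; have cfn := entire_coeffs_shiftn n cf.
have := egf_lin 1 (-1) z cfn cP; rewrite !mul1r mulN1r => <-.
apply/csum_le/egf_summable => M; apply: le_trans (limit_coeffs_near M nE eq1 Hd Hu).
apply: ler_sum => i _; rewrite mul1r mulN1r; apply: ler_wpM2l; first exact: modulus_ge0.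
by apply: ler_ew => //; exact: modulus_ge0.
Qed.

End Approximation.

(** * Density of the visits *)

Section Counting.
Variables (al s : nat -> nat) (sgn : pred nat).
Hypothesis al0 : forall l, (0 < al l)%N.
Hypothesis s_al : forall l, (s l <= al l)%N.
Hypothesis al_mono : forall l, (al l <= al l.+1)%N.
Hypothesis gap : forall l, (s l.+1 * 2 ^ (l + 7) * al l <= al l.+1)%N.
Hypothesis sgn_dense : forall j, exists2 i, (i < 4)%N & sgn (4 * j + i)%N.

Let clear l n := ((n < al l + l) || (s l <= n %% al l <= al l - s l))%N.


Lemma sum_below_le_nat n a : (\sum_(i < n) (i < a) <= minn n a)%N.
Proof.
elim: n => [|n IH]; first by rewrite big_ord0.
rewrite big_ord_recr /=; move: IH; move: (\sum_(i < n) _)%N => S; have [] := ltnP n a; lia.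
Qed.

Lemma sum_above_le_nat n a : (a <= n)%N -> (\sum_(i < n) (n - a < i) <= a)%N.
Proof.
move=> an; have H j : (\sum_(i < j) (n - a < i) <= j - (n - a))%N.
  elim: j => [|j IH]; first by rewrite big_ord0.
  rewrite big_ord_recr /=; move: IH; move: (\sum_(i < j) _)%N => S; have [] := ltnP (n - a) j; lia.
by apply: leq_trans (H n) _; lia.
Qed.

(** A block of length [al l] has at most [2 s l] bad positions. The onset makes the bound valid for
    all [x]: below it nothing is blocked, and beyond it the number of blocks met, [x %/ al l + 1],
    is at most [2 x / al l]. *)
Lemma blocked_count l x : (al l * \sum_(1 <= n < x.+1) ~~ clear l n <= 4 * s l * x)%N.
Proof.
have [xl|lx] := ltnP x (al l + l).
  rewrite big_nat big1 ?muln0 // => n /andP[_ nx].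
  by rewrite /clear (leq_ltn_trans _ xl).
have h1 : (\sum_(1 <= n < x.+1) ~~ clear l n <=
    \sum_(n < (x %/ al l).+1 * al l) ~~ (s l <= n %% al l <= al l - s l))%N.
  apply: (@leq_trans (\sum_(n < x.+1) ~~ (s l <= n %% al l <= al l - s l))).
    rewrite -(big_mkord xpredT (fun n => nat_of_bool (~~ (s l <= n %% al l <= al l - s l)%N))).
    rewrite [leqRHS]big_ltn // -[leqLHS]add0n; apply: leq_add => //.
    apply: leq_sum => n _; rewrite /clear negb_or; case: (_ < _)%N => //.
  have xE : (x < (x %/ al l).+1 * al l)%N by rewrite ltn_ceil.
  by rewrite -(subnKC xE) [leqRHS]big_split_ord /= leq_addr.
have h2 : (\sum_(n < (x %/ al l).+1 * al l) ~~ (s l <= n %% al l <= al l - s l) <=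
    (x %/ al l).+1 * (2 * s l))%N.
  rewrite (sum_blocks (fun n => nat_of_bool (~~ (s l <= n %% al l <= al l - s l)%N))).
  rewrite -[leqRHS]/((x %/ al l).+1 * (2 * s l))%N -[X in (_ <= X * _)%N]card_ord -sum_nat_const.
  apply: leq_sum => j _; apply: (@leq_trans (\sum_(i < al l) ((i < s l) + (al l - s l < i)))%N).
    apply: leq_sum => i _; rewrite modnMDl modn_small // negb_and -!ltnNge.
    by case: (_ < s l)%N; case: (_ < i)%N.
  rewrite big_split /= mul2n -addnn; apply: leq_add; last exact: sum_above_le_nat.
  by apply: leq_trans (sum_below_le_nat _ _) (geq_minr _ _).
have h3 : ((x %/ al l).+1 * al l <= 2 * x)%N.
  by have := leq_trunc_div x (al l); rewrite mulSn; lia.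
apply: leq_trans (leq_mul (leqnn (al l)) (leq_trans h1 h2)) _.
by rewrite mulnCA mulnA; apply: leq_trans (leq_mul h3 (leqnn _)) _; lia.
Qed.

(** Four consecutive multiples of [al k] contain a positively signed one; the [2] pays for [n = 0]
    and for the incomplete last group. *)
Lemma signed_count k x :
  (x < ((\sum_(1 <= n < x.+1) ((al k %| n) && sgn (n %/ al k))) + 2) * (4 * al k))%N.
Proof.
set A := (4 * al k)%N; have A0 : (0 < A)%N by rewrite muln_gt0 al0.
pose g n := nat_of_bool ((al k %| n) && sgn (n %/ al k))%N.
have h1 : (x %/ A <= \sum_(n < x %/ A * A) g n)%N.
  rewrite (sum_blocks g) -[X in (X <= _)%N](card_ord (x %/ A)) -sum1_card; apply: leq_sum => j _.
  have [i i4 si] := sgn_dense j.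
  have iA : (i * al k < A)%N by rewrite /A ltn_pmul2r.
  rewrite (bigD1 (Ordinal iA)) //= /g.
  have -> : (j * A + i * al k = (4 * j + i) * al k)%N by rewrite /A; ring.
  by rewrite dvdn_mull // mulnK // si.
have h2 : (\sum_(n < x %/ A * A) g n <= 1 + \sum_(1 <= n < x.+1) g n)%N.
  apply: (@leq_trans (\sum_(n < x.+1) g n)).
    have xE : (x %/ A * A <= x.+1)%N by apply: leq_trans (leq_trunc_div x A) _.
    by rewrite -(subnKC xE) [leqRHS]big_split_ord /= leq_addr.
  rewrite -(big_mkord xpredT g) [leqLHS]big_ltn // leq_add2r /g.
  by case: (_ && _).
have := ltn_ceil x A0; set S := (\sum_(1 <= n < x.+1) g n)%N in h2 *.
rewrite -/S => h3; apply: leq_trans h3 _; rewrite leq_mul2r; apply/orP; right; lia.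
Qed.

Lemma al_le k l : (k <= l)%N -> (al k <= al l)%N.
Proof. by move=> kl; apply: (homo_leq (r := leq)) kl => //; exact: leq_trans. Qed.

Variable R : realType.

(** Put [y = x / (16 al k)]. There are at least [4 y - 2] positively signed multiples; the later
    layers block at most [y] of them and [n1] are discarded at the start. For [y >= n1 + 2] at least
    [2 y] remain, which is density [1 / (8 al k)]. *)
Lemma visits_dense k n1 (A : set nat) :
  (forall n q, (0 < n)%N -> (n1 <= n)%N -> n = (q * al k)%N -> sgn q ->
     (forall l, (k < l)%N -> clear l n) -> A n) ->
  (0 < lower_density R A)%E.
Proof.
move=> HA; apply/lower_density_gt0P.
have ak : 0 < (al k)%:R :> R by rewrite ltr0n.
exists (8 * (al k)%:R)^-1; first by rewrite invr_gt0 mulr_gt0.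
exists (16 * (al k) * (n1 + 2))%N => x xn.
pose g n := nat_of_bool ((al k %| n) && sgn (n %/ al k))%N.
have pw n : (1 <= n < x.+1)%N -> (g n <= `[< A n >] + (n < n1) +
    \sum_(k.+1 <= l < x.+1) ~~ clear l n)%N.
  move=> /andP[n0 nx]; rewrite /g; case: andP => // -[/dvdnP[q nq] sq].
  have [//|n1n] := ltnP n n1; first by rewrite addn1.
  have [/hasP[l lin bl]|/hasPn H] := boolP (has (fun l => ~~ clear l n) (index_iota k.+1 x.+1)).
    by rewrite (big_rem l) //= bl addnCA.
  suff /asboolP -> : A n by [].
  apply: (HA n q) => //; first by move: sq; rewrite nq mulnK.
  (* Layers [l > x] need no check: [n <= x < l] precedes the onset [al l + l]. Hence finitely many
     [l] are summed. *)
  move=> l kl; have [lx|xl] := leqP l x.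
    by apply/negbNE/H; rewrite mem_index_iota kl.
  by rewrite /clear (leq_trans _ (leq_addl _ _)) // (leq_trans nx).
have tot : (\sum_(1 <= n < x.+1) g n <= count_upto A x + n1 +
    \sum_(k.+1 <= l < x.+1) \sum_(1 <= n < x.+1) ~~ clear l n)%N.
  apply: (@leq_trans (\sum_(1 <= n < x.+1) (`[< A n >] + (n < n1) +
    \sum_(k.+1 <= l < x.+1) ~~ clear l n))%N).
    by rewrite big_nat [leqRHS]big_nat; apply: leq_sum => n; exact: pw.
  rewrite !big_split /= [in leqRHS]exchange_big /= leq_add2r leq_add2l.
  apply: (@leq_trans (\sum_(n < x.+1) (n < n1))%N).
    by rewrite -(big_mkord xpredT (fun n => nat_of_bool (n < n1)%N)) [leqRHS]big_ltn // leq_addl.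
  by apply: leq_trans (sum_below_le_nat _ _) (geq_minr _ _).
have bad : (\sum_(k.+1 <= l < x.+1) \sum_(1 <= n < x.+1) ~~ clear l n)%:R <=
    x%:R / (16 * (al k)%:R) :> R.
  rewrite natr_sum; apply: (@le_trans _ _ (\sum_(k.+1 <= l < x.+1) x%:R / (16 * (al k)%:R) * 2^-1 ^+ l)).
    rewrite big_nat [leRHS]big_nat; apply: ler_sum => -[//|l] /andP[kl _].
    rewrite -(ler_pM2l (_ : 0 < (al l.+1)%:R)) ?ltr0n //.
    apply: (@le_trans _ _ (4 * (s l.+1)%:R * x%:R)).
      by have := blocked_count l.+1 x; rewrite -(ler_nat R) !natrM.
    (* In [gap], [l + 7 = (l + 1) + 6] and [2^6 = 4 * 16]: the 4 is that of [blocked_count] and the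
       16 that of the target [x / (16 al k)]. *)
    have h : (4 * s l.+1 * (2 ^ l.+1 * (16 * al k)) <= al l.+1)%N.
      apply: leq_trans (gap l); have akl := al_le (kl : (k <= l)%N).
      rewrite (_ : (l + 7 = l.+1 + 6)%N) ?expnD; last by rewrite addSn -addnS.
      apply: leq_trans (leq_mul (leqnn (s l.+1 * (2 ^ l.+1 * 2 ^ 6))%N) akl).
      by rewrite leq_eqVlt; apply/orP; left; apply/eqP; ring.
    have p0 : 0 < (2 ^ l.+1 * (16 * al k))%:R :> R by rewrite ltr0n !muln_gt0 expn_gt0 al0.
    have -> : (al l.+1)%:R * (x%:R / (16 * (al k)%:R) * 2^-1 ^+ l.+1) =
       x%:R * ((al l.+1)%:R / (2 ^ l.+1 * (16 * al k))%:R) :> R.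
      rewrite exprVn natrM natrX natrM; field.
      by rewrite expf_neq0 // gt_eqF.
    rewrite mulrC; apply: ler_wpM2l => //; rewrite ler_pdivlMr // -!natrM ler_nat.
    exact: h.
  rewrite -mulr_sumr ler_piMr ?divr_ge0 ?mulr_ge0 //.
  apply: le_trans (sum_halfS_le R x); rewrite -(big_mkord xpredT (fun l => 2^-1 ^+ l.+1)).
  have F0 i : 0 <= 2^-1 ^+ i :> R by exact: exprn_ge0.
  have [xk|kx] := leqP x k; first by rewrite [leLHS]big_geq //; apply: sumr_ge0.
  rewrite -(big_add1 _ _ 0%N x.+1 xpredT (fun l => 2^-1 ^+ l)) (@big_cat_nat _ _ _ k.+1 1) //=.
  by rewrite lerDr; apply: sumr_ge0.
  exact: ltnW.
have sc : x%:R <= ((\sum_(1 <= n < x.+1) g n)%:R + 2) * (4 * (al k)%:R) :> R.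
  have /ltnW := signed_count k x; rewrite -(ler_nat R) natrM natrD natrM; exact.
have tot' : (\sum_(1 <= n < x.+1) g n)%:R <= (count_upto A x)%:R + n1%:R +
   x%:R / (16 * (al k)%:R) :> R.
  by apply: le_trans (lerD (lexx _) bad); rewrite -!natrD ler_nat.
have xn' : 16 * (al k)%:R * (n1%:R + 2) <= x%:R :> R.
  by rewrite -(natrD _ n1 2) -!natrM ler_nat.
pose y : R := x%:R / (16 * (al k)%:R).
have xE : x%:R = y * (16 * (al k)%:R) by rewrite divfK // mulf_neq0 // gt_eqF.
have y1 : n1%:R + 2 <= y by rewrite ler_pdivlMr ?mulr_gt0 // mulrC.
have y2 : 4 * y <= (\sum_(1 <= n < x.+1) g n)%:R + 2.
  rewrite -(@ler_pM2r _ (4 * (al k)%:R)) ?mulr_gt0 //; apply: le_trans sc; rewrite xE.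
  by rewrite le_eqVlt; apply/orP; left; apply/eqP; ring.
have -> : (8 * (al k)%:R)^-1 * x%:R = 2 * y by rewrite /y; field; rewrite gt_eqF.
move: y1 y2 tot'; rewrite -/y.
move: (\sum_(1 <= n < x.+1) g n)%:R (count_upto A x)%:R n1%:R => u v w; move: {xE} y => y; lra.
Qed.

End Counting.

(** * Rational polynomials and the compact-open topology *)

Section Density.
Variable R : realType.
Local Notation C := (Cfield R).

Lemma half_pow_small (x : R) : 0 < x -> exists n0, forall n, (n0 <= n)%N -> 2^-1 ^+ n <= x.
Proof.
move=> x0; have [L HL] := exists_nat_ge x^-1; exists L => n Ln.
rewrite exprVn -[leRHS]invrK lef_pV2 ?posrE ?invr_gt0 ?exprn_gt0 //.
apply: (le_trans HL); rewrite -natrX ler_nat; apply: (leq_trans Ln).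
exact/ltnW/ltn_expl.
Qed.

Definition closeness (g : C -> C) n : set (C -> C) :=
  [set h | forall z, modulus z <= n%:R -> modulus (h z - g z) <= 2^-1 ^+ n].

(** The sets [closeness g n] form the base of a filter converging to [g], which therefore contains
    [O]. Convergence need only be checked on pairs of a compact set and an open set. *)
Lemma compact_open_nbhd (g : C -> C) (O : set {compact-open, C -> C}) : entire g ->
  open O -> O g -> exists n, closeness g n `<=` O.
Proof.
move=> eg oO Og; pose F := filter_from [set: nat] (closeness g).
have anti i j : (i <= j)%N -> closeness g j `<=` closeness g i.
  move=> ij h H z zi; apply: (@le_trans _ _ (2^-1 ^+ j)).
    by apply: H; apply: (le_trans zi); rewrite ler_nat.
  by rewrite -(subnKC ij) exprD ler_piMr ?exprn_ge0 // exprn_ile1 // invf_le1 // ler1n.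
have FF : Filter F.
  apply: filter_fromT_filter; first by exists 0%N.
  move=> i j; exists (maxn i j) => h Hh.
  by split; [apply: (anti i) Hh | apply: (anti j) Hh]; rewrite leq_max leqnn ?orbT.
have cF : {compact-open, F --> g}.
  apply/compact_open_cvgP => K V cK oV gKV.
  (* Compactness in its near-covering form reduces the claim to points [v] near a fixed [x], where
     continuity of [g] uses half of the margin [e] and the approximation the other half. *)
  pose Q (n : nat) v := modulus v <= n%:R /\ forall w, modulus (w - g v) <= 2^-1 ^+ n -> V w.
  have : \forall n \near \oo, K `<=` Q n.
    have /compact_near_coveringP := cK; apply => x Kx.
    have Vx : nbhs (g x) V by apply: open_nbhs_nbhs; split=> //; apply: gKV; exists x.
    move/nbhs_modulusP: Vx => [e e0 He]; have e20 : 0 < e / 2 by rewrite divr_gt0.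
    have [d d0 Hd] := cderiv_continuous (derivable_cderiv (eg x)) e20.
    have [n1 Hn1] : exists n1, forall n, (n1 <= n)%N -> 2^-1 ^+ n < e / 2.
      have [n1 H] := half_pow_small (divr_gt0 e20 (ltr0Sn R 1)); exists n1 => n /H /le_lt_trans; apply.
      by rewrite ltr_pdivrMr // ltr_pMr // ltr1n.
    have [n2 Hn2] := exists_nat_ge (modulus x + d).
    exists ([set v | modulus (v - x) < d], [set n | (maxn n1 n2 <= n)%N]).
      split=> /=; first by apply/nbhs_modulusP; exists d.
      by exists (maxn n1 n2).
    move=> [v n] /= [vx]; rewrite geq_max => /andP[n1n n2n]; split.
      have : modulus v <= modulus x + modulus (v - x).
        by rewrite -{1}(subrK x v) addrC modulusD.
      move: Hn2 vx; have : n2%:R <= n%:R :> R by rewrite ler_nat.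
      lra.
    move=> w wv; apply: He.
    have : modulus (w - g x) <= modulus (w - g v) + modulus (g v - g x).
      by apply: le_trans (modulusD _ _); rewrite addrA subrK.
    by have := Hd _ vx; have := Hn1 n n1n; lra.
  move=> [n _ /(_ n (leqnn n)) Hn]; exists n => // h Hh _ [v Kv <-].
  by have [vn HV] := Hn v Kv; apply/HV/Hh.
have [n _ Hn] : F O by apply: cF; exact: open_nbhs_nbhs.
by exists n.
Qed.

Definition rational_complex (q : rat * rat) : C := Complex (ratr q.1) (ratr q.2).

Lemma rational_complex_dense (z : C) (e : R) : 0 < e ->
  exists q, modulus (rational_complex q - z) <= e.
Proof.
move=> e0; have e20 : 0 < e / 2 by rewrite divr_gt0.
have H (x : R) : exists q : rat, `|ratr q - x| <= e / 2.
  have [|q] := @rat_in_itvoo R (x - e / 2) (x + e / 2); first by lra.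
  by rewrite in_itv /= => /andP[h1 h2]; exists q; rewrite ler_norml; apply/andP; split; lra.
have [q1 H1] := H (complex.Re z); have [q2 H2] := H (complex.Im z).
exists (q1, q2); apply: le_trans (modulus_le_ReIm _) _.
by rewrite CReB CImB /= (le_trans (lerD H1 H2)) //; lra.
Qed.

(* Every finite sequence is decoded from infinitely many codes. *)
Definition code_coeffs (l : nat) : seq (rat * rat) := odflt [::] (unpickle (logn 2 l)).

Lemma code_coeffs_recurs (q : seq (rat * rat)) M : exists2 l, (M <= l)%N & code_coeffs l = q.
Proof.
(* Only the exponent of 2 is decoded; the power of 3 makes the code as large as desired. *)
exists (2 ^ pickle q * 3 ^ M)%N.
  apply: (@leq_trans (3 ^ M)); first exact/ltnW/ltn_expl.
  by rewrite leq_pmull // expn_gt0.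
rewrite /code_coeffs lognM ?expn_gt0 // pfactorK // lognX (_ : logn 2 3 = 0%N) //.
by rewrite muln0 addn0 pickleK.
Qed.

Definition rational_poly l i : C := rational_complex (nth (0, 0) (code_coeffs l) i).

Lemma rational_poly0 l i : (size (code_coeffs l) <= i)%N -> rational_poly l i = 0.
Proof.
by move=> h; rewrite /rational_poly nth_default //; apply: complex_ext; rewrite /= rmorph0.
Qed.

Lemma rational_poly_approx (g : C -> C) n (e : R) M : entire g -> 0 < e ->
  exists2 l, (M <= l)%N & forall z, modulus z <= n%:R ->
    modulus (egf (rational_poly l) z - g z) <= e.
Proof.
move=> /entire_egfP[b cb ->] e0; have e20 : 0 < e / 2 by rewrite divr_gt0.
have n0 : 0 <= n%:R :> R by [].
have [K HK] := cb _ n0.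
have [j /(_ j (leqnn j)) Hj] := @bounded_sum_tail R (fun k => modulus (b k) * ew n%:R k) K
  (fun k => mulr_ge0 (modulus_ge0 _) (ew_ge0 k n0)) HK (e / 2) e20.
have d0 : 0 < e / 2 / expR n%:R by rewrite divr_gt0 ?expR_gt0.
have [q Hq] := choice (fun i => rational_complex_dense (b i) d0).
have [l Ml dl] := code_coeffs_recurs (mkseq q j) M; exists l => // z zn.
have Pq i : (i < j)%N -> rational_poly l i = rational_complex (q i).
  by move=> ij; rewrite /rational_poly dl nth_mkseq.
have P0 i : (j <= i)%N -> rational_poly l i = 0.
  by move=> ji; apply: rational_poly0; rewrite dl size_mkseq.
have cP : entire_coeffs (rational_poly l).
  move=> rho rho0; exists (\sum_(i < j) modulus (rational_poly l i) * ew rho i) => k.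
  have nn i : 0 <= modulus (rational_poly l i) * ew rho i by rewrite mulr_ge0 ?modulus_ge0 ?ew_ge0.
  have [kj|jk] := leqP k j.
    by rewrite -(subnKC kj) [leRHS]big_split_ord /= lerDl; apply: sumr_ge0.
  rewrite -(subnKC (ltnW jk)) big_split_ord /= [X in _ + X]big1 ?addr0 // => i _.
  by rewrite P0 ?leq_addr // modulus0 mul0r.
have := egf_lin 1 (-1) z cP cb; rewrite !mul1r mulN1r => <-.
have step k : \sum_(i < k) modulus (rational_poly l i - b i) * ew n%:R i <= e.
  apply: (@le_trans _ _ (\sum_(i < j + k) modulus (rational_poly l i - b i) * ew n%:R i)).
    rewrite addnC [leRHS]big_split_ord /= lerDl; apply: sumr_ge0 => i _.
    by rewrite mulr_ge0 ?modulus_ge0 ?ew_ge0.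
  rewrite big_split_ord /= [leRHS](_ : e = e / 2 + e / 2); last by lra.
  apply: lerD.
    apply: (@le_trans _ _ (e / 2 / expR n%:R * \sum_(i < j) ew n%:R i)).
      rewrite mulr_sumr; apply: ler_sum => i _; apply: ler_wpM2r; first exact: ew_ge0.
      by rewrite Pq.
    by rewrite -[leRHS](divfK (lt0r_neq0 (expR_gt0 n%:R))) ler_wpM2l ?(ltW d0) // sum_ew_le.
  apply: le_trans (Hj k); apply: ler_sum => i _.
  by rewrite P0 ?leq_addr // sub0r modulusN.
apply/csum_le/egf_summable => k; apply: le_trans (step k); apply: ler_sum => i _.
rewrite mul1r mulN1r; apply: ler_wpM2l; first exact: modulus_ge0.
by apply: ler_ew => //; exact: modulus_ge0.
Qed.

End Density.

(** * Choice of the parameters *)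

Section Existence.
Variable R : realType.
Local Notation C := (Cfield R).

Lemma ramp_defect_small (B : nat -> R) N k : (forall l, 0 <= B l) -> (forall l, (0 < N l)%N) ->
  exists n1, forall n, (n1 <= n)%N -> ramp_defect B N k n <= 2^-1 ^+ k.
Proof.
move=> B0 N0; rewrite /ramp_defect.
suff H (j : nat) (e : R) : 0 < e -> exists n1, forall n, (n1 <= n)%N ->
    \sum_(l < j) (1 - (N l)%:R^-1) ^+ n * (2 * B l) * expR k%:R <= e.
  by apply: H; rewrite exprn_gt0.
elim: j e => [|j IH] e e0; first by exists 0%N => n _; rewrite big_ord0 ltW.
have e20 : 0 < e / 2 by rewrite divr_gt0.
have [n1 H1] := IH _ e20.
set q := 1 - (N j)%:R^-1 : R; have /andP[q0 q1] := ramp_base R (N0 j).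
have q1' : `|q| < 1 by rewrite ger0_norm // /q gtrBl invr_gt0 ltr0n.
pose X := 2 * B j * expR k%:R + 1; have X0 : 0 < X by rewrite ltr_wpDl // !mulr_ge0 ?expR_ge0.
move/cvgrPdist_lt: (cvg_expr q1') => /(_ _ (divr_gt0 e20 X0)) [n2 _ H2].
exists (maxn n1 n2) => n; rewrite geq_max => /andP[n1n n2n].
rewrite big_ord_recr /=; have h2 : q ^+ n <= e / 2 / X.
  have := H2 n n2n; rewrite sub0r normrN ger0_norm ?exprn_ge0 //; exact: ltW.
apply: le_trans (lerD (H1 n n1n) _) (_ : e / 2 + e / 2 <= e); last by lra.
rewrite -/q -mulrA; apply: (@le_trans _ _ (e / 2 / X * X)); last by rewrite divfK ?gt_eqF.
apply: ler_pM; rewrite ?exprn_ge0 ?mulr_ge0 ?expR_ge0 //.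
by rewrite /X lerDl.
Qed.

(** The order of the choices matters: sizes [B], effective lengths [s], allotted means [eta], then
    the exponents [m] by recursion, and last the ramps [N], for which [negligible_classes] only sets
    a lower bound. *)
Lemma frequently_hypercyclic_bounded (E : set (nat -> R)) (e0 : nat -> R) (p : \bar R)
    (T : R -> R) (c : R) :
  (forall e, E e -> unit_signs e) ->
  (forall e (b : bool), E e -> E (fun j => e (j.*2 + b)%N)) ->
  E e0 -> (forall j, exists2 i, (i < 4)%N & e0 (4 * j + i)%N = 1) ->
  (1%:E <= p)%E -> (forall r, 0 < r -> 0 < T r) -> 0 < c -> negligible_classes E p T ->
  exists f : C -> C, [/\ entire f, D_frequently_hypercyclic f &
    forall r, 0 < r -> Lp_mean p f r <= c * T r].
Proof.
move=> Eunit Esample Ee0 plus p1 T0 c0 negl; pose P := @rational_poly R.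
pose S j := \sum_(i < size (code_coeffs j)) modulus (P j i).
have S0 j : 0 <= S j by apply: sumr_ge0 => i _; exact: modulus_ge0.
have PS j i : modulus (P j i) <= S j.
  have [h|h] := ltnP i (size (code_coeffs j)); last by rewrite /P rational_poly0 // modulus0.
  by rewrite /S (bigD1 (Ordinal h)) //= lerDl; apply: sumr_ge0 => k _; exact: modulus_ge0.
pose B l := 1 + \sum_(j < l.+1) S j.
have B1 l : 1 <= B l by rewrite lerDl; apply: sumr_ge0.
have B0 l : 0 <= B l by apply: le_trans (B1 l).
have PB l j i : (j <= l)%N -> modulus (P j i) <= B l.
  move=> jl; apply: (le_trans (PS j i)); rewrite /B (bigD1 (Ordinal (jl : (j < l.+1)%N))) //= addrCA lerDl.
  by rewrite addr_ge0 //; apply: sumr_ge0.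
have Hs l : exists s, (forall i, (s <= i)%N -> P l i = 0) /\
    forall M, \sum_(i < M) (s <= i)%N%:R * (2 * B l * ew l%:R i) <= 2^-1 ^+ l :> R.
  have v0 i : 0 <= 2 * B l * ew (l%:R : R) i by rewrite !mulr_ge0 ?ew_ge0.
  have vB n : \sum_(i < n) 2 * B l * ew (l%:R : R) i <= 2 * B l * expR l%:R.
    by rewrite -mulr_sumr ler_wpM2l ?mulr_ge0 // sum_ew_le.
  have h20 : 0 < 2^-1 :> R by rewrite invr_gt0.
  have [n0 Hn] := bounded_sum_tail v0 vB (exprn_gt0 l h20).
  exists (maxn n0 (size (code_coeffs l))); split=> [i|M].
    by rewrite geq_max => /andP[_ h]; exact: rational_poly0.
  set s := maxn _ _; have n0s : (n0 <= s)%N by rewrite leq_maxl.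
  apply: le_trans (Hn s n0s M).
  apply: (@le_trans _ _ (\sum_(i < s + M) (s <= i)%N%:R * (2 * B l * ew l%:R i))).
    by rewrite addnC [leRHS]big_split_ord /= lerDl; apply: sumr_ge0 => i _; rewrite mulr_ge0.
  rewrite big_split_ord /= big1 ?add0r => [|i _]; last by rewrite leqNgt ltn_ord mul0r.
  by apply: ler_sum => i _; rewrite leq_addr mul1r.
have [s Hs'] := choice Hs.
have Ps l i : (s l <= i)%N -> P l i = 0 by have [h _] := Hs' l; exact: h.
have Bs l M : \sum_(i < M) (s l <= i)%N%:R * (2 * B l * ew l%:R i) <= 2^-1 ^+ l.
  by have [_ h] := Hs' l; exact: h.
(* The mean allotted to one class, so that the layers together stay below [c T]. *)
pose eta l := c * 2^-1 ^+ l.+1 / ((s l).+1%:R * (2 * B l)).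
have D0 l : 0 < (s l).+1%:R * (2 * B l) by rewrite !mulr_gt0 ?ltr0n // (lt_le_trans ltr01).
have eta0 l : 0 < eta l by rewrite divr_gt0 // mulr_gt0 ?exprn_gt0.
have eta_le l : (s l).+1%:R * (2 * B l * eta l) <= c * 2^-1 ^+ l.+1.
  by rewrite mulrA mulrC divfK // gt_eqF.
have Hmn (la : nat * nat) : exists mn : nat * nat, (la.2 <= 2 ^ mn.1)%N /\ forall N, (mn.2 <= N)%N ->
    forall e i r, E e -> (i < 2 ^ mn.1)%N -> 0 < r ->
      Lp_mean p (egf (residue_coeffs e (2 ^ mn.1) i N)) r <= eta la.1 * T r.
  by have [m [N0 H]] := negl _ la.2 (eta0 la.1); exists (m, N0).
have [F HF] := choice Hmn.
(* Lower bound for [al l] in terms of the preceding exponent: room for [P l], monotonicity, and the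
   gap that keeps the blocked indices rare. *)
pose a0 l m := maxn (s l) (maxn (2 ^ m) (if l is l'.+1 then s l * 2 ^ (l' + 7) * 2 ^ m else 0))%N.
pose m := fix m l := (F (l, a0 l (if l is l'.+1 then m l' else 0%N))).1.
have mE l : exists a, [/\ (a <= 2 ^ m l)%N, (s l <= a)%N, m l = (F (l, a)).1 &
    forall l', l = l'.+1 -> (2 ^ m l' <= a)%N /\ (s l * 2 ^ (l' + 7) * 2 ^ m l' <= a)%N].
  exists (a0 l (if l is l'.+1 then m l' else 0%N)); split.
  - by have [h _] := HF (l, a0 l (if l is l'.+1 then m l' else 0%N)); case: l h.
  - exact: leq_maxl.
  - by case: l.
  - by move=> l' ->; split; rewrite /a0 !leq_max leqnn ?orbT.
have s_al l : (s l <= 2 ^ m l)%N by have [a [h1 h2 _ _]] := mE l; exact: leq_trans h1.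
have m_mono l : (m l <= m l.+1)%N.
  have [a [h1 _ _ /(_ l erefl)[h2 _]]] := mE l.+1.
  by rewrite -(leq_exp2l (m := 2)) //; exact: leq_trans h1.
have gap l : (s l.+1 * 2 ^ (l + 7) * 2 ^ m l <= 2 ^ m l.+1)%N.
  by have [a [h1 _ _ /(_ l erefl)[_ h2]]] := mE l.+1; exact: leq_trans h1.
have HN l : exists N, [/\ (0 < N)%N, 2 ^+ l.+1 * (2 * B l) <= N%:R :> R,
    2 ^+ l * (2 * B l * ((2 ^ m l + l + l)%:R * expR l%:R)) <= N%:R :> R &
    forall e i r, E e -> (i < 2 ^ m l)%N -> 0 < r ->
      Lp_mean p (egf (residue_coeffs e (2 ^ m l) i N)) r <= eta l * T r].
  have [a [_ _ ml _]] := mE l; have [_ H] := HF (l, a); rewrite -ml in H.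
  have [N1 H1] := exists_nat_ge (2 ^+ l.+1 * (2 * B l)).
  have [N2 H2] := exists_nat_ge (2 ^+ l * (2 * B l * ((2 ^ m l + l + l)%:R * expR l%:R))).
  exists (maxn (maxn 1 (F (l, a)).2) (maxn N1 N2)); split.
  - by rewrite !leq_max.
  - by apply: (le_trans H1); rewrite ler_nat !leq_max leqnn ?orbT.
  - by apply: (le_trans H2); rewrite ler_nat !leq_max leqnn ?orbT.
  - by apply: H; rewrite !leq_max leqnn ?orbT.
have [N HN'] := choice HN.
have N0 l : (0 < N l)%N by have [] := HN' l.
have NB l : 2 ^+ l.+1 * (2 * B l) <= (N l)%:R by have [] := HN' l.
have N_onset l : 2 ^+ l * (2 * B l * ((2 ^ m l + l + l)%:R * expR l%:R)) <= (N l)%:R.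
  by have [] := HN' l.
have Nneg l e i r : E e -> (i < 2 ^ m l)%N -> 0 < r ->
    Lp_mean p (egf (residue_coeffs e (2 ^ m l) i (N l))) r <= eta l * T r.
  by have [_ _ _] := HN' l; exact.
have cf := entire_limit_coeffs s m Eunit Ee0 B1 PB N0 NB.
exists (egf (limit_coeffs e0 P s m N)); split; first exact: entire_egf.
  move=> U [W oW UE] [g]; rewrite UE => -[Wg eg].
  have [j Hj] := compact_open_nbhd eg oW Wg.
  have e0' : 0 < 2^-1 ^+ j / 2 :> R by rewrite divr_gt0 ?exprn_gt0.
  (* With [k >= j + 3], the error [3 * 2^-k] is at most [3/8] of [2^-j], and the polynomial itself
     is within half of [2^-j] of [g]. *)
  have [k jk Hk] := rational_poly_approx j (j + 3) eg e0'.
  have [n1 Hn1] := ramp_defect_small k B0 N0.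
  apply: (@visits_dense (fun l => 2 ^ m l)%N s (fun q => e0 q == 1) _ s_al _ gap _ R k n1).
  - by move=> l; rewrite expn_gt0.
  - by move=> l; rewrite leq_exp2l.
  - by move=> i; have [i' h1 h2] := plus i; exists i' => //; apply/eqP.
  move=> n q npos n1n nq /eqP eq1 clear_n; split; first exact: npos.
  split; last first.
    rewrite (derive1n_egf n cf).
    exact: (entire_egf (entire_coeffs_shiftn n cf)).
  apply: Hj => z zj; have zk : modulus z <= k%:R.
    by apply: (le_trans zj); rewrite ler_nat; apply: leq_trans jk; exact: leq_addr.
  have := derivatives_near Eunit Ee0 B1 PB Ps N0 NB s_al Bs N_onset nq eq1 (Hn1 n n1n) clear_n zk.
  have := Hk z zj; set D := derive1n _ _ z => h1 h2.
  have h3 : 2^-1 ^+ k <= 2^-1 ^+ j / 8 :> R.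
    rewrite -(subnKC jk) -addnA exprD; apply: ler_wpM2l; first exact: exprn_ge0.
    rewrite exprD (_ : 8^-1 = 2^-1 ^+ 3); last by field.
    by rewrite ler_piMr ?exprn_ge0 // exprn_ile1 // invf_le1 // ler1n.
  have -> : D - g z = (D - egf (P k) z) + (egf (P k) z - g z) by rewrite addrA subrK.
  apply: le_trans (modulusD _ _) (le_trans (lerD h2 h1) _).
  have : 0 <= 2^-1 ^+ j :> R by rewrite exprn_ge0.
  by move: h3; move: (2^-1 ^+ k) (2^-1 ^+ j) => x y; lra.
move=> r r0; exact: (limit_mean Eunit Esample Ee0 B1 PB m_mono N0 NB p1 T0 c0 eta0 eta_le s_al Nneg r0).
Qed.

End Existence.

Theorem theorem1p1 (R : realType) :
  (* (i) *)
  ((forall c : R, 0 < c ->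
      exists f : Cfield R -> Cfield R,
        [/\ entire f, D_frequently_hypercyclic f &
          forall r : R, 0 < r ->
            max_modulus f r <= c * (expR r / r `^ (1 / 4))]) /\
   (forall f : Cfield R -> Cfield R, entire f -> D_frequently_hypercyclic f ->
      (0 < limsup_pinfty
             (fun r : R => r `^ (1 / 4) * expR (- r) * max_modulus f r)%R)%E)) /\
  (* (ii) *)
  ((forall (c : R) (p : \bar R), 0 < c -> (1 < p)%E ->
      exists f : Cfield R -> Cfield R,
        [/\ entire f, D_frequently_hypercyclic f &
          forall r : R, 0 < r ->
            Lp_mean p f r <= c * (expR r / r `^ growth_exponent p)]) /\
   (forall p : \bar R, (1 < p)%E ->
      forall f : Cfield R -> Cfield R, entire f -> D_frequently_hypercyclic f ->
      (0 < limsup_pinfty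
             (fun r : R =>
                r `^ growth_exponent p * expR (- r) * Lp_mean p f r)%R)%E)) /\
  (* (iii) *)
  ((forall phi : R -> R,
      (forall r : R, 0 < r -> 1 <= phi r) ->
      (forall r s : R, 0 < r -> r <= s -> phi r <= phi s) ->
      phi r @[r --> +oo] --> +oo ->
      exists f : Cfield R -> Cfield R,
        [/\ entire f, D_frequently_hypercyclic f &
          forall r : R, 0 < r ->
            Lp_mean 1%:E f r <= phi r * (expR r / r `^ (1 / 2))]) /\
   (forall f : Cfield R -> Cfield R, entire f -> D_frequently_hypercyclic f ->
      limsup_pinfty
        (fun r : R => r `^ (1 / 2) * expR (- r) * Lp_mean 1%:E f r) = +oo%E)).
Proof.
have existence p T c : negligible_classes (@rs_family R) p T \/
    negligible_classes [set (fun=> 1) : nat -> R] p T ->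
    (1%:E <= p)%E -> (forall r, 0 < r -> 0 < T r) -> 0 < c ->
    exists f : Cfield R -> Cfield R, [/\ entire f, D_frequently_hypercyclic f &
      forall r, 0 < r -> Lp_mean p f r <= c * T r].
  move=> [|] negl p1 T0 c0.
    apply: (frequently_hypercyclic_bounded (e0 := rs_sign R false false) _ _ _ _ p1 T0 c0 negl).
    - exact: rs_unit.
    - exact: rs_family_sample.
    - by exists false, false.
    - exact: rs_sign_plus.
  apply: (frequently_hypercyclic_bounded (e0 := fun=> 1) _ _ _ _ p1 T0 c0 negl) => //.
  - by move=> e ->; exact: one_unit.
  - by move=> e b ->.
  - by move=> j; exists 0%N.
have T0 a (r : R) : 0 < r -> 0 < expR r / r `^ a.
  by move=> r0; rewrite divr_gt0 ?expR_gt0 ?powR_gt0.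
have two_inf : (2%:E <= +oo :> \bar R)%E by exact: leey.
have one_inf : (1%:E <= +oo :> \bar R)%E by exact: leey.
split; [|split].
(* The case [p = +oo], where [Lp_mean] is [max_modulus] by definition. *)
- split=> [c c0|f ef Hf]; first exact: existence (or_introl (negligible_rs one_inf)) _ (T0 _) c0.
  have := optimal_Lp (ltey_eq _ : (1%:E < +oo)%E) ef Hf.
  by rewrite /growth_exponent two_inf.
- split=> [c p c0 p1|p p1 f ef Hf]; last exact: optimal_Lp.
  rewrite /growth_exponent; case: ifP => [p2|/negbT p2].
    exact: existence (or_introl (negligible_rs (ltW p1))) (ltW p1) (T0 _) c0.
  move: p p1 p2 => [p| |] //; last by rewrite leey.
  rewrite lte_fin lee_fin -ltNge => p1 p2.
  apply: existence (or_intror (negligible_small_p p1 (ltW p2))) _ (T0 _) c0.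
  by rewrite lee_fin ltW.
- split=> [phi phi1 _ phioo|f ef Hf]; last exact: optimal_one.
  (* Here [phi] belongs to the scale [T], so the constant is 1. *)
  have [|r r0|f [ef Hf fT]] := existence _ _ _ (or_intror (negligible_one phi1 phioo)) _ _ ltr01.
  + by rewrite lee_fin.
  + by rewrite mulr_gt0 ?T0 // (lt_le_trans ltr01) // phi1.
  by exists f; split=> // r r0; rewrite -[leRHS]mul1r; exact: fT.
Qed.
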